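(* Let $X$ be a centered stationary Gaussian process on $\mathbb{R}$ whose spectral measure $\mu$ is a symmetric Borel probability measure on $\mathbb{R}$ which has a nontrivial absolutely continuous part with respect to Lebesgue measure, and all of whose moments $C_n$ are finite. Then there exist constants $c>0$ and $b,B\in(0,1)$ such that for every $\epsilon\in(0,1/2)$, every $n\in\mathbb{N}$ with $n\ge 1/\epsilon^2$ and every $T\in(0,b\lfloor \epsilon n\rfloor)$ satisfying $$\frac{B}{D_n^{1/n}}\left(\frac{n}{T}\right)^{1-2\epsilon}\ge e,$$ we have $$\exp\left(-n^2\log(cn/T)\right)\le \mathbb{P}(\mathscr{N}_T\ge n)\le 2\exp\left\{-\frac{\epsilon n^2}{2}\log\left(\frac{B}{D_n^{1/n}}\left(\frac{n}{T}\right)^{1-2\epsilon}\right)\right\}.$$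
   Context: The spectral measure $\mu$ of a centered stationary Gaussian process $X$ on $\mathbb{R}$ is the measure such that $\mathbb{E}[X_tX_0]=\widehat{\mu}(t)=\int_{\mathbb{R}}e^{-itx}\,d\mu(x)$. When all moments of $\mu$ are finite, $X$ is smooth (take a version with smooth sample paths). For $n\in\mathbb{N}$, $C_n:=\int_{\mathbb{R}}|x|^n\,d\mu(x)$ and $D_n:=\max\{1,\sqrt{C_{2n}},\sqrt{C_{2n+2}}\}$. For $T>0$, $\mathscr{N}_T:=\#\{x\in[0,T]: X_x=0\}$ is the number of zeros of $X$ in $[0,T]$. ''Symmetric'' means $\mu(-A)=\mu(A)$ for all Borel $A$. *)

(* Defs.v *)
From HB Require Import structures.
From mathcomp Require Import all_boot all_order all_algebra.
From mathcomp Require Import complex.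
From mathcomp Require Import all_classical all_reals all_analysis.

Set Implicit Arguments.
Unset Strict Implicit.
Unset Printing Implicit Defensive.
Import Order.TTheory GRing.Theory Num.Theory.
Import numFieldNormedType.Exports.

Local Open Scope classical_set_scope.
Local Open Scope ring_scope.

Section Process.
Context d (Omega : measurableType d) (R : realType) (P : probability Omega R).

(* The library's [normal_prob m 0] is not a point mass (it is uniform on
   [0, 1]), so the degenerate Gaussian law is given separately. *)
Definition gaussian_law (m s : R) (A : set R) : \bar R :=
  if s == 0 then \d_m A else normal_prob m s A.

Definition gaussian_rv (Y : Omega -> R) : Prop :=
  exists m s : R,
    forall A : set R, measurable A -> P (Y @^-1` A) = gaussian_law m s A.

Variable X : R -> {RV P >-> R}.

Definition gaussian_process : Prop :=
  forall (k : nat) (t a : 'I_k -> R),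
    gaussian_rv (fun w => \sum_(i < k) a i * X (t i) w).

Definition centered : Prop := forall t : R, ('E_P[X t] = 0)%E.

Definition values (k : nat) (t : 'I_k -> R) (w : Omega) : k.-tuple R :=
  [tuple X (t i) w | i < k].

Definition stationary : Prop :=
  forall (k : nat) (t : 'I_k -> R) (s : R) (A : set (k.-tuple R)),
    measurable A ->
    P (values (fun i => t i + s) @^-1` A) = P (values t @^-1` A).

Definition smooth_paths : Prop :=
  forall (w : Omega) (k : nat) (t : R),
    derivable ((fun u => X u w : R)^`(k))%classic t 1.

(* Value in [0, +oo]: infinite when the path has infinitely many zeros. *)
Definition num_zeros (T : R) (w : Omega) : \bar R :=
  counting [set x : R | 0 <= x <= T /\ X x w = 0].

End Process.

Section SpectralMeasure.
Context (R : realType) (mu : {measure set (measurableTypeR R) -> \bar R}).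

Definition expi (y : R) : R[i] := (cos y +i* sin y)%C.

Definition Cintegral (f : R -> R[i]) : R[i] :=
  (\int[mu]_x complex.Re (f x) +i* \int[mu]_x complex.Im (f x))%C.

Definition fourier (t : R) : R[i] := Cintegral (fun x => expi (- (t * x))).

Definition symmetric_measure : Prop :=
  forall A : set (measurableTypeR R), measurable A ->
    mu [set - x | x in A] = mu A.

(* [mu_ac + mu_s] is the Lebesgue decomposition of [mu]. *)
Definition nontrivial_ac_part : Prop :=
  exists mu_ac mu_s : {measure set (measurableTypeR R) -> \bar R},
    [/\ forall A, measurable A -> mu A = (mu_ac A + mu_s A)%E,
        mu_ac `<< lebesgue_measure,
        exists N, [/\ measurable N, lebesgue_measure N = 0%E
                    & mu_s (~` N) = 0%E]
      & mu_ac [set: _] != 0%E].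

Definition finite_moments : Prop :=
  forall n : nat, (\int[mu]_x (`|x| ^+ n)%:E < +oo)%E.

Definition moment (n : nat) : R := \int[mu]_x (`|x| ^+ n).

Definition Dmom (n : nat) : R :=
  Num.max 1 (Num.max (Num.sqrt (moment (2 * n)))
                     (Num.sqrt (moment (2 * n + 2)))).

End SpectralMeasure.

(* The expectation is finite whenever [X] is Gaussian, so [fine] is harmless. *)
Definition is_spectral_measure d (Omega : measurableType d) (R : realType)
    (P : probability Omega R) (X : R -> {RV P >-> R})
    (mu : {measure set (measurableTypeR R) -> \bar R}) : Prop :=
  forall t : R, 
    ((fine 'E_P[fun w => (X t w * X 0%R w)%R]%E)%:C)%C = fourier mu t.

(* Main.v *)
Require Import Defs.
From HB Require Import structures.
From mathcomp Require Import all_boot all_order all_algebra.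
From mathcomp Require Import all_classical all_reals all_analysis.
From mathcomp Require finmap.
From mathcomp Require Import measurable_realfun complex.
From mathcomp Require Import ring lra zify.

(** The variance of a finite combination [\sum_i a_i * X t_i] is the integral
    against [mu] of [trig_sqr a t], the squared modulus of
    [\sum_i a_i e^(i t_i x)]. Both bounds come from two opposite consequences
    of this identity.

    Nondegeneracy ([trig_energy_ge]). Some part of [mu] has a bounded density
    and a bounded support. Its quantiles cut the line into cells of equal mass
    whose mutual distances grow linearly. If a trigonometric polynomial with
    frequencies [0, h, .., m * h] had little energy, it would be small at a
    point of each of [m.+1] such cells, and Lagrange interpolation at these
    points would make all its coefficients small. Hence the covariance matrix
    of the values on a grid of mesh [h] has all its eigenvalues at least
    [k0 * (k * h) ^+ (2 * m)], for every [m] and every small [h].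

    Regularity ([fdiff_second_moment_le]). Since [|e^(i h x) - 1| <= |h x|],
    the [n]-th difference of step [h] has variance at most
    [h ^+ (2 * n) * moment mu (2 * n)].

    Upper bound. If a path has [n] zeros in [0, T], then by Rolle its
    derivative of order [n - 1] vanishes somewhere and by the interpolation
    remainder the path is at most [T ^+ (n - 1) / (n - 1)!] times the supremum
    of that derivative. So either the derivative varies by more than a level
    [M] on [0, T], or the path is tiny at [m] equally spaced points, with [m]
    the integer part of [eps * n]. The first event is controlled by a high
    moment of the total variation of the discretised derivative, uniformly in
    the mesh ([fdiff_variation_tail]); the second one by revealing the [m]
    values one after the other, each of which has, given the previous ones, a
    conditional variance bounded below ([gspace_small_ball_le]). The level [M]
    carries the factor [L ^ (eps * n / 4)], where [L] is the argument of the
    logarithm in the statement: with it both probabilities are at most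
    [L ^ (- eps * n ^ 2 / 2)] ([upper_bound_le]).

    Lower bound. If the values at the [n.+1] points [j * T / n] alternate in
    sign, the intermediate value theorem gives [n] zeros. A suitable
    combination [Z] of these values has covariances with them that alternate in
    sign, and the remainders of the regression on [Z] are independent of [Z]
    and span only [n] dimensions. Asking that [Z] be of order one and that the
    remainders be small has the required probability
    ([gspace_alternating_ge]).

    Uncorrelated members of a Gaussian space have to be independent for these
    arguments. This is derived from the cosine moments: a bounded function [h]
    with [E (h * cos (\sum_i a_i Y_i + b)) = 0] for all [a], [b] keeps this
    property when multiplied by the indicator of an event [Y_i \in S], because
    such indicators are obtained from cosines by products, sums and bounded
    pointwise limits. *)

Set Implicit Arguments.
Unset Strict Implicit.
Unset Printing Implicit Defensive.
Import Order.TTheory GRing.Theory Num.Theory.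
Import numFieldNormedType.Exports.
Local Open Scope classical_set_scope.
Local Open Scope ring_scope.

(** * Integrals against normal laws *)

Section BoundedExpectation.
Context d (T : measurableType d) (R : realType) (Q : probability T R).
Implicit Types (f g : T -> R) (k c : R).

Lemma integrable_bounded f k : measurable_fun setT f ->
  (forall x, `|f x| <= k) -> Q.-integrable setT (EFin \o f).
Proof.
move=> mf fk; apply: measurable_bounded_integrable => //.
  by apply: (le_lt_trans (probability_le1 _ _)) => //; rewrite ltry.
exists k; split; first exact: num_real.
by move=> x kx y _ /=; rewrite (le_trans (fk y))// ltW.
Qed.

Lemma Rintegral_prob_cst c : \int[Q]_x c = c.
Proof. rewrite Rintegral_cst// [X in fine X](_ : _ = 1%E) ?mulr1//.
exact: probability_setT. Qed.

Lemma Rintegral_cstD c f k : measurable_fun setT f -> (forall x, `|f x| <= k) ->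
  \int[Q]_x (c + f x) = c + \int[Q]_x f x.
Proof.
move=> mf fk; rewrite (RintegralD measurableT) ?Rintegral_prob_cst//.
- by apply: (@integrable_bounded _ `|c|) => //.
- exact: (integrable_bounded mf fk).
Qed.

End BoundedExpectation.

Section NormalLaw.
Context (R : realType).
Implicit Types (m s t b u : R).
Local Notation N := (@normal_prob R).
Local Notation leb := (@lebesgue_measure R).

(** The library defines [normal_prob] by its density; the Radon-Nikodym
    derivative turns that into a formula for integrals of nonnegative functions. *)
Lemma ge0_integral_normal_prob m s (f : R -> \bar R) :
  measurable_fun setT f -> (forall x, 0 <= f x)%E ->
  (\int[N m s]_x f x = \int[leb]_x (f x * (normal_pdf m s x)%:E))%E.
Proof.
move=> mf f0.
rewrite -(Radon_Nikodym_SigmaFinite.change_of_variables (normal_prob_dominates m s))//.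
apply: ae_eq_integral => //.
- apply: emeasurable_funM => //.
  exact: measurable_int (Radon_Nikodym_SigmaFinite.f_integrable (normal_prob_dominates m s)).
- apply: emeasurable_funM => //; apply/measurable_EFinP; exact: measurable_normal_pdf.
apply: ae_eqe_mul2l; apply: integral_ae_eq => //.
- exact: Radon_Nikodym_SigmaFinite.f_integrable (normal_prob_dominates m s).
- by apply/measurable_EFinP; exact: measurable_normal_pdf.
- move=> A _ mA.
  by rewrite -Radon_Nikodym_SigmaFinite.f_integral//; exact: normal_prob_dominates.
Qed.

Lemma normal_pdf_tilt m s x : s != 0 ->
  normal_pdf m s x = expR ((m * x - m ^+ 2 / 2) / s ^+ 2) * normal_pdf 0 s x.
Proof.
move=> s0; rewrite !normal_pdfE// /normal_fun mulrCA -expRD; congr (_ * expR _).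
by field.
Qed.

(** Cameron-Martin: shifting the mean amounts to an exponential weight. It
    is used in both directions, as a formula for the shifted law and as a
    formula for exponential moments. *)
Lemma ge0_integral_normal_tilt m s (f : R -> \bar R) : s != 0 ->
  measurable_fun setT f -> (forall x, 0 <= f x)%E ->
  (\int[N m s]_x f x =
   \int[N 0 s]_x (f x * (expR ((m * x - m ^+ 2 / 2) / s ^+ 2))%:E))%E.
Proof.
move=> s0 mf f0; rewrite [LHS]ge0_integral_normal_prob; [|exact: mf|exact: f0].
rewrite [RHS]ge0_integral_normal_prob; first last.
- by move=> x; rewrite mule_ge0// lee_fin expR_ge0.
- apply: emeasurable_funM => //; apply/measurable_EFinP.
  apply: measurableT_comp => //; apply: measurable_funM => //.
  by apply: measurable_funB => //; apply: measurable_funM.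
- apply: eq_integral => x _; rewrite (normal_pdf_tilt m)// EFinM muleA; reflexivity.
Qed.

Lemma normal_mgf s u : s != 0 ->
  (\int[N 0 s]_x (expR (u * x))%:E = (expR (u ^+ 2 * s ^+ 2 / 2))%:E)%E.
Proof.
move=> s0.
have := @ge0_integral_normal_tilt (u * s ^+ 2) s (cst 1%E) s0.
move=> /(_ (measurable_cst _) (fun=> lee01)).
have -> : (\int[N (u * s ^+ 2) s]_x cst 1%E x = 1)%E.
  by rewrite integral_cst// mul1e; exact: probability_setT.
under eq_integral => x _.
  rewrite /cst mul1e (_ : _ / s ^+ 2 = u * x + - (u ^+ 2 * s ^+ 2 / 2)); last by field.
  rewrite expRD EFinM muleC; over.
rewrite ge0_integralZl//=; last first.
  by apply/measurable_EFinP; apply: measurableT_comp => //; apply: measurable_funM.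
move=> /(congr1 (fun y => (expR (u ^+ 2 * s ^+ 2 / 2))%:E * y)%E).
by rewrite mule1 muleA -EFinM -expRD subrr expR0 mul1e.
Qed.

Lemma integrable_expR_normal s u : s != 0 ->
  (N 0 s).-integrable setT (EFin \o (fun x => expR (u * x))).
Proof.
move=> s0; apply/integrableP; split.
  by apply/measurable_EFinP; apply: measurableT_comp => //; apply: measurable_funM.
under eq_integral => x _ do rewrite /= ger0_norm ?expR_ge0//.
by rewrite normal_mgf// ltry.
Qed.

(** An integrable majorant of every polynomial and of every exponential of
    smaller rate, hence a convenient bound for differentiating under normal
    integrals. *)
Definition two_sided_exp u (x : R) := expR (u * x) + expR (- u * x).

Lemma two_sided_exp_ge0 u x : 0 <= two_sided_exp u x.
Proof. by rewrite addr_ge0// expR_ge0. Qed.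

Lemma integrable_two_sided_exp s u k : s != 0 ->
  (N 0 s).-integrable setT (EFin \o (fun x => k * two_sided_exp u x)).
Proof.
move=> s0; rewrite (_ : EFin \o _ =
   (fun x => k%:E * ((EFin \o (fun x => expR (u * x))) x +
             (EFin \o (fun x => expR (- u * x))) x))%E); last first.
  by apply/funext => x /=; rewrite EFinM EFinD.
by apply: integrableZl => //; apply: integrableD => //; exact: integrable_expR_normal.
Qed.

Lemma measurable_two_sided_exp u : measurable_fun setT (two_sided_exp u).
Proof.
by apply: measurable_funD; apply: measurableT_comp => //; apply: measurable_funM.
Qed.

Lemma integrable_le_two_sided_exp s u k (f : R -> R) : s != 0 ->
  measurable_fun setT f -> (forall x, `|f x| <= k * two_sided_exp u x) ->
  (N 0 s).-integrable setT (EFin \o f).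
Proof.
move=> s0 mf fk; apply: (le_integrable measurableT _ _ (integrable_two_sided_exp u k s0)).
- exact/measurable_EFinP.
- by move=> x _; rewrite /= lee_fin (le_trans (fk x))// ler_norm.
Qed.

(** Domination by a two-sided exponential near [a] makes the library's
    differentiation under the integral sign applicable. *)
Lemma is_derive_normal_integral s u k a (f f' : R -> R -> R) : s != 0 ->
  (forall t x, `|t - a| < 1 -> is_derive t 1 (f^~ x) (f' t x)) ->
  (forall t, measurable_fun setT (f t)) ->
  (forall t x, `|t - a| < 1 -> `|f t x| <= k * two_sided_exp u x) ->
  (forall t x, `|t - a| < 1 -> `|f' t x| <= k * two_sided_exp u x) ->
  is_derive a 1 (fun t => \int[N 0 s]_x f t x)%R (\int[N 0 s]_x f' a x)%R.
Proof.
move=> s0 df mf fk f'k.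
have k0 : 0 <= k.
  have := f'k a 0; rewrite subrr normr0 ltr01 => /(_ isT) /(le_trans (normr_ge0 _)).
  rewrite /two_sided_exp !mulr0 expR0; lra.
have E t : `](a - 1), (a + 1)[%classic t -> `|t - a| < 1.
  by rewrite /= in_itv/= ltr_norml => /andP[? ?]; apply/andP; split; lra.
have Ia : `](a - 1), (a + 1)[%classic a.
  by rewrite /= in_itv/=; apply/andP; split; lra.
have intf t : `](a - 1), (a + 1)[%classic t -> (N 0 s).-integrable setT (EFin \o f t).
  move=> /E ta; apply: (integrable_le_two_sided_exp (u := u) (k := k)) => // x.
  exact: fk.
have derf t x : `](a - 1), (a + 1)[%classic t -> setT x -> derivable (f ^~ x) t 1.
  by move=> /E ta _; have [] := df t x ta.
have d1 t x : `|t - a| < 1 -> partial1of2 f t x = f' t x.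
  by move=> ta; rewrite /partial1of2 derive1E; apply: derive_val; exact: df.
have G0 x : 0 <= k * two_sided_exp u x by rewrite mulr_ge0// two_sided_exp_ge0.
have Gub t x : `](a - 1), (a + 1)[%classic t -> setT x ->
    `|partial1of2 f t x| <= k * two_sided_exp u x.
  by move=> /E ta _; rewrite d1//; exact: f'k.
have iG := integrable_two_sided_exp u k s0.
have := @differentiation_under_integral _ _ _ (N 0 s) f setT measurableT a (a-1) (a+1) Ia intf derf _ G0 iG Gub.
have := @derivable_under_integral _ _ _ (N 0 s) f setT measurableT a (a-1) (a+1) Ia intf derf _ G0 iG Gub.
rewrite derive1E => dF eF; apply: DeriveDef => //.
by rewrite eF; apply: eq_Rintegral => x _ /=; rewrite d1// subrr normr0.
Qed.

(** Substitution [x + m] in the density. Only nonnegative continuous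
    functions are covered, which is why the consequences below first add a
    constant or an absolute value to the integrand. *)
Lemma normal_integral_translate m s (g : R -> R) : s != 0 ->
  continuous g -> (forall x, 0 <= g x) ->
  (\int[N m s]_x (g x)%:E = \int[N 0 s]_x (g (x + m))%:E)%E.
Proof.
move=> s0 cg g0.
have mg : measurable_fun setT g by exact: continuous_measurable_fun.
rewrite [LHS]ge0_integral_normal_prob; [|exact/measurable_EFinP|by move=> x; rewrite lee_fin].
rewrite [RHS]ge0_integral_normal_prob; first last.
- by move=> x; rewrite lee_fin.
- by apply/measurable_EFinP; apply: (measurableT_comp mg); apply: measurable_funD.
have dF (x : R) : is_derive x 1 (fun x : R => x + m) 1.
  by apply: is_derive_eq; rewrite addr0.
have dFE : (fun x : R => x + m)^`()%classic = cst 1.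
  by apply/funext => x; rewrite derive1E; apply: derive_val.
under eq_integral do rewrite -EFinM.
rewrite (@increasing_ge0_integration_by_substitutionT _ (fun x => x + m))//.
- apply: eq_integral => x _; rewrite dFE -EFinM /= mulr1; congr (_ * _)%:E.
  by rewrite !normal_pdfE// /normal_fun addrK subr0.
- by move=> x y xy; rewrite ltrD2r.
- by rewrite dFE => x; exact: cvg_cst.
- by rewrite dFE; exact: is_cvg_cst.
- by rewrite dFE; exact: is_cvg_cst.
- exact: cvg_addrr_Ny.
- exact: cvg_addrr.
- by move=> x; apply: continuousM; [exact: cg|exact: continuous_normal_pdf].
- by move=> x; rewrite mulr_ge0// normal_pdf_ge0.
Qed.

Lemma measurable_cos_affine t b : measurable_fun setT (fun x : R => cos (t * x + b)).
Proof.
apply: continuous_measurable_fun => x; apply: continuous_comp; last exact: continuous_cos.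
by apply: continuousD; [apply: continuousM; [exact: cvg_cst|exact: cvg_id]|exact: cvg_cst].
Qed.

Lemma cos_normal_translate m s t b : s != 0 ->
  (\int[N m s]_x cos (t * x + b) = \int[N 0 s]_x cos (t * x + (t * m + b)))%R.
Proof.
move=> s0.
have H : \int[N m s]_x (1 + cos (t * x + b)) = \int[N 0 s]_x (1 + cos (t * x + (t * m + b))).
  rewrite /Rintegral normal_integral_translate//.
  - by congr fine; apply: eq_integral => x _; rewrite mulrDr addrA.
  - move=> x; apply: continuousD; first exact: cvg_cst.
    apply: continuous_comp; last exact: continuous_cos.
    by apply: continuousD; [apply: continuousM; [exact: cvg_cst|exact: cvg_id]|exact: cvg_cst].
have E m' b' : \int[N m' s]_x (1 + cos (t * x + b')) = 1 + \int[N m' s]_x cos (t * x + b').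
  apply: (@Rintegral_cstD _ _ _ (N m' s) _ _ 1); first exact: measurable_cos_affine.
  by move=> x; rewrite ler_norml cos_geN1 cos_le1.
by move: H; rewrite (E m b) (E 0 (t * m + b)) => /addrI.
Qed.

Lemma fact_le_expn n : (n`! <= n ^ n)%N.
Proof.
elim: n => // n IH; rewrite factS expnS leq_mul2l/=.
by apply: (leq_trans IH); case: n {IH} => // n; rewrite leq_exp2r.
Qed.

Lemma pow_le_expR (x : R) j : 0 <= x -> x ^+ j <= j`!%:R * expR x.
Proof.
move=> x0; case: j => [|j]; first by rewrite expr0 fact0 mul1r -[leLHS]expR0 ler_expR.
have := expR_ge1Dxn j x0 => H.
rewrite -ler_pdivrMl ?ltr0n ?fact_gt0// mulrC; lra.
Qed.

Lemma expR_le_two_sided u (x : R) : expR (`|u * x|) <= two_sided_exp u x.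
Proof.
rewrite /two_sided_exp mulNr; have [_|_] := ger0P (u * x).
  by rewrite lerDl expR_ge0.
by rewrite lerDr expR_ge0.
Qed.

Lemma pow_le_two_sided u (x : R) j : `|u * x| ^+ j <= j`!%:R * two_sided_exp u x.
Proof.
apply: (le_trans (pow_le_expR j (normr_ge0 _))).
by rewrite ler_wpM2l// ?ler0n// expR_le_two_sided.
Qed.

(** The margin [1] in the rate absorbs the power, through
    [`|x| ^+ j <= j`! * expR `|x|]. *)
Lemma pow_expR_le_two_sided u v (x : R) j : `|v| + 1 <= u ->
  `|x| ^+ j * expR (v * x) <= j`!%:R * two_sided_exp u x.
Proof.
move=> vu; apply: (@le_trans _ _ (j`!%:R * expR `|u * x|)); last first.
  by rewrite ler_wpM2l// ?ler0n// expR_le_two_sided.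
apply: (@le_trans _ _ (j`!%:R * expR `|x| * expR (v * x))).
  by rewrite ler_wpM2r ?expR_ge0// pow_le_expR.
rewrite -mulrA -expRD ler_wpM2l ?ler0n// ler_expR.
have u0 : 0 <= u by have := normr_ge0 v; lra.
rewrite (normrM u x) (ger0_norm u0).
have h1 : v * x <= `|v| * `|x| by rewrite -normrM ler_norm.
have := ler_wpM2r (normr_ge0 x) vu; lra.
Qed.

Lemma measurable_pow_cos j t b u : measurable_fun setT
  (fun x : R => x ^+ j * (expR (u * x) * cos (t * x + b))).
Proof.
apply: measurable_funM; first exact: measurable_funX.
apply: measurable_funM; last exact: measurable_cos_affine.
by apply: measurableT_comp => //; apply: measurable_funM.
Qed.

Lemma norm_pow_cos_le j t b u v (x : R) : `|v| + 1 <= u ->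
  `|x ^+ j * (expR (v * x) * cos (t * x + b))| <= j`!%:R * two_sided_exp u x.
Proof.
move=> vu; rewrite !normrM normrX (ger0_norm (expR_ge0 _)).
apply: le_trans (pow_expR_le_two_sided x j vu).
rewrite mulrA -[leRHS]mulr1 ler_wpM2l ?mulr_ge0 ?expR_ge0 ?exprn_ge0//.
by rewrite ler_norml cos_geN1 cos_le1.
Qed.

Lemma cos_sub_pihalf y : cos (y - pi / 2) = sin y :> R.
Proof. by rewrite cosB cos_pihalf sin_pihalf mulr0 add0r mulr1. Qed.

Lemma sin_sub_pihalf y : sin (y - pi / 2) = - cos y :> R.
Proof. by rewrite sinB cos_pihalf sin_pihalf mulr0 mulr1 sub0r. Qed.

Local Notation cosI s t b := (\int[N 0 s]_x cos (t * x + b))%R.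

(** The exponential weight shifts the mean by [u * s ^+ 2], and a shift of
    the mean is a change of phase in the cosine. *)
Lemma cos_normal_exp s u t b : s != 0 ->
  (\int[N 0 s]_x (expR (u * x) * cos (t * x + b)))%R =
  expR (u ^+ 2 * s ^+ 2 / 2) * cosI s t (t * (u * s ^+ 2) + b).
Proof.
move=> s0; rewrite -(cos_normal_translate (u * s ^+ 2))//.
have H : \int[N (u * s ^+ 2) s]_x (1 + cos (t * x + b)) =
   \int[N 0 s]_x (expR (- (u ^+ 2 * s ^+ 2 / 2)) * (expR (u * x) + expR (u * x) * cos (t * x + b))).
  rewrite /Rintegral ge0_integral_normal_tilt//.
  - congr fine; apply: eq_integral => x _; rewrite -EFinM.
    rewrite (_ : _ / s ^+ 2 = - (u ^+ 2 * s ^+ 2 / 2) + u * x); last by field.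
    by rewrite expRD; congr (_%:E); ring.
  - apply/measurable_EFinP; apply: measurable_funD => //; exact: measurable_cos_affine.
have E : \int[N (u * s ^+ 2) s]_x (1 + cos (t * x + b)) =
    1 + \int[N (u * s ^+ 2) s]_x cos (t * x + b).
  apply: (@Rintegral_cstD _ _ _ (N (u * s ^+ 2) s) _ _ 1); first exact: measurable_cos_affine.
  by move=> x; rewrite ler_norml cos_geN1 cos_le1.
have i1 := integrable_expR_normal u s0.
have i2 : (N 0 s).-integrable setT (EFin \o (fun x => expR (u * x) * cos (t * x + b))).
  apply: (integrable_le_two_sided_exp (u := `|u| + 1) (k := 1)); first exact: s0.
    by have := measurable_pow_cos 0 t b u; under eq_fun do rewrite expr0 mul1r.
  by move=> x; have := norm_pow_cos_le 0 t b x (lexx (`|u| + 1)); rewrite expr0 mul1r.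
have i3 : (N 0 s).-integrable setT (EFin \o (fun x => expR (u * x) + expR (u * x) * cos (t * x + b))).
  exact: (integrableD measurableT i1 i2).
have e1 : \int[N 0 s]_x expR (u * x) = expR (u ^+ 2 * s ^+ 2 / 2).
  by rewrite /Rintegral normal_mgf.
move: H; rewrite E (RintegralZl _ measurableT i3) (RintegralD measurableT i1 i2) e1.
rewrite mulrDr -expRD addNr expR0 => /addrI ->.
by rewrite mulrA -expRD subrr expR0 mul1r.
Qed.

(** The sine integral is written as the cosine integral with phase
    [b - pi / 2], so that a single family of integrals suffices. *)
Lemma cosI_addition s t b c :
  cosI s t (b + c) = cos c * cosI s t b - sin c * cosI s t (b - pi / 2).
Proof.
have i k b' : (N 0 s).-integrable setT (EFin \o (fun x => k * cos (t * x + b'))).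
  apply: (@integrable_bounded _ _ _ (N 0 s) _ `|k|).
    by apply: measurable_funM => //; exact: measurable_cos_affine.
  by move=> x; rewrite normrM ler_piMr// ler_norml cos_geN1 cos_le1.
have i' b' : (N 0 s).-integrable setT (EFin \o (fun x => cos (t * x + b'))).
  by have := i 1 b'; under eq_fun do rewrite mul1r.
rewrite -(RintegralZl _ measurableT (i' b)) -(RintegralZl _ measurableT (i' (b - pi / 2))).
rewrite -(RintegralB measurableT (i _ _) (i _ _)); apply: eq_Rintegral => x _.
by rewrite !addrA cosD cos_sub_pihalf; ring.
Qed.

(** Stein's identity for the cosine, obtained by differentiating
    [cos_normal_exp] in [u] at [0]. *)
Lemma normal_stein s t b : s != 0 ->
  \int[N 0 s]_x (x * cos (t * x + b)) = - (t * s ^+ 2 * cosI s t (b - pi / 2)).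
Proof.
move=> s0.
have D1 : is_derive (0 : R) 1 (fun u => \int[N 0 s]_x (expR (u * x) * cos (t * x + b)))
   (\int[N 0 s]_x (x * (expR (0 * x) * cos (t * x + b)))).
  apply: (@is_derive_normal_integral s 2 1 0
    (fun u x => expR (u * x) * cos (t * x + b))
    (fun u x => x * (expR (u * x) * cos (t * x + b)))) => //.
  - by move=> v x _; apply: is_derive_eq; rewrite /GRing.scale/=; ring.
  - by move=> v; have := measurable_pow_cos 0 t b v; under eq_fun do rewrite expr0 mul1r.
  - move=> v x; rewrite subr0 => v1; have := @norm_pow_cos_le 0 t b 2 v x.
    by rewrite expr0 mul1r; apply; lra.
  - move=> v x; rewrite subr0 => v1; have := @norm_pow_cos_le 1 t b 2 v x.
    by rewrite expr1; apply; lra.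
have D2 : is_derive (0 : R) 1
    (fun u => expR (u ^+ 2 * s ^+ 2 / 2) * (cos (t * (u * s ^+ 2)) * cosI s t b
       - sin (t * (u * s ^+ 2)) * cosI s t (b - pi / 2)))
    (- (t * s ^+ 2 * cosI s t (b - pi / 2))).
  apply: is_derive_eq; rewrite /GRing.scale/= !mul0r !mulr0 sin0 cos0 expr0n/= !mul0r expR0.
  by ring.
have E : (fun u => \int[N 0 s]_x (expR (u * x) * cos (t * x + b))) =
   (fun u => expR (u ^+ 2 * s ^+ 2 / 2) * (cos (t * (u * s ^+ 2)) * cosI s t b
       - sin (t * (u * s ^+ 2)) * cosI s t (b - pi / 2))).
  by apply/funext => u; rewrite cos_normal_exp// -cosI_addition (addrC b).
transitivity (\int[N 0 s]_x (x * (expR (0 * x) * cos (t * x + b)))).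
  by apply: eq_Rintegral => x _; rewrite mul0r expR0 mul1r.
rewrite E in D1.
by rewrite -(derive_val (is_derive := D1)) (derive_val (is_derive := D2)).
Qed.

Lemma is_derive_cos_moment s t b (j : nat) : s != 0 ->
  is_derive t 1 (fun t => \int[N 0 s]_x (x ^+ j * cos (t * x + b)))
    (\int[N 0 s]_x (- (x ^+ j.+1 * cos (t * x + (b - pi / 2))))).
Proof.
move=> s0.
apply: (@is_derive_normal_integral s 1 j.+1`!%:R t
    (fun t x => x ^+ j * cos (t * x + b))
    (fun t x => - (x ^+ j.+1 * cos (t * x + (b - pi / 2))))) => //.
- move=> v x _; apply: is_derive_eq; rewrite addrA cos_sub_pihalf exprS /GRing.scale/=.
  ring.
- by move=> v; have := measurable_pow_cos j v b 0; under eq_fun do rewrite mul0r expR0 mul1r.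
- move=> v x _; have := @norm_pow_cos_le j v b 1 0 x.
  rewrite normr0 add0r mul0r expR0 mul1r => /(_ (lexx _)) /le_trans; apply.
  by rewrite ler_wpM2r ?two_sided_exp_ge0// ler_nat leq_fact.
- move=> v x _; have := @norm_pow_cos_le j.+1 v (b - pi / 2) 1 0 x.
  by rewrite normr0 add0r mul0r expR0 mul1r normrN; apply.
Qed.

Lemma integrable_cos s t b : (N 0 s).-integrable setT (EFin \o (fun x => cos (t * x + b))).
Proof.
apply: (@integrable_bounded _ _ _ (N 0 s) _ 1); first exact: measurable_cos_affine.
by move=> x; rewrite ler_norml cos_geN1 cos_le1.
Qed.

Lemma cosI_sub_pi s t b : cosI s t (b - pi / 2 - pi / 2) = - cosI s t b.
Proof.
transitivity (-1 * cosI s t b); last by rewrite mulN1r.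
rewrite -(RintegralZl _ measurableT (integrable_cos s t b)).
by apply: eq_Rintegral => x _; rewrite !addrA cos_sub_pihalf sin_sub_pihalf mulN1r.
Qed.

Lemma integrable_pow_cos s t b j : s != 0 ->
  (N 0 s).-integrable setT (EFin \o (fun x => x ^+ j * cos (t * x + b))).
Proof.
move=> s0.
apply: (integrable_le_two_sided_exp (u := 1) (k := j`!%:R)); first exact: s0.
  by have := measurable_pow_cos j t b 0; under eq_fun do rewrite mul0r expR0 mul1r.
move=> x; have := @norm_pow_cos_le j t b 1 0 x.
by rewrite normr0 add0r mul0r expR0 mul1r; apply.
Qed.

(** The linear differential equation that determines the characteristic
    function of the normal law. *)
Lemma is_derive_cosI s t b : s != 0 ->
  is_derive (t : R) 1 (fun v => cosI s v b) (- (t * s ^+ 2 * cosI s t b)).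
Proof.
move=> s0; have := is_derive_cos_moment t b 0 s0.
under eq_fun do under eq_Rintegral do rewrite expr0 mul1r.
suff -> : \int[N 0 s]_x (- (x ^+ 1 * cos (t * x + (b - pi / 2)))) =
      - (t * s ^+ 2 * cosI s t b) by [].
under eq_Rintegral do rewrite -mulN1r.
rewrite (RintegralZl _ measurableT (integrable_pow_cos t (b - pi / 2) 1 s0)).
under eq_Rintegral do rewrite expr1.
by rewrite (normal_stein t _ s0) cosI_sub_pi; ring.
Qed.

(** By [is_derive_cosI] the product of the integral and of
    [expR (t ^+ 2 * s ^+ 2 / 2)] has derivative zero in [t]; its value at
    [t = 0] is [cos b]. *)
Lemma normal_cos s t b : s != 0 ->
  cosI s t b = expR (- (t ^+ 2 * s ^+ 2 / 2)) * cos b.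
Proof.
move=> s0.
pose F v := expR (v ^+ 2 * s ^+ 2 / 2) * cosI s v b.
have DF (v : R) : is_derive v 1 F 0.
  have D := is_derive_cosI v b s0.
  by rewrite /F; apply: is_derive_eq; rewrite /GRing.scale/=; field.
have := is_derive_0_is_cst t 0 DF.
rewrite /F expr0n/= !mul0r expR0 mul1r.
under [X in _ = X -> _]eq_Rintegral do rewrite mul0r add0r.
rewrite (Rintegral_prob_cst (N 0 s)) => <-.
by rewrite mulrA -expRD addNr expR0 mul1r.
Qed.

Lemma normal_mean0 s : s != 0 -> \int[N 0 s]_x x = 0.
Proof.
move=> s0; have := normal_stein 0 0 s0.
under eq_Rintegral do rewrite mul0r add0r cos0 mulr1.
by move=> ->; rewrite !mul0r oppr0.
Qed.

Lemma integrable_normal_id m s : s != 0 -> (N m s).-integrable setT (EFin \o idfun).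
Proof.
move=> s0; apply/integrableP; split.
  by apply/measurable_EFinP; exact: measurable_id.
rewrite [ltLHS](_ : _ = (\int[N 0 s]_x `|x + m|%:E)%E); last first.
  by apply: normal_integral_translate => //; exact: norm_continuous.
have i0 : (N 0 s).-integrable setT (EFin \o (fun x : R => x + m)).
  rewrite (_ : EFin \o _ = (EFin \o (fun x : R => x)) \+ (EFin \o cst m))//; apply: integrableD => //.
    by have := integrable_pow_cos 0 0 1 s0; under eq_fun do rewrite mul0r add0r cos0 mulr1 expr1.
  exact: (@integrable_bounded _ _ _ (N 0 s) _ `|m|).
by have /integrableP[_] := i0.
Qed.

Lemma normal_mean m s : s != 0 -> \int[N m s]_x x = m.
Proof.
move=> s0.
have i1 := integrable_normal_id m s0; have i0 := integrable_normal_id 0 s0.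
have i0m : (N 0 s).-integrable setT (EFin \o (fun x : R => x + m)).
  rewrite (_ : EFin \o _ = (EFin \o (fun x : R => x)) \+ (EFin \o cst m))//; apply: integrableD => //.
  exact: (@integrable_bounded _ _ _ (N 0 s) _ `|m|).
have na g m' : (N m' s).-integrable setT (EFin \o g) -> (N m' s).-integrable setT (EFin \o (fun x => `|g x|)).
  by move=> /integrable_norm.
have A1 : \int[N m s]_x `|x| = \int[N 0 s]_x `|x + m|.
  have H := normal_integral_translate m s0 (@norm_continuous _ R^o) (fun x => normr_ge0 x).
  exact: (congr1 fine H).
have A2 : \int[N m s]_x (`|x| + x) = \int[N 0 s]_x (`|x + m| + (x + m)).
  have cg : continuous (fun x : R => `|x| + x).
    by move=> x; apply: continuousD; [exact: norm_continuous|exact: cvg_id].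
  have g0 (x : R) : 0 <= `|x| + x by rewrite -lerBlDr sub0r -normrN ler_norm.
  have H := normal_integral_translate m s0 cg g0; exact: (congr1 fine H).
move: A2; rewrite (RintegralD measurableT (na _ _ i1) i1) (RintegralD measurableT (na _ _ i0m) i0m).
rewrite A1 => /addrI ->.
rewrite (RintegralD measurableT i0); last exact: (@integrable_bounded _ _ _ (N 0 s) _ `|m|).
exact: (etrans (f_equal2 +%R (normal_mean0 s0) (Rintegral_prob_cst (N 0 s) m)) (add0r m)).
Qed.

(** Differentiate [\int x cos (t x - pi / 2)] at [t = 0], using Stein's
    identity for its value. *)
Lemma normal_second_moment s : s != 0 -> \int[N 0 s]_x (x ^+ 2) = s ^+ 2.
Proof.
move=> s0.
have D1 := is_derive_cos_moment 0 (- (pi / 2)) 1 s0.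
have D2 : is_derive (0 : R) 1 (fun t => t * s ^+ 2 * expR (- (t ^+ 2 * s ^+ 2 / 2))) (s ^+ 2).
  by apply: is_derive_eq; rewrite /GRing.scale/= expr0n/= !mul0r oppr0 expR0; field.
have E : (fun t => \int[N 0 s]_x (x ^+ 1 * cos (t * x - pi / 2))) =
    (fun t => t * s ^+ 2 * expR (- (t ^+ 2 * s ^+ 2 / 2))).
  apply/funext => t; under eq_Rintegral do rewrite expr1.
  have := cosI_sub_pi s t 0; rewrite sub0r => H.
  by rewrite (normal_stein t _ s0) H normal_cos// cos0 mulr1; ring.
rewrite E in D1.
rewrite -(@derive_val _ _ _ _ _ _ _ D2) (@derive_val _ _ _ _ _ _ _ D1).
apply: eq_Rintegral => x _; rewrite mul0r add0r -opprD.
by rewrite -splitr cosN cospi mulrN1 opprK.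
Qed.

(** Compare [x ^+ (2 * p)] with its term in the exponential series of
    [u * x] and use the exponential moment; [u ^+ 2 * s ^+ 2 = 2 * p] is the
    optimal choice. *)
Lemma normal_even_moment_le s p : s != 0 -> (0 < p)%N ->
  (\int[N 0 s]_x (x ^+ (2 * p))%:E <= ((4 * expR 1 * p%:R) ^+ p * s ^+ (2 * p))%:E)%E.
Proof.
move=> s0 p0.
have p0' : 0 < p%:R :> R by rewrite ltr0n.
pose u := Num.sqrt (2 * p%:R) / s.
have u2 : u ^+ 2 * s ^+ 2 = 2 * p%:R.
  by rewrite /u exprMn sqr_sqrtr ?mulr_ge0 ?ler0n//; field.
have u0 : u != 0.
  by rewrite mulf_neq0 ?invr_eq0// gt_eqF// sqrtr_gt0 mulr_gt0.
pose K := (2 * p)`!%:R / u ^+ (2 * p).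
have up0 : 0 < u ^+ (2 * p) by rewrite exprn_even_gt0//= ?mul2n ?odd_double//; rewrite u0 orbT.
have mx : measurable_fun setT (fun x : R => (x ^+ (2 * p))%:E).
  by apply/measurable_EFinP; exact: measurable_funX.
apply: (@le_trans _ _ (\int[N 0 s]_x (K * two_sided_exp u x)%:E)%E).
  apply: ge0_le_integral => //.
  - by move=> x _; rewrite lee_fin exprn_even_ge0// mul2n odd_double.
  - apply/measurable_EFinP; apply: measurable_funM => //; exact: measurable_two_sided_exp.
  move=> x _; rewrite lee_fin /K mulrAC ler_pdivlMr//.
  apply: le_trans (pow_le_two_sided u x (2 * p)).
  by rewrite -exprMn mulrC -normrX ler_norm.
have -> : (\int[N 0 s]_x (K * two_sided_exp u x)%:E)%E = (K * (2 * expR p%:R))%:E.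
  have K0 : 0 <= K by rewrite divr_ge0 ?ler0n// ltW.
  under eq_integral do rewrite EFinM EFinD.
  have m1 v : measurable_fun setT (fun x : R => (expR (v * x))%:E).
    by apply/measurable_EFinP; apply: measurableT_comp => //; exact: measurable_funM.
  rewrite ge0_integralZl//=; first last.
  - by move=> x _; rewrite adde_ge0// lee_fin expR_ge0.
  - by apply: emeasurable_funD; exact: m1.
  rewrite ge0_integralD//=; try (by move=> x _; rewrite lee_fin expR_ge0); try exact: m1.
  rewrite !normal_mgf// sqrrN u2 -EFinD -EFinM; congr (_ * _)%:E.
  by rewrite mulrAC divff// mul1r mulr2n mulrDl mul1r.
rewrite lee_fin /K mulrAC ler_pdivrMr//.
have e2 : (s * u) ^+ (2 * p) = (2 * p%:R) ^+ p.
  by rewrite (mulrC s) exprM (exprMn 2) u2.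
rewrite -[leRHS]mulrA -(exprMn (2 * p)) e2.
apply: (@le_trans _ _ ((2 * p%:R) ^+ (2 * p) * (2 ^+ p * expR p%:R))).
  apply: ler_pM; rewrite ?ler0n ?mulr_ge0 ?expR_ge0//.
    by rewrite -natrM -natrX ler_nat fact_le_expn.
  rewrite ler_wpM2r ?expR_ge0// -[leLHS]expr1.
  by rewrite ler_eXn2l// ltr1n.
rewrite -[X in expR X]mulr1 expRM_natl (mulnC 2) exprM -!exprMn le_eqVlt; apply/orP; left.
by apply/eqP; rewrite exprAC -(exprMn p); congr (_ ^+ p); ring.
Qed.

(** The density is at most its peak, and [s ^+ 2 * pi *+ 2] is at least
    [(2 * s) ^+ 2]. *)
Lemma normal_prob_itv_le s a b : 0 < s -> a <= b ->
  (N 0 s `[a, b] <= ((b - a) / (2 * s))%:E)%E.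
Proof.
move=> s0 ab; rewrite /normal_prob.
have s0' : s != 0 by rewrite gt_eqF.
apply: (@le_trans _ _ (\int[leb]_(x in `[a, b]) (normal_peak s)%:E)%E).
  apply: ge0_le_integral => //.
  - by move=> x _; rewrite lee_fin normal_pdf_ge0.
  - by apply/measurable_EFinP; apply: measurable_funTS; exact: measurable_normal_pdf.
  - by move=> x _; rewrite lee_fin normal_pdf_ub.
rewrite integral_cst//= lebesgue_measure_itv/=; case: ifPn => [_|_]; last first.
  by rewrite mule0 lee_fin divr_ge0 ?subr_ge0// mulr_ge0// ltW.
rewrite -EFinD -EFinM lee_fin mulrC ler_wpM2l ?subr_ge0//.
rewrite /normal_peak lef_pV2 ?posrE ?mulr_gt0//; last first.
  by rewrite sqrtr_gt0 mulrn_wgt0// mulr_gt0 ?pi_gt0// exprn_gt0.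
rewrite -(ler_pXn2r (n := 2)) ?nnegrE ?sqrtr_ge0 ?mulr_ge0 ?(ltW s0)//.
rewrite sqr_sqrtr; last by rewrite mulrn_wge0// mulr_ge0 ?pi_ge0// sqr_ge0.
have := @pi_ge2 R; have := sqr_ge0 s; nra.
Qed.

(** From [expR (- (1 / 4)) >= 3 / 4]; the bound [256 / 81] is below
    [16 / 5]. *)
Lemma expR1_le : expR 1 <= 16 / 5 :> R.
Proof.
have h : 3 / 4 <= expR (- (1 / 4)) :> R by have := expR_ge1Dx (- (1 / 4) : R); lra.
have -> : expR 1 = (expR (- (1 / 4)))^-1 ^+ 4 :> R.
  by rewrite -expRN opprK -expRM_natl; congr expR; field.
apply: (@le_trans _ _ ((3 / 4)^-1 ^+ 4)); last by lra.
by rewrite ler_pXn2r ?nnegrE ?invr_ge0 ?expR_ge0// lef_pV2 ?posrE ?expR_gt0//.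
Qed.

(** Within two standard deviations the density is at least
    [expR (- 2)] times the peak; [12] bounds [expR 2] and [5 * s] bounds
    the inverse of the peak. *)
Lemma normal_prob_itv_ge s (a b : R) : 0 < s -> - 2 <= a -> b <= 2 ->
  (((b - a) / 60)%:E <= N 0 s `[(a * s)%R, (b * s)%R])%E.
Proof.
move=> s0 a2 b2; rewrite /normal_prob.
have s0' : s != 0 by rewrite gt_eqF.
have [ba|ab] := leP b a.
  apply: (@le_trans _ _ 0%E); first by rewrite lee_fin pmulr_lle0 ?subr_le0.
  by apply: integral_ge0 => x _; rewrite lee_fin normal_pdf_ge0.
apply: (@le_trans _ _ (\int[leb]_(x in `[(a * s)%R, (b * s)%R]) ((60 * s)^-1)%:E)%E).
  rewrite integral_cst//= lebesgue_measure_itv/= lte_fin ltr_pM2r// ab.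
  rewrite -EFinD -EFinM lee_fin -mulrBl le_eqVlt; apply/orP; left; apply/eqP.
  by field.
apply: ge0_le_integral => //.
- by move=> x _; rewrite lee_fin invr_ge0 mulr_ge0// ltW.
- by apply/measurable_EFinP; apply: measurable_funTS; exact: measurable_normal_pdf.
move=> x; rewrite /= in_itv/= => /andP[ax xb].
rewrite lee_fin normal_pdfE// /normal_fun.
have x2 : x ^+ 2 <= 4 * s ^+ 2.
  have : `|x| <= 2 * s by rewrite ler_norml; apply/andP; split; nra.
  by rewrite -(ler_pXn2r (n := 2)) ?nnegrE ?mulr_ge0 ?(ltW s0)// real_normK ?num_real// exprMn; lra.
have e2 : expR (- 2) <= expR (- (x - 0) ^+ 2 / (s ^+ 2 *+ 2)).
  rewrite ler_expR subr0 mulNr lerN2 ler_pdivrMr; first by lra.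
  by rewrite mulrn_wgt0// exprn_gt0.
(* [(16 / 5) ^+ 2 < 12] *)
have e1 : (12 : R)^-1 <= expR (- 2).
  rewrite expRN lef_pV2 ?posrE ?expR_gt0//.
  have -> : expR 2 = expR 1 ^+ 2 :> R by rewrite -expRM_natl mulr1.
  have := expR1_le; have := expR_ge0 (1 : R); nra.
have pk : (5 * s)^-1 <= normal_peak s.
  rewrite /normal_peak lef_pV2 ?posrE ?mulr_gt0//; last first.
    by rewrite sqrtr_gt0 mulrn_wgt0// mulr_gt0 ?pi_gt0// exprn_gt0.
  rewrite -(ler_pXn2r (n := 2)) ?nnegrE ?sqrtr_ge0 ?mulr_ge0 ?(ltW s0)//.
  rewrite sqr_sqrtr; last by rewrite mulrn_wge0// mulr_ge0 ?pi_ge0// sqr_ge0.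
  have : pi <= 4 :> R by have := @pihalf_lt2 R; lra.
  have := sqr_ge0 s; nra.
have -> : (60 * s)^-1 = (5 * s)^-1 * 12^-1 by field.
apply: ler_pM => //; rewrite ?invr_ge0 ?mulr_ge0 ?(ltW s0)//.
exact: le_trans e1 e2.
Qed.

End NormalLaw.

(** * Centred Gaussian variables *)

Section CenteredGaussian.
Context d (Omega : measurableType d) (R : realType) (P : probability Omega R).
Implicit Types Y : Omega -> R.

Definition centered_gaussian Y : Prop :=
  measurable_fun setT Y /\ exists s : R, 0 <= s /\
    forall A : set R, measurable A -> P (Y @^-1` A) = gaussian_law 0 s A.

Section Law.
Variables (Y : Omega -> R) (s : R).
Hypothesis mY : measurable_fun setT Y.
(* The normal laws live on the Borel sets of [measurableTypeR R], a display
   different from the one carried by random variables. *)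
Let mY' : measurable_fun setT (Y : Omega -> measurableTypeR R) := mY.
Let mY_mixin := isMeasurableFun.Build _ _ _ _ _ mY'.
Let Ym : {mfun Omega >-> measurableTypeR R} := HB.pack (Y : Omega -> measurableTypeR R) mY_mixin.

Section Nondegenerate.
Variable m : R.
Hypothesis lawY : forall A : set R, measurable A -> P (Y @^-1` A) = normal_prob m s A.

Lemma ge0_integral_law (f : R -> \bar R) : measurable_fun setT f ->
  (forall x, 0 <= f x)%E -> (\int[P]_w f (Y w) = \int[normal_prob m s]_x f x)%E.
Proof.
move=> mf f0.
transitivity (\int[distribution P Ym]_x f x)%E.
  by rewrite ge0_integral_distribution.
by apply: eq_measure_integral => A mA _; exact: lawY.
Qed.

Lemma integrable_law (f : R -> R) : measurable_fun setT f ->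
  (normal_prob m s).-integrable setT (EFin \o f) ->
  P.-integrable setT (EFin \o (f \o Y)).
Proof.
move=> mf /integrableP[_ fi]; apply/integrableP; split.
  by apply/measurable_EFinP; exact: measurableT_comp.
rewrite (ge0_integral_law (f := fun x => `|(f x)%:E|%E))//.
by apply: measurableT_comp => //; exact/measurable_EFinP.
Qed.

Lemma Rintegral_law (f : R -> R) : measurable_fun setT f ->
  (normal_prob m s).-integrable setT (EFin \o f) ->
  \int[P]_w f (Y w) = \int[normal_prob m s]_x f x.
Proof.
move=> mf fi; rewrite /Rintegral; congr fine.
transitivity (\int[distribution P Ym]_x (f x)%:E)%E.
  rewrite (integral_distribution (P := P) (X := Ym) (f := EFin \o f))//.
    exact/measurable_EFinP.
  exact: integrable_law.
by apply: eq_measure_integral => A mA _; exact: lawY.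
Qed.

End Nondegenerate.

Section Degenerate.
Hypothesis lawY : forall A : set R, measurable A -> P (Y @^-1` A) = \d_(0 : R) A.

Lemma degenerate_ae (f : R -> \bar R) : ae_eq P setT (f \o Y) (cst (f 0%R)).
Proof.
exists (Y @^-1` (~` [set 0])); split.
- rewrite -[_ @^-1` _]setTI; apply: mY => //; exact: measurableC.
- rewrite -[LHS]/(P (Y @^-1` _)) lawY; last exact: measurableC.
  by rewrite diracE memNset//= => /(_ erefl).
- by move=> w /= /not_implyP[_ H] Y0; apply: H; rewrite /= Y0.
Qed.

(** A variable whose law is a point mass is almost surely constant. *)
Lemma integral_degenerate (f : R -> \bar R) : measurable_fun setT f ->
  (\int[P]_w f (Y w) = f 0%R)%E.
Proof.
move=> mf; rewrite (ae_eq_integral (cst (f 0%R)))//.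
- by rewrite integral_cst// [X in (_ * X)%E](_ : _ = 1%E) ?mule1//; exact: probability_setT.
- exact: measurableT_comp.
- exact: degenerate_ae.
Qed.

End Degenerate.
End Law.

Lemma integrable_degenerate Y (f : R -> R) : measurable_fun setT Y ->
  (forall A : set R, measurable A -> P (Y @^-1` A) = \d_(0 : R) A) ->
  measurable_fun setT f -> P.-integrable setT (EFin \o (f \o Y)).
Proof.
move=> mY lawY mf; apply/integrableP; split.
  by apply/measurable_EFinP; exact: measurableT_comp.
rewrite (integral_degenerate mY lawY (f := fun x => `|(f x)%:E|%E)) ?ltry//.
by apply: measurableT_comp => //; exact/measurable_EFinP.
Qed.

Lemma gaussian_law_normal (s : R) A : s != 0 -> gaussian_law 0 s A = normal_prob 0 s A.
Proof. by rewrite /gaussian_law => /negbTE ->. Qed.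

Lemma gaussian_integrable_pow Y j : centered_gaussian Y ->
  P.-integrable setT (EFin \o (fun w => Y w ^+ j)).
Proof.
move=> [mY [s [s0 lawY]]].
have mj : measurable_fun setT (fun x : R => x ^+ j) by exact: measurable_funX.
have [s00|sn0] := eqVneq s 0.
  apply: (integrable_degenerate mY _ mj) => A mA.
  by rewrite lawY// /gaussian_law s00 eqxx.
apply: (integrable_law mY _ mj) => [A mA|].
  by rewrite lawY// gaussian_law_normal.
by have := integrable_pow_cos 0 0 j sn0; under eq_fun do rewrite mul0r add0r cos0 mulr1.
Qed.

Definition second_moment Y := \int[P]_w (Y w ^+ 2).

Lemma second_moment_ge0 Y : 0 <= second_moment Y.
Proof. by apply: Rintegral_ge0 => w _; rewrite sqr_ge0. Qed.

(** The parameter [s] of the law is determined by the second moment, so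
    that the law of a centred Gaussian variable is a function of its variance. *)
Lemma gaussian_second_moment Y : centered_gaussian Y ->
  forall A, measurable A -> P (Y @^-1` A) = gaussian_law 0 (Num.sqrt (second_moment Y)) A.
Proof.
move=> [mY [s [s0 lawY]]] A mA; rewrite (lawY _ mA); congr (gaussian_law _ _ _).
have m2 : measurable_fun setT (fun x : R => x ^+ 2) by exact: measurable_funX.
rewrite -[LHS]ger0_norm// -sqrtr_sqr; congr Num.sqrt; apply/esym.
have [s00|sn0] := eqVneq s 0.
  rewrite /second_moment /Rintegral (integral_degenerate mY _ (f := fun x => (x ^+ 2)%:E)).
  - by rewrite s00.
  - by move=> B mB; rewrite lawY// /gaussian_law s00 eqxx.
  - exact/measurable_EFinP.
rewrite -(normal_second_moment sn0).
apply: (Rintegral_law mY _ m2) => [B mB|].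
  by rewrite lawY// gaussian_law_normal.
by have := integrable_pow_cos 0 0 2 sn0; under eq_fun do rewrite mul0r add0r cos0 mulr1.
Qed.

Lemma gaussian_cos Y b : centered_gaussian Y ->
  \int[P]_w cos (Y w + b) = expR (- (second_moment Y / 2)) * cos b.
Proof.
move=> gY; have lawY := gaussian_second_moment gY; have [mY _] := gY.
have V0 := second_moment_ge0 Y.
have mc : measurable_fun setT (fun x : R => cos (x + b)).
  by have := measurable_cos_affine 1 b; under eq_fun do rewrite mul1r.
have [s00|sn0] := eqVneq (Num.sqrt (second_moment Y)) 0.
  have V00 : second_moment Y = 0 by rewrite -(sqr_sqrtr V0) s00 expr0n.
  rewrite /Rintegral (integral_degenerate mY _ (f := fun x => (cos (x + b))%:E)).
  - by rewrite V00 mul0r oppr0 expR0 mul1r add0r.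
  - by move=> B mB; rewrite lawY// /gaussian_law s00 eqxx.
  - exact/measurable_EFinP.
have := normal_cos 1 b sn0; rewrite expr1n mul1r sqr_sqrtr// => <-.
under [RHS]eq_Rintegral do rewrite mul1r.
apply: (Rintegral_law mY _ mc) => [B mB|].
  by rewrite lawY// gaussian_law_normal.
by have := integrable_cos (Num.sqrt (second_moment Y)) 1 b; under eq_fun do rewrite mul1r.
Qed.

Lemma gaussian_even_moment_le Y p : centered_gaussian Y -> (0 < p)%N ->
  (\int[P]_w (Y w ^+ (2 * p))%:E <=
   ((4 * expR 1 * p%:R) ^+ p * second_moment Y ^+ p)%:E)%E.
Proof.
move=> gY p0; have lawY := gaussian_second_moment gY; have [mY _] := gY.
have V0 := second_moment_ge0 Y.
have mj : measurable_fun setT (fun x : R => (x ^+ (2 * p))%:E).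
  by apply/measurable_EFinP; exact: measurable_funX.
have [s00|sn0] := eqVneq (Num.sqrt (second_moment Y)) 0.
  rewrite (integral_degenerate mY _ mj); last first.
    by move=> B mB; rewrite lawY// /gaussian_law s00 eqxx.
  by rewrite lee_fin expr0n muln_eq0/= (gtn_eqF p0)/= mulr_ge0 ?exprn_ge0.
have := normal_even_moment_le sn0 p0; rewrite exprM sqr_sqrtr//; apply: le_trans.
rewrite (ge0_integral_law (m := 0) mY (s := Num.sqrt (second_moment Y)) _ mj)//.
  by move=> B mB; rewrite lawY// gaussian_law_normal.
by move=> x; rewrite lee_fin exprn_even_ge0// mul2n odd_double.
Qed.

Lemma gaussian_itv_le Y a b : centered_gaussian Y -> 0 < second_moment Y -> a <= b ->
  (P (Y @^-1` `[a, b]) <= ((b - a) / (2 * Num.sqrt (second_moment Y)))%:E)%E.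
Proof.
move=> gY V0 ab; have s0 : 0 < Num.sqrt (second_moment Y) by rewrite sqrtr_gt0.
rewrite (gaussian_second_moment gY)// gaussian_law_normal ?gt_eqF//.
exact: normal_prob_itv_le.
Qed.

Lemma gaussian_itv_ge Y (a b : R) : centered_gaussian Y -> 0 < second_moment Y ->
  - 2 <= a -> b <= 2 ->
  (((b - a) / 60)%:E <=
   P (Y @^-1` `[(a * Num.sqrt (second_moment Y))%R, (b * Num.sqrt (second_moment Y))%R]))%E.
Proof.
move=> gY V0 ab; have s0 : 0 < Num.sqrt (second_moment Y) by rewrite sqrtr_gt0.
rewrite (gaussian_second_moment gY)// gaussian_law_normal ?gt_eqF//.
exact: normal_prob_itv_ge.
Qed.

Lemma gaussian_null Y : centered_gaussian Y -> second_moment Y = 0 ->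
  P (Y @^-1` [set 0]) = 1%E.
Proof.
move=> gY V0; rewrite (gaussian_second_moment gY)// V0 sqrtr0 /gaussian_law eqxx.
by rewrite diracE mem_set.
Qed.
End CenteredGaussian.

(** * Independence from cosine moments *)

Section TrigonometricMultipliers.
Context d (Omega : measurableType d) (R : realType) (P : probability Omega R).
Implicit Types (f h : Omega -> R) (u v : R -> R).

Definition bounded_measurable d' (T : measurableType d') (f : T -> R) : Prop :=
  measurable_fun setT f /\ exists k, forall x, `|f x| <= k.

Lemma bounded_measurable_cst d' (T : measurableType d') (c : R) :
  bounded_measurable (cst c : T -> R).
Proof. by split=> //; exists `|c|. Qed.

Lemma bounded_measurableM d' (T : measurableType d') (f g : T -> R) :
  bounded_measurable f -> bounded_measurable g ->
  bounded_measurable (fun x => f x * g x).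
Proof.
move=> [mf [k fk]] [mg [l gl]]; split; first exact: measurable_funM.
by exists (k * l) => x; rewrite normrM ler_pM.
Qed.

Lemma bounded_measurableD d' (T : measurableType d') (f g : T -> R) :
  bounded_measurable f -> bounded_measurable g ->
  bounded_measurable (fun x => f x + g x).
Proof.
move=> [mf [k fk]] [mg [l gl]]; split; first exact: measurable_funD.
by exists (k + l) => x; rewrite (le_trans (ler_normD _ _))// lerD.
Qed.

Lemma bounded_measurable_comp (Y : Omega -> R) u :
  measurable_fun setT Y -> bounded_measurable u ->
  bounded_measurable (fun w => u (Y w)).
Proof.
move=> mY [mu [k uk]]; split; first exact: measurableT_comp mu mY.
by exists k => x.
Qed.

Lemma bounded_measurable_cos (Y : Omega -> R) b : measurable_fun setT Y ->
  bounded_measurable (fun w => cos (Y w + b)).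
Proof.
move=> mY; split.
  have := measurable_cos_affine 1 b; under eq_fun do rewrite mul1r.
  by move=> mc; exact: (measurableT_comp mc mY).
by exists 1 => x; rewrite ler_norml cos_geN1 cos_le1.
Qed.

Lemma bounded_measurable_integrable f : bounded_measurable f ->
  P.-integrable setT (EFin \o f).
Proof. by move=> [mf [k fk]]; exact: integrable_bounded mf fk. Qed.

Lemma norm_limit_le (u_ : nat -> R) (l k : R) :
  (forall n, `|u_ n| <= k) -> u_ n @[n --> \oo] --> l -> `|l| <= k.
Proof.
move=> uk /cvg_norm cl; rewrite -(cvg_lim _ cl)//; apply: limr_le.
  exact: cvgP cl.
by apply: nearW => n; exact: uk.
Qed.

Lemma bounded_convergence_cst (f_ : nat -> Omega -> R) f (k c : R) :
  (forall n, measurable_fun setT (f_ n)) -> (forall n w, `|f_ n w| <= k) ->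
  (forall w, f_ n w @[n --> \oo] --> f w) ->
  (forall n, \int[P]_w f_ n w = c) -> \int[P]_w f w = c.
Proof.
move=> mf fk cf ic.
have mfl : measurable_fun setT f.
  by apply: (measurable_fun_cvg (h := f_)) => // w _; exact: cf.
have kf w : `|f w| <= k by exact: norm_limit_le (cf w).
have cfE w : (f_ n w)%:E @[n --> \oo] --> (f w)%:E.
  by apply: cvg_EFin; [exact: nearW|exact: cf].
have [_ _ H] := @dominated_convergence _ _ _ P setT measurableT
   (fun n w => (f_ n w)%:E) (EFin \o f) (cst k%:E)
   (fun n => (measurable_EFinP _ _).2 (mf n)) ((measurable_EFinP _ _).2 mfl)
   (aeW _ (fun w _ => cfE w))
   (@integrable_bounded _ _ _ P (cst k) `|k| (measurable_cst _) (fun=> lexx _))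
   (aeW _ (fun w n _ => fk n w)).
have E n : (\int[P]_w (f_ n w)%:E)%E = c%:E.
  rewrite -(ic n) /Rintegral fineK//; apply: integrable_fin_num => //.
  exact: integrable_bounded (mf n) (fk n).
move: H => /=; under eq_fun do rewrite E; move=> H.
by rewrite /Rintegral -(cvg_lim _ H)// lim_cst.
Qed.

Variables (m : nat) (Y : 'I_m -> Omega -> R).
Hypothesis mY : forall i, measurable_fun setT (Y i).

(** [h] has vanishing conditional expectation given [Y], expressed through
    the cosine moments only. *)
Definition trig_null h : Prop := forall (a : 'I_m -> R) b,
  \int[P]_w (h w * cos (\sum_i a i * Y i w + b)) = 0.

(** The functions of [Y i] that preserve nullity. They form an algebra that
    contains the cosines and is closed under bounded limits, which is enough to
    reach all Borel indicators. *)
Definition trig_multiplier i u : Prop := bounded_measurable u /\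
  forall h, bounded_measurable h -> trig_null h ->
    trig_null (fun w => h w * u (Y i w)).

Lemma measurable_lincomb (a : 'I_m -> R) :
  measurable_fun setT (fun w => \sum_i a i * Y i w).
Proof.
apply: measurable_sum => i; apply: measurable_funM => //.
Qed.

Lemma bounded_measurable_trig h a b : bounded_measurable h ->
  bounded_measurable (fun w => h w * cos (\sum_i a i * Y i w + b)).
Proof.
move=> bh; apply: bounded_measurableM => //.
by apply: bounded_measurable_cos; exact: measurable_lincomb.
Qed.

Lemma trig_multiplier_cst i c : trig_multiplier i (cst c).
Proof.
split; first exact: bounded_measurable_cst.
move=> h bh nh a b; under eq_Rintegral do rewrite mulrAC mulrC.
rewrite (RintegralZl _ measurableT) ?nh ?mulr0//.
by apply: bounded_measurable_integrable; exact: bounded_measurable_trig.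
Qed.

Lemma trig_multiplierD i u v : trig_multiplier i u -> trig_multiplier i v ->
  trig_multiplier i (fun x => u x + v x).
Proof.
move=> [bu nu] [bv nv]; split; first exact: bounded_measurableD.
move=> h bh nh a b; under eq_Rintegral do rewrite mulrDr mulrDl.
rewrite (RintegralD measurableT) ?nu ?nv ?addr0//; apply: bounded_measurable_integrable;
  apply: bounded_measurable_trig; apply: bounded_measurableM => //;
  exact: bounded_measurable_comp.
Qed.

Lemma trig_multiplierM i u v : trig_multiplier i u -> trig_multiplier i v ->
  trig_multiplier i (fun x => u x * v x).
Proof.
move=> [bu nu] [bv nv]; split; first exact: bounded_measurableM.
move=> h bh nh; have := nv _ _ (nu _ bh nh).
have bhu : bounded_measurable (fun w => h w * u (Y i w)).
  by apply: bounded_measurableM => //; exact: bounded_measurable_comp.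
move=> /(_ bhu) H a b; rewrite -[RHS](H a b).
by apply: eq_Rintegral => w _; rewrite mulrA.
Qed.

(** A product of two cosines is a mean of two cosines whose coefficients
    of [Y] differ from the original ones only at [i]. *)
Lemma trig_multiplier_cos i s c : trig_multiplier i (fun x => cos (s * x + c)).
Proof.
have bc : bounded_measurable (fun x : R => cos (s * x + c)).
  split; first exact: measurable_cos_affine.
  by exists 1 => x; rewrite ler_norml cos_geN1 cos_le1.
split=> // h bh nh a b.
have upd t w : \sum_j (a j + t * (j == i)%:R) * Y j w = \sum_j a j * Y j w + t * Y i w.
  under eq_bigr do rewrite mulrDl.
  rewrite big_split/=; congr (_ + _); rewrite (bigD1 i)//= eqxx mulr1 big1 ?addr0// => j.
  by move=> /negbTE ->; rewrite mulr0 mul0r.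
pose G t e w := h w * cos (\sum_j (a j + t * (j == i)%:R) * Y j w + e).
have iG t e : P.-integrable setT (EFin \o G t e).
  by apply: bounded_measurable_integrable; exact: bounded_measurable_trig.
transitivity (\int[P]_w (2^-1 * (G s (b + c) w + G (- s) (b - c) w))).
  apply: eq_Rintegral => w _; rewrite /G !upd.
  set A := \sum_j _; set B := Y i w.
  rewrite (_ : A + s * B + (b + c) = (A + b) + (s * B + c)); last by ring.
  rewrite (_ : A + - s * B + (b - c) = (A + b) - (s * B + c)); last by ring.
  by rewrite (cosB (A + b) (s * B + c)) (cosD (A + b) (s * B + c)); field.
rewrite (RintegralZl _ measurableT); last exact: (integrableD measurableT (iG _ _) (iG _ _)).
by rewrite (RintegralD measurableT (iG _ _) (iG _ _)) !nh addr0 mulr0.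
Qed.

Lemma trig_multiplier_lim i (u_ : nat -> R -> R) u (k : R) :
  (forall n, trig_multiplier i (u_ n)) -> (forall n x, `|u_ n x| <= k) ->
  (forall x, u_ n x @[n --> \oo] --> u x) -> trig_multiplier i u.
Proof.
move=> mu uk cu.
have bu : bounded_measurable u.
  split; last by exists k => x; exact: norm_limit_le (cu x).
  by apply: (measurable_fun_cvg (h := u_)) => [n|x _]; [have [[]] := mu n|exact: cu].
split=> // h bh nh a b.
have [l hl] := bh.2.
have k0 : 0 <= k := le_trans (normr_ge0 _) (uk 0%N 0).
apply: (@bounded_convergence_cst
  (fun n w => h w * u_ n (Y i w) * cos (\sum_j a j * Y j w + b)) _ (l * k)).
- move=> n; have [bun _] := mu n.
  apply: (bounded_measurable_trig a b (h := fun w => h w * u_ n (Y i w)) _).1.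
  by apply: bounded_measurableM => //; exact: bounded_measurable_comp.
- move=> n w; rewrite !normrM -[leRHS]mulr1; apply: ler_pM => //.
    by apply: ler_pM.
  by rewrite ler_norml cos_geN1 cos_le1.
- move=> w; apply: cvgM; last exact: cvg_cst.
  by apply: cvgM; [exact: cvg_cst|exact: cu].
- by move=> n; have [_ nun] := mu n; exact: nun.
Qed.

Let q (x : R) := x * (3 - x ^+ 2) / 2.

(** [1 - q x = (1 - x) ^+ 2 * (2 + x) / 2] and symmetrically for
    [1 + q x]. *)
Lemma cubic_norm_le1 x : `|x| <= 1 -> `|q x| <= 1.
Proof.
rewrite !ler_norml => /andP[x1 x2]; rewrite /q.
have h1 : 0 <= (1 - x) ^+ 2 * (2 + x) by rewrite mulr_ge0 ?sqr_ge0//; lra.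
have h2 : 0 <= (1 + x) ^+ 2 * (2 - x) by rewrite mulr_ge0 ?sqr_ge0//; lra.
by apply/andP; split; nra.
Qed.

Lemma cubic_iter_norm_le1 n x : `|x| <= 1 -> `|iter n q x| <= 1.
Proof. by move=> x1; elim: n => //= n; exact: cubic_norm_le1. Qed.

(** Iterating the cubic moves positive points to its attracting fixed
    point [1]: each step contracts [1 - y] by the factor [1 - x / 2], as the
    iterates stay above [x]. *)
Lemma cubic_iter_pos x : 0 < x <= 1 -> iter n q x @[n --> \oo] --> (1 : R).
Proof.
move=> /andP[x0 x1]; pose r := 1 - x / 2.
have H n : x <= iter n q x <= 1 /\ 1 - iter n q x <= r ^+ n.
  elim: n => [|n [/andP[h1 h2] h3]] /=; first by rewrite expr0 lexx x1; split=> //; lra.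
  set y := iter n q x in h1 h2 h3 *.
  have yq : y <= q y by rewrite /q; nra.
  have /cubic_norm_le1 : `|y| <= 1 by rewrite ler_norml h2 andbT; lra.
  rewrite ler_norml => /andP[_ q1]; rewrite (le_trans h1 yq) q1; split=> //.
  apply: (@le_trans _ _ (r * (1 - y))).
    by rewrite /q /r; nra.
  by rewrite exprS ler_wpM2l// /r; lra.
have r1 : `|r| < 1 by rewrite /r ltr_norml; apply/andP; split; lra.
apply/cvgrPdist_le => e e0.
have /cvgrPdist_le /(_ e e0) := cvg_expr r1.
apply: filterS => n; rewrite sub0r normrN => hn.
have [/andP[h1 h2] h3] := H n.
rewrite ger0_norm ?subr_ge0//; apply: (le_trans h3); apply: le_trans hn; exact: ler_norm.
Qed.

Lemma cubicN x : q (- x) = - q x.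
Proof. by rewrite /q sqrrN; ring. Qed.

(** The sign function on [-1, 1] is thus a bounded limit of polynomials,
    which is what a class closed under products and limits can exploit. *)
Lemma cubic_iter_sg x : `|x| <= 1 -> iter n q x @[n --> \oo] --> Num.sg x.
Proof.
move=> x1; have iN n y : iter n q (- y) = - iter n q y.
  by elim: n => //= n ->; exact: cubicN.
have [x0|x0|->] := ltgtP x 0.
- rewrite (ltr0_sg x0); have := @cubic_iter_pos (- x) _.
  rewrite oppr_gt0 x0/= lerNl; move: (x1); rewrite ler_norml => /andP[h _] /(_ h).
  have <- : (fun n => - iter n q (- x)) = (fun n => iter n q x).
    by apply/funext => n; rewrite iN opprK.
  exact: cvgN.
- by rewrite (gtr0_sg x0); apply: cubic_iter_pos; rewrite x0 (le_trans _ x1)// ler_norm.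
- rewrite sgr0 (_ : (fun n => iter n q 0) = cst 0); first exact: cvg_cst.
  by apply/funext; elim=> //= n ->; rewrite /q !mul0r.
Qed.

Lemma trig_multiplier_ext i u v : trig_multiplier i u -> u =1 v -> trig_multiplier i v.
Proof. by move=> mu /funext <-. Qed.

Lemma trig_multiplier_iter i u n : trig_multiplier i u -> trig_multiplier i (fun x => iter n q (u x)).
Proof.
move=> mu; elim: n => //= n IH.
apply: (trig_multiplier_ext (u := fun x => (cst 2^-1 x * iter n q (u x)) *
    (cst 3 x + (cst (- 1) x * iter n q (u x)) * iter n q (u x)))).
  apply: trig_multiplierM; first by apply: trig_multiplierM => //; exact: trig_multiplier_cst.
  apply: trig_multiplierD; first exact: trig_multiplier_cst.
  by apply: trig_multiplierM => //; apply: trig_multiplierM => //; exact: trig_multiplier_cst.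
by move=> x /=; rewrite /q /=; field.
Qed.

(** For large [l] the argument lies in ]-pi, pi[, where the sine has the
    sign of its argument. *)
Lemma sg_sin_cvg (y : R) : Num.sg (sin (y / l.+1%:R)) @[l --> \oo] --> Num.sg y.
Proof.
have [N Ny] : exists N, forall l, (N <= l)%N -> `|y / l.+1%:R| < pi.
  exists (Num.trunc `|y|) => l Nl; rewrite normrM normfV (ger0_norm (ler0n _ _)).
  rewrite ltr_pdivrMr ?ltr0n//.
  have h : `|y| < l.+1%:R by rewrite (lt_le_trans (truncnS_gt _))// ler_nat.
  by rewrite (lt_trans h)// -[ltLHS]mul1r ltr_pM2r ?ltr0n//; have := @pi_ge2 R; lra.
apply: cvg_near_cst; exists N => // l /= /Ny H.
have [y0|y0|->] := ltgtP y 0; last by rewrite mul0r sin0.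
- rewrite (ltr0_sg y0) ltr0_sg//.
  rewrite -oppr_gt0 -sinN; apply: sin_gt0_pi.
  rewrite -mulNr divr_gt0 ?oppr_gt0 ?ltr0n//=.
  by rewrite mulNr; apply: le_lt_trans H; rewrite -normrN ler_norm.
- rewrite (gtr0_sg y0) gtr0_sg//; apply: sin_gt0_pi.
  by rewrite divr_gt0 ?ltr0n//= (le_lt_trans (ler_norm _) H).
Qed.

(** The sign of [y - c] is the limit of the signs of
    [sin ((y - c) / l.+1)], each of which is the limit of the iterated cubic
    applied to the sine; the indicator is then [(sg ^+ 2 + sg) / 2]. *)
Lemma trig_multiplier_ray i c : trig_multiplier i (\1_`]c, +oo[).
Proof.
have msg : trig_multiplier i (fun y => Num.sg (y - c)).
  apply: (@trig_multiplier_lim i (fun l y => Num.sg (sin ((y - c) / l.+1%:R))) _ 1); first last.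
  - by move=> x; exact: sg_sin_cvg.
  - by move=> n x; rewrite normr_sg; case: (_ != 0); rewrite ?lexx ?ler01.
  move=> l; apply: (@trig_multiplier_lim i
     (fun n y => iter n q (sin ((y - c) / l.+1%:R))) _ 1).
  - move=> n; apply: (@trig_multiplier_iter i (fun y => sin ((y - c) / l.+1%:R))).
    apply: trig_multiplier_ext (trig_multiplier_cos i (l.+1%:R^-1) (- (c / l.+1%:R) - pi / 2)) _.
    by move=> x; rewrite addrA cos_sub_pihalf mulrC -mulrBl.
  - move=> n x; apply: cubic_iter_norm_le1.
    by rewrite ler_norml sin_geN1 sin_le1.
  - move=> x; apply: cubic_iter_sg.
    by rewrite ler_norml sin_geN1 sin_le1.
apply: (trig_multiplier_ext (u := fun y => cst 2^-1 y * (Num.sg (y - c) * Num.sg (y - c) + Num.sg (y - c)))).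
  apply: trig_multiplierM; first exact: trig_multiplier_cst.
  by apply: trig_multiplierD => //; exact: trig_multiplierM.
move=> y; rewrite indicE /cst; have [yc|yc|->] := ltgtP y c.
- rewrite memNset/= ?in_itv/= ?andbT ?(ltNge c) ?(ltW yc)//.
  by rewrite ltr0_sg ?subr_lt0// mulN1r opprK subrr mulr0.
- rewrite mem_set/= ?in_itv/= ?yc//.
  by rewrite gtr0_sg ?subr_gt0//; field.
- rewrite memNset/= ?in_itv/= ?ltxx//.
  by rewrite subrr sgr0 mul0r addr0 mulr0.
Qed.

Lemma trig_multiplierC i (A : set R) : trig_multiplier i (\1_A) -> trig_multiplier i (\1_(~` A)).
Proof.
move=> mA; apply: (trig_multiplier_ext (u := fun x => cst 1 x + cst (- 1) x * \1_A x)).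
  apply: trig_multiplierD; first exact: trig_multiplier_cst.
  by apply: trig_multiplierM => //; exact: trig_multiplier_cst.
by move=> x /=; rewrite !indicE in_setC; case: (x \in A) => /=; lra.
Qed.

Lemma trig_multiplierU i (A B : set R) : trig_multiplier i (\1_A) ->
  trig_multiplier i (\1_B) -> trig_multiplier i (\1_(A `|` B)).
Proof.
move=> mA mB; rewrite -[A `|` B]setCK setCU; apply: trig_multiplierC.
apply: (trig_multiplier_ext (u := fun x => \1_(~` A) x * \1_(~` B) x)).
  by apply: trig_multiplierM; exact: trig_multiplierC.
by move=> x; rewrite [in RHS]indicI.
Qed.

Lemma trig_multiplier_bigcup i (A : nat -> set R) :
  (forall k, trig_multiplier i (\1_(A k))) -> trig_multiplier i (\1_(\bigcup_k A k)).
Proof.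
(* The indicators of the partial unions converge pointwise. *)
move=> mA; apply: (@trig_multiplier_lim i (fun n => \1_(\big[setU/set0]_(k < n) A k)) _ 1).
- elim=> [|n IH]; last by rewrite big_ord_recr; exact: trig_multiplierU.
  rewrite big_ord0 indic0; exact: trig_multiplier_cst.
- by move=> n x; rewrite indicE; case: (_ \in _); rewrite ?normr1 ?normr0 ?ler01.
move=> x; have [[k _ Akx]|nA] := pselect ((\bigcup_k A k) x).
  apply: cvg_near_cst; exists k.+1 => // n /= kn.
  have U1 : (\bigcup_k A k) x by exists k.
  have U2 : (\big[setU/set0]_(k < n) A k) x by rewrite -bigcup_mkord; exists k.
  by rewrite !indicE (mem_set U1) (mem_set U2).
apply: cvg_near_cst; exists 0%N => // n _.
rewrite !indicE !memNset// -bigcup_mkord => -[k /= _ Akx]; apply: nA.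
by exists k.
Qed.

(** The sets whose indicator is a multiplier form a sigma-algebra that
    contains the open rays. *)
Lemma trig_multiplier_indic i (A : set R) : measurable A -> trig_multiplier i (\1_A).
Proof.
rewrite -[measurable A]/((R.-ocitv.-measurable).-sigma.-measurable A) RGenOInfty.measurableE.
move: A; apply: smallest_sub.
  split.
  - by rewrite /= indic0; exact: trig_multiplier_cst.
  - by move=> A /= mA; rewrite setTD; exact: trig_multiplierC.
  - by move=> A /= mA; exact: trig_multiplier_bigcup.
by move=> _ [x ->] /=; exact: trig_multiplier_ray.
Qed.

Lemma trig_null_indics h (S : 'I_m -> set R) (s : seq 'I_m) :
  bounded_measurable h -> trig_null h -> (forall i, measurable (S i)) ->
  trig_null (fun w => h w * \prod_(i <- s) \1_(S i) (Y i w)) /\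
  bounded_measurable (fun w => h w * \prod_(i <- s) \1_(S i) (Y i w)).
Proof.
move=> bh nh mS; elim: s => [|i s [IH1 IH2]].
  by split; under eq_fun do rewrite big_nil mulr1.
have [bi ni] := trig_multiplier_indic i (mS i).
have E : (fun w => h w * \prod_(j <- i :: s) \1_(S j) (Y j w)) =
    (fun w => h w * \prod_(j <- s) \1_(S j) (Y j w) * \1_(S i) (Y i w)).
  by apply/funext => w; rewrite big_cons; ring.
rewrite E; split; first exact: ni.
by apply: bounded_measurableM => //; exact: bounded_measurable_comp.
Qed.

End TrigonometricMultipliers.

Section Independence.
Context d (Omega : measurableType d) (R : realType) (P : probability Omega R).

Lemma prod_indic (m : nat) (Y : 'I_m -> Omega -> R) (S : 'I_m -> set R) w :
  \prod_i \1_(S i) (Y i w) = \1_[set w | forall i, S i (Y i w)] w :> R.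
Proof.
rewrite indicE; have [H|H] := pselect (forall i, S i (Y i w)).
  by rewrite mem_set// big1// => i _; rewrite indicE mem_set.
rewrite memNset//; have [i Hi] : exists i, ~ S i (Y i w) by exact/existsNP.
by rewrite (bigD1 i)//= indicE memNset// mul0r.
Qed.

Lemma measurable_box (m : nat) (Y : 'I_m -> Omega -> R) (S : 'I_m -> set R) :
  (forall i, measurable_fun setT (Y i)) -> (forall i, measurable (S i)) ->
  measurable [set w | forall i, S i (Y i w)].
Proof.
move=> mY mS; rewrite (_ : [set w | _] = \bigcap_(i in [set: 'I_m]) (Y i @^-1` S i)).
  apply: fin_bigcap_measurable => // i _.
  by rewrite -[_ @^-1` _]setTI; exact: mY.
by apply/seteqP; split => [w H i _|w H i]; exact: H.
Qed.

Lemma Rintegral_indic (A : set Omega) : measurable A -> \int[P]_w \1_A w = fine (P A).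
Proof. by move=> mA; rewrite /Rintegral integral_indic// setIT. Qed.

Lemma trig_null_box (m : nat) (Y : 'I_m -> Omega -> R) h (S : 'I_m -> set R) :
  (forall i, measurable_fun setT (Y i)) -> bounded_measurable h -> trig_null P Y h ->
  (forall i, measurable (S i)) ->
  \int[P]_w (h w * \1_[set w | forall i, S i (Y i w)] w) = 0.
Proof.
move=> mY bh nh mS.
have [/(_ (fun=> 0) 0) + _] := trig_null_indics mY (index_enum _) bh nh mS.
move=> H; rewrite -[RHS]H; apply: eq_Rintegral => w _.
rewrite prod_indic (_ : \sum_i 0 * Y i w = 0) ?add0r ?cos0 ?mulr1//.
by rewrite big1// => i _; rewrite mul0r.
Qed.

(** Nullity is used twice. First for [cos (s * Z + b)] minus its mean, which
    replaces the cosine of [Y] by the indicator of the box; then for that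
    indicator minus its mean, seen as a function that is null for [Z]. *)
Lemma independent_of_trig (Z : Omega -> R) (m : nat) (Y : 'I_m -> Omega -> R)
  (A : set R) (S : 'I_m -> set R) :
  measurable_fun setT Z -> (forall i, measurable_fun setT (Y i)) ->
  (forall s b (a : 'I_m -> R) c,
    \int[P]_w (cos (s * Z w + b) * cos (\sum_i a i * Y i w + c)) =
    \int[P]_w cos (s * Z w + b) * \int[P]_w cos (\sum_i a i * Y i w + c)) ->
  measurable A -> (forall i, measurable (S i)) ->
  (P [set w | A (Z w) /\ forall i, S i (Y i w)] =
   P [set w | A (Z w)] * P [set w | forall i, S i (Y i w)])%E.
Proof.
move=> mZ mY facE mA mS.
set W := [set w | forall i, S i (Y i w)].
have mW : measurable W by exact: measurable_box.
have mAZ : measurable [set w | A (Z w)] by rewrite -[X in measurable X]setTI; exact: mZ.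
have bW : bounded_measurable (\1_W : Omega -> R).
  split; first exact: measurable_indic.
  by exists 1 => w; rewrite indicE; case: (_ \in _); rewrite ?normr1 ?normr0 ?ler01.
have bcos s b : bounded_measurable (fun w => cos (s * Z w + b)).
  by apply: bounded_measurable_cos; exact: measurable_funM.
have bcosY a c : bounded_measurable (fun w => cos (\sum_i a i * Y i w + c)).
  by apply: bounded_measurable_cos; exact: measurable_lincomb.
(* The cosine of [Z] is uncorrelated with the box event. *)
have H1 s b : \int[P]_w (cos (s * Z w + b) * \1_W w) = \int[P]_w cos (s * Z w + b) * fine (P W).
  set c0 := \int[P]_w cos (s * Z w + b).
  pose h w := cos (s * Z w + b) + cst (- c0) w.
  have bh : bounded_measurable h by apply: bounded_measurableD => //; exact: bounded_measurable_cst.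
  have nh : trig_null P Y h.
    move=> a c; rewrite /h /cst; under eq_Rintegral do rewrite mulrDl.
    rewrite (RintegralD measurableT); first last.
    - by apply: bounded_measurable_integrable; apply: bounded_measurableM => //; exact: bounded_measurable_cst.
    - by apply: bounded_measurable_integrable; apply: bounded_measurableM.
    rewrite (RintegralZl _ measurableT); last exact: bounded_measurable_integrable.
    by rewrite facE mulNr subrr.
  have := trig_null_box mY bh nh mS.
  rewrite /h /cst; under eq_Rintegral do rewrite mulrDl.
  rewrite (RintegralD measurableT); first last.
  - by apply: bounded_measurable_integrable; apply: bounded_measurableM => //; exact: bounded_measurable_cst.
  - by apply: bounded_measurable_integrable; apply: bounded_measurableM.
  rewrite (RintegralZl _ measurableT); last exact: bounded_measurable_integrable.
  by rewrite Rintegral_indic// mulNr => /subr0_eq.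
(* The roles of [Z] and of the box are exchanged. *)
pose h w := \1_W w + cst (- fine (P W)) w.
have bh : bounded_measurable h by apply: bounded_measurableD => //; exact: bounded_measurable_cst.
have nh : trig_null P (fun _ : 'I_1 => Z) h.
  move=> a c; under eq_Rintegral do rewrite big_ord1.
  rewrite /h /cst; under eq_Rintegral do rewrite mulrDl mulrC.
  rewrite (RintegralD measurableT); first last.
  - by apply: bounded_measurable_integrable; apply: bounded_measurableM => //; exact: bounded_measurable_cst.
  - by apply: bounded_measurable_integrable; apply: bounded_measurableM.
  rewrite (RintegralZl _ measurableT); last exact: bounded_measurable_integrable.
  by rewrite H1; ring.
have := trig_null_box (S := fun=> A) (fun=> mZ) bh nh (fun=> mA).
rewrite (_ : [set w | _] = [set w | A (Z w)]); last first.
  by apply/seteqP; split => w //= H; exact: (H ord0).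
rewrite /h /cst; under eq_Rintegral do rewrite mulrDl.
have bA : bounded_measurable (\1_[set w | A (Z w)] : Omega -> R).
  split; first exact: measurable_indic.
  by exists 1 => w; rewrite indicE; case: (_ \in _); rewrite ?normr1 ?normr0 ?ler01.
rewrite (RintegralD measurableT); first last.
- by apply: bounded_measurable_integrable; apply: bounded_measurableM => //; exact: bounded_measurable_cst.
- by apply: bounded_measurable_integrable; apply: bounded_measurableM.
rewrite (RintegralZl _ measurableT); last exact: bounded_measurable_integrable.
rewrite Rintegral_indic//.
have -> : \int[P]_x (\1_W x * \1_[set w | A (Z w)] x) =
    \int[P]_x \1_(W `&` [set w | A (Z w)]) x.
  by apply: eq_Rintegral => w _; rewrite indicI.
rewrite Rintegral_indic; last exact: measurableI.
move=> /(canRL (addrK _)); rewrite add0r mulNr opprK => H.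
rewrite (_ : [set w | _ /\ _] = W `&` [set w | A (Z w)]); last by rewrite setIC.
rewrite -[LHS]fineK; last by apply: fin_num_measure; exact: measurableI.
rewrite H EFinM !fineK 1?muleC//; exact: fin_num_measure.
Qed.

End Independence.

(** * Gaussian spaces *)

Section GaussianSpace.
Context d (Omega : measurableType d) (R : realType) (P : probability Omega R).
Implicit Types (Y Z : Omega -> R).

(** A vector space of centred Gaussian variables. Variables are plain
    functions, and equality of members is equality of functions. *)
Definition gaussian_space (H : set (Omega -> R)) : Prop :=
  [/\ forall Y, H Y -> centered_gaussian P Y, H (cst 0) &
      forall a Y Z, H Y -> H Z -> H (fun w => a * Y w + Z w)].

Definition cov Y Z : R := \int[P]_w (Y w * Z w).

Definition lincomb (m : nat) (a : 'I_m -> R) (Y : 'I_m -> Omega -> R) : Omega -> R :=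
  fun w => \sum_i a i * Y i w.

Lemma covC Y Z : cov Y Z = cov Z Y.
Proof. by apply: eq_Rintegral => w _; rewrite mulrC. Qed.

Lemma cov_second_moment Y : second_moment P Y = cov Y Y.
Proof. by apply: eq_Rintegral => w _; rewrite expr2. Qed.

Lemma cov_ge0 Y : 0 <= cov Y Y.
Proof. by rewrite -cov_second_moment second_moment_ge0. Qed.

Variable H : set (Omega -> R).
Hypothesis gH : gaussian_space H.

Lemma gspace_gaussian Y : H Y -> centered_gaussian P Y.
Proof. by have [h _ _] := gH; exact: h. Qed.

Lemma gspace_measurable Y : H Y -> measurable_fun setT Y.
Proof. by move=> /gspace_gaussian[]. Qed.

Lemma gspace0 : H (cst 0). Proof. by have [] := gH. Qed.

Lemma gspaceZD a Y Z : H Y -> H Z -> H (fun w => a * Y w + Z w).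
Proof. by have [_ _ h] := gH; exact: h. Qed.

Lemma gspace_ext Y Z : H Y -> Y =1 Z -> H Z.
Proof. by move=> HY /funext <-. Qed.

Lemma gspaceZ a Y : H Y -> H (fun w => a * Y w).
Proof.
move=> HY; apply: gspace_ext (gspaceZD a HY gspace0) _ => w.
by rewrite /cst addr0.
Qed.

Lemma gspaceD Y Z : H Y -> H Z -> H (fun w => Y w + Z w).
Proof. by move=> HY HZ; apply: gspace_ext (gspaceZD 1 HY HZ) _ => w; rewrite mul1r. Qed.

Lemma gspaceBZ a Y Z : H Y -> H Z -> H (fun w => Y w - a * Z w).
Proof. by move=> HY HZ; apply: gspace_ext (gspaceZD (- a) HZ HY) _ => w; rewrite addrC mulNr. Qed.

Lemma gspace_lincomb m a (Y : 'I_m -> Omega -> R) :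
  (forall i, H (Y i)) -> H (lincomb a Y).
Proof.
elim: m a Y => [|m IH] a Y HY.
  by apply: gspace_ext gspace0 _ => w; rewrite /lincomb big_ord0.
pose Y' := fun i => Y (widen_ord (leqnSn m) i).
apply: gspace_ext (gspaceZD (a ord_max) (HY ord_max)
  (IH (fun i => a (widen_ord (leqnSn m) i)) Y' (fun i => HY _))) _ => w.
by rewrite /lincomb big_ord_recr/= addrC.
Qed.

(** Products are dominated by half the sum of the squares. *)
Lemma gspace_integrableM Y Z : H Y -> H Z ->
  P.-integrable setT (EFin \o (fun w => Y w * Z w)).
Proof.
move=> HY HZ.
have iY := gaussian_integrable_pow 2 (gspace_gaussian HY).
have iZ := gaussian_integrable_pow 2 (gspace_gaussian HZ).
apply: (le_integrable measurableT _ _ (integrableD measurableT iY iZ)).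
  by apply/measurable_EFinP; apply: measurable_funM; exact: gspace_measurable.
move=> w _ /=; rewrite lee_fin [leRHS]ger0_norm ?addr_ge0 ?sqr_ge0//.
rewrite ler_norml; apply/andP; split.
  by have := sqr_ge0 (Y w + Z w); have := sqr_ge0 (Y w); have := sqr_ge0 (Z w); nra.
by have := sqr_ge0 (Y w - Z w); have := sqr_ge0 (Y w); have := sqr_ge0 (Z w); nra.
Qed.

Lemma covZDl a Y Z W : H Y -> H Z -> H W ->
  cov (fun w => a * Y w + Z w) W = a * cov Y W + cov Z W.
Proof.
move=> HY HZ HW; rewrite /cov.
have iY := gspace_integrableM HY HW; have iZ := gspace_integrableM HZ HW.
rewrite -(RintegralZl _ measurableT iY) -(RintegralD measurableT _ iZ).
  by apply: eq_Rintegral => w _; rewrite mulrDl mulrA.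
by have := gspace_integrableM (gspaceZ a HY) HW; under eq_fun do rewrite -mulrA.
Qed.

Lemma cov0l W : cov (cst 0) W = 0.
Proof.
rewrite /cov; under eq_Rintegral do rewrite mul0r.
exact: (Rintegral_prob_cst P 0).
Qed.

Lemma covZl a Y W : H Y -> H W -> cov (fun w => a * Y w) W = a * cov Y W.
Proof.
move=> HY HW; rewrite -[RHS]addr0 -(cov0l W) -covZDl//; last exact: gspace0.
by congr cov; apply/funext => w; rewrite /cst addr0.
Qed.

Lemma covBZl a Y Z W : H Y -> H Z -> H W ->
  cov (fun w => Y w - a * Z w) W = cov Y W - a * cov Z W.
Proof.
move=> HY HZ HW; rewrite addrC -mulNr -covZDl//.
by congr cov; apply/funext => w; rewrite addrC mulNr.
Qed.

Lemma cov_lincombl m a (Y : 'I_m -> Omega -> R) W :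
  (forall i, H (Y i)) -> H W -> cov (lincomb a Y) W = \sum_i a i * cov (Y i) W.
Proof.
move=> + HW; elim: m a Y => [|m IH] a Y HY.
  rewrite big_ord0 -(cov0l W); congr cov.
  by apply/funext => w; rewrite /lincomb big_ord0.
pose a' := fun i => a (widen_ord (leqnSn m) i).
pose Y' := fun i => Y (widen_ord (leqnSn m) i).
have -> : lincomb a Y = (fun w => a ord_max * Y ord_max w + lincomb a' Y' w).
  by apply/funext => w; rewrite /lincomb big_ord_recr/= addrC.
have HY' i : H (Y' i) by exact: HY.
by rewrite (covZDl _ (HY _) (gspace_lincomb a' HY') HW) IH// big_ord_recr/= addrC.
Qed.

Lemma cov_lincomb m a (Y : 'I_m -> Omega -> R) b : (forall i, H (Y i)) ->
  cov (lincomb a Y) (lincomb b Y) = \sum_i \sum_j a i * b j * cov (Y i) (Y j).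
Proof.
move=> HY; rewrite cov_lincombl//; last exact: gspace_lincomb.
apply: eq_bigr => i _; rewrite covC cov_lincombl// mulr_sumr.
by apply: eq_bigr => j _; rewrite covC mulrA.
Qed.

Lemma cov_sqrZD a Y Z : H Y -> H Z ->
  cov (fun w => a * Y w + Z w) (fun w => a * Y w + Z w) =
  a ^+ 2 * cov Y Y + 2 * a * cov Y Z + cov Z Z.
Proof.
move=> HY HZ; have HW := gspaceZD a HY HZ.
rewrite (covZDl a HY HZ HW) (covC Y) (covC Z).
by rewrite (covZDl a HY HZ HY) (covZDl a HY HZ HZ) (covC Z Y); ring.
Qed.

(** Cauchy-Schwarz in the degenerate case: otherwise some combination of
    [Y] and [Z] would have negative variance. *)
Lemma cov_null Y Z : H Y -> H Z -> cov Y Y = 0 -> cov Y Z = 0.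
Proof.
move=> HY HZ Y0; apply/eqP/negPn/negP => YZ0.
have := cov_ge0 (fun w => (- (cov Z Z + 1) / (2 * cov Y Z)) * Y w + Z w).
rewrite cov_sqrZD// Y0 mulr0 add0r.
set c := cov Y Z in YZ0 *.
have -> : 2 * (- (cov Z Z + 1) / (2 * c)) * c = - (cov Z Z + 1) by field.
lra.
Qed.

Lemma gspace_cos Y b : H Y ->
  \int[P]_w cos (Y w + b) = expR (- (cov Y Y / 2)) * cos b.
Proof. by move=> /gspace_gaussian gY; rewrite gaussian_cos// cov_second_moment. Qed.

(** Orthogonality makes the variance of [s * Z + \sum_i a_i Y_i] additive,
    so the Gaussian formula for cosine moments factorises; conclude by
    [independent_of_trig]. *)
Lemma gspace_independent Z m (Y : 'I_m -> Omega -> R) (A : set R) (S : 'I_m -> set R) :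
  H Z -> (forall i, H (Y i)) -> (forall i, cov Z (Y i) = 0) ->
  measurable A -> (forall i, measurable (S i)) ->
  (P [set w | A (Z w) /\ forall i, S i (Y i w)] =
   P [set w | A (Z w)] * P [set w | forall i, S i (Y i w)])%E.
Proof.
move=> HZ HY ZY mA mS; apply: independent_of_trig => //.
- exact: gspace_measurable.
- by move=> i; exact: gspace_measurable.
move=> s b a c.
have HL : H (lincomb a Y) by exact: gspace_lincomb.
have covZL : cov Z (lincomb a Y) = 0.
  rewrite covC cov_lincombl// big1// => i _; by rewrite covC ZY mulr0.
have HsZ := gspaceZ s HZ.
have HLN := gspaceZ (- s) HZ.
have H1 := gspaceZD s HZ HL.
have H2 := gspaceZD (- s) HZ HL.
transitivity (\int[P]_w (2^-1 * (cos ((s * Z w + lincomb a Y w) + (b + c)) +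
    cos ((- s * Z w + lincomb a Y w) + (c - b))))).
  apply: eq_Rintegral => w _; rewrite -/(lincomb a Y w).
  set x := s * Z w; set y := lincomb a Y w.
  rewrite (_ : x + y + (b + c) = (y + c) + (x + b)); last by ring.
  rewrite (_ : - s * Z w + y + (c - b) = (y + c) - (x + b)); last by rewrite /x; ring.
  by rewrite (cosB (y + c) (x + b)) (cosD (y + c) (x + b)); field.
have i1 t e : H t -> P.-integrable setT (EFin \o (fun w => cos (t w + e))).
  move=> Ht; apply: bounded_measurable_integrable.
  by apply: bounded_measurable_cos; exact: gspace_measurable.
rewrite (RintegralZl _ measurableT); last first.
  exact: (integrableD measurableT (i1 _ (b + c) H1) (i1 _ (c - b) H2)).
rewrite (RintegralD measurableT (i1 _ (b + c) H1) (i1 _ (c - b) H2)).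
rewrite !gspace_cos// !cov_sqrZD// covZL.
rewrite (_ : cov (fun w => s * Z w) (fun w => s * Z w) = s ^+ 2 * cov Z Z); last first.
  by rewrite covZl// covC covZl//; ring.
rewrite sqrrN !mulr0 !addr0 -!/(lincomb a Y) mulrDl opprD expRD.
by rewrite (cosD b) (cosB c); field.
Qed.

End GaussianSpace.

(** * Small balls and sign patterns in a Gaussian space *)

Section SmallBalls.
Context d (Omega : measurableType d) (R : realType) (P : probability Omega R).
Implicit Types (Y Z : Omega -> R).
Variable H : set (Omega -> R).
Hypothesis gH : gaussian_space P H.

(** Uniform positivity of the variance makes the Gram matrix of [Y]
    invertible. *)
Lemma gram_solve m (Y : 'I_m -> Omega -> R) (lam : R) (v : 'I_m -> R) :
  (forall i, H (Y i)) -> 0 < lam ->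
  (forall a, lam * \sum_i a i ^+ 2 <= cov P (lincomb a Y) (lincomb a Y)) ->
  exists c, forall i, cov P (lincomb c Y) (Y i) = v i.
Proof.
move=> HY lam0 pos.
pose G : 'M[R]_m := \matrix_(i, j) cov P (Y i) (Y j).
have covE (u : 'rV[R]_m) j : (u *m G) 0 j = cov P (lincomb (fun i => u 0 i) Y) (Y j).
  rewrite mxE (cov_lincombl gH)//; apply: eq_bigr => i _; by rewrite mxE.
have Gu : G \in unitmx.
  rewrite -row_free_unit; apply: inj_row_free => u uG.
  have : lam * \sum_i u 0 i ^+ 2 <= 0.
    apply: le_trans (pos _) _; rewrite (cov_lincombl gH)//; last exact: (gspace_lincomb gH).
    rewrite big1// => j _; by rewrite covC -covE uG mxE mulr0.
  rewrite pmulr_rle0// => su.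
  have : \sum_i u 0 i ^+ 2 = 0.
    by apply/eqP; rewrite eq_le su sumr_ge0// => i _; exact: sqr_ge0.
  move/psumr_eq0P => /(_ (fun i _ => sqr_ge0 _)) ui.
  by apply/rowP => i; rewrite mxE; apply/eqP; rewrite -sqrf_eq0 ui.
exists (fun i => (\row_j v j *m invmx G) 0 i) => i.
by rewrite -covE mulmxKV// mxE.
Qed.

Lemma measurable_preimage Y (A : set R) : H Y -> measurable A -> measurable [set w | A (Y w)].
Proof. by move=> HY mA; rewrite -[X in measurable X]setTI; exact: (gspace_measurable gH HY). Qed.

Lemma measure_cells Y (E : set Omega) (t s : R) (n : nat) : H Y -> measurable E -> 0 < s ->
  (forall w, E w -> t <= Y w < t + s *+ n) ->
  P E = (\sum_(k < n) P (E `&` [set w | `[(t + s *+ k)%R, (t + s *+ k.+1)%R[%classic (Y w)]))%E.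
Proof.
move=> HY mE s0 EY.
rewrite -measure_bigsetU_ord//; first last.
- apply/trivIsetP => i j _ _ ij; rewrite -subset0 => w /= [[_]].
  rewrite in_itv/= => /andP[i1 i2] [_]; rewrite in_itv/= => /andP[j1 j2].
  have lt1 (a b : nat) : t + s *+ a < t + s *+ b -> (a < b)%N.
    by rewrite ltrD2l ltr_pMn2l.
  have := lt1 _ _ (le_lt_trans i1 j2); have := lt1 _ _ (le_lt_trans j1 i2).
  rewrite !ltnS => h1 h2; move/eqP: ij; apply; apply/val_inj/eqP.
  by rewrite eqn_leq h1 h2.
- move=> k; apply: measurableI => //; apply: measurable_preimage => //.
rewrite -(bigcup_mkord n
  (fun k => E `&` [set w | `[(t + s *+ k)%R, (t + s *+ k.+1)%R[%classic (Y w)])).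
congr (P _); apply/seteqP; split => [w Ew|w].
  have /andP[h1 h2] := EY w Ew.
  pose k := Num.trunc ((Y w - t) / s).
  have q0 : 0 <= (Y w - t) / s by rewrite divr_ge0 ?subr_ge0 ?(ltW s0).
  have /andP[k1 k2] := truncn_itv q0.
  have kn : (k < n)%N.
    rewrite -(ltr_nat R); apply: le_lt_trans k1 _.
    by rewrite ltr_pdivrMr// mulr_natl ltrBlDl.
  exists k => //; split=> //=.
  rewrite in_itv/=; apply/andP; split.
    by rewrite -lerBrDl -mulr_natl -ler_pdivlMr.
  by rewrite -ltrBlDl -mulr_natl -ltr_pdivrMr.
by move=> [k _ []].
Qed.

(** Without conditional laws: cut the range of the combination of the [Y i]
    into cells of length [2 * delta]. On a cell the first condition
    confines [Z] to an interval of length [4 * delta], an event that is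
    independent of everything expressed with [Y]. *)
Lemma gspace_conditional_itv_le Z m (Y : 'I_m -> Omega -> R) (b : 'I_m -> R) (lam delta : R) :
  H Z -> (forall i, H (Y i)) -> (forall i, cov P Z (Y i) = 0) ->
  0 < lam -> 0 < delta -> lam <= cov P Z Z ->
  (P [set w | `|(Z w + lincomb b Y w)| <= delta /\ forall i, `|Y i w| <= delta]%R <=
   (2 * delta / Num.sqrt lam)%:E * P [set w | forall i, `|Y i w| <= delta]%R)%E.
Proof.
move=> HZ HY ZY lam0 delta0 lamV.
have HL : H (lincomb b Y) by exact: (gspace_lincomb gH).
pose I : set R := `[- delta, delta]%classic.
have IE (x : R) : (`|x| <= delta) = (x \in `[- delta, delta]).
  by rewrite in_itv/= ler_norml.
set E' := [set w | forall i, `|Y i w| <= delta].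
set E := [set w | _ /\ _].
have mE' : measurable E'.
  rewrite /E' (_ : [set w | _] = [set w | forall i, I (Y i w)]).
    apply: (@measurable_box _ _ _ _ Y (fun=> I)) => i; first exact: (gspace_measurable gH).
    exact: measurable_itv.
  by apply/seteqP; split => w h i; have := h i; rewrite /I /= -IE.
have mE : measurable E.
  rewrite (_ : E = [set w | I (Z w + lincomb b Y w)] `&` E'); last first.
    by apply/seteqP; split => w [h1 h2]; split=> //; move: h1; rewrite /I /= -IE.
  apply: measurableI => //.
  by apply: (measurable_preimage (A := I) (gspaceD gH HZ HL)); exact: measurable_itv.
(* On the event the combination lies in a bounded range, so [N] cells are enough. *)
pose N := (Num.trunc (\sum_i `|b i|)).+1.
have LN w : E' w -> - (delta *+ N) <= lincomb b Y w < - (delta *+ N) + (2 * delta) *+ N.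
  move=> Ew; have h : `|lincomb b Y w| < delta *+ N.
    apply: (@le_lt_trans _ _ ((\sum_i `|b i|) * delta)).
      rewrite mulr_suml; apply: le_trans (ler_norm_sum _ _ _) _.
      by apply: ler_sum => i _; rewrite normrM ler_wpM2l.
    by rewrite -mulr_natl ltr_pM2r// truncnS_gt.
  move: h; rewrite ltr_norml => /andP[h1 h2]; rewrite ltW//=.
  rewrite (_ : - _ + _ = delta *+ N)//.
  by rewrite -mulrnAr mulr_natl mulr2n addrA addNr add0r.
rewrite (@measure_cells (lincomb b Y) E' _ _ _ HL mE' _ LN) ?mulr_gt0//.
rewrite (@measure_cells (lincomb b Y) E (- (delta *+ N)) (2 * delta) N HL mE) ?mulr_gt0//; last first.
  by move=> w [_]; exact: LN.
rewrite ge0_sume_distrr//; apply: lee_sum => k _.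
set c := _ + _ *+ k; set c' := _ + _ *+ k.+1.
have c'E : c' = c + 2 * delta by rewrite /c /c' (mulrSr _ k) addrA.
(* The cell condition is one more box condition, on a combination of [Y]. *)
pose Y' (i : 'I_m.+1) := if unlift ord_max i is Some j then Y j else lincomb b Y.
pose S' (i : 'I_m.+1) := if unlift ord_max i is Some j then I else `[c, c'[%classic.
have boxE : E' `&` [set w | `[c, c'[%classic (lincomb b Y w)] =
    [set w | forall i, S' i (Y' i w)].
  apply/seteqP; split => [w [h1 h2] i|w h].
    by rewrite /S' /Y'; case: unliftP => [j _|_] //; rewrite /I /= -IE; exact: h1.
  split; last by have := h ord_max; rewrite /S' /Y' unlift_none.
  by move=> i; have := h (lift ord_max i); rewrite /S' /Y' liftK /I /= -IE.
have HY' i : H (Y' i) by rewrite /Y'; case: unliftP.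
have ZY' i : cov P Z (Y' i) = 0.
  rewrite /Y'; case: unliftP => // _; rewrite covC (cov_lincombl gH)// big1// => j _.
  by rewrite covC ZY mulr0.
have mS' i : measurable (S' i) by rewrite /S'; case: unliftP => [j _|_]; exact: measurable_itv.
apply: (@le_trans _ _ (P [set w | `[(- delta - c')%R, (delta - c)%R]%classic (Z w) /\
    forall i, S' i (Y' i w)])).
  apply: le_measure; rewrite ?inE.
  - by apply: measurableI => //; exact: measurable_preimage.
  - apply: measurableI; first exact: measurable_preimage.
    by apply: (@measurable_box _ _ _ _ Y' S') => // i; exact: (gspace_measurable gH).
  - move=> w [[h1 h2] h3].
    have B : (E' `&` [set w | `[c, c'[%classic (lincomb b Y w)]) w by [].
    rewrite boxE in B; split; last exact: B.
    move: h1 h3; rewrite /= !in_itv/= ler_norml => /andP[h1 h4] /andP[h5 h6].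
    by apply/andP; split; lra.
rewrite (gspace_independent gH HZ HY' ZY')// -boxE.
apply: lee_wpmul2r => //.
have V0 : 0 < second_moment P Z by rewrite cov_second_moment (lt_le_trans lam0).
apply: (le_trans (gaussian_itv_le (gspace_gaussian gH HZ) V0 _)).
  by rewrite c'E; lra.
rewrite lee_fin c'E.
rewrite (_ : delta - c - _ = 4 * delta); last by ring.
rewrite -[leLHS]mulrC.
have -> : (2 * Num.sqrt (second_moment P Z))^-1 * (4 * delta) = 2 * delta / Num.sqrt (second_moment P Z).
  by field; rewrite gt_eqF// sqrtr_gt0.
rewrite ler_wpM2l ?mulr_ge0 ?(ltW delta0)// lef_pV2 ?posrE ?sqrtr_gt0//.
by apply: ler_wsqrtr; rewrite cov_second_moment.
Qed.

Definition extend0 m (a : 'I_m -> R) (c : R) (k0 i : 'I_m.+1) : R :=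
  if unlift k0 i is Some j then a j else c.

Lemma lincomb_extend m (a : 'I_m -> R) c (k0 : 'I_m.+1) (Y : 'I_m.+1 -> Omega -> R) w :
  lincomb (extend0 a c k0) Y w = c * Y k0 w + lincomb a (fun j => Y (lift k0 j)) w.
Proof.
rewrite /lincomb (bigD1_ord k0)//=; congr (_ + _).
  by rewrite /extend0 unlift_none.
by apply: eq_bigr => j _; rewrite /extend0 liftK.
Qed.

Lemma sum_sqr_extend m (a : 'I_m -> R) c (k0 : 'I_m.+1) :
  \sum_i extend0 a c k0 i ^+ 2 = c ^+ 2 + \sum_i a i ^+ 2.
Proof.
rewrite (bigD1_ord k0)//=; congr (_ + _).
  by rewrite /extend0 unlift_none.
by apply: eq_bigr => j _; rewrite /extend0 liftK.
Qed.

(** Induction on [m]: the last variable is a combination of the others plus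
    an orthogonal remainder, and the hypothesis gives this remainder variance
    at least [lam]. *)
Lemma gspace_small_ball_le m (Y : 'I_m -> Omega -> R) (lam delta : R) :
  (forall i, H (Y i)) -> 0 < lam -> 0 < delta ->
  (forall a, lam * \sum_i a i ^+ 2 <= cov P (lincomb a Y) (lincomb a Y)) ->
  (P [set w | forall i, `|Y i w| <= delta]%R <= ((2 * delta / Num.sqrt lam) ^+ m)%:E)%E.
Proof.
move=> + lam0 delta0; elim: m Y => [|m IH] Y HY pos.
  by rewrite expr0 probability_le1// (_ : [set w | _] = setT)//; apply/seteqP; split => // w _ [].
pose Y' j := Y (lift ord_max j).
have HY' j : H (Y' j) by exact: HY.
have posE a c : lam * (c ^+ 2 + \sum_i a i ^+ 2) <=
    cov P (fun w => c * Y ord_max w + lincomb a Y' w) (fun w => c * Y ord_max w + lincomb a Y' w).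
  rewrite -(sum_sqr_extend a c ord_max); apply: le_trans (pos _) _.
  by rewrite le_eqVlt; apply/orP; left; apply/eqP; congr cov; apply/funext => w;
    rewrite lincomb_extend.
have pos' a : lam * \sum_i a i ^+ 2 <= cov P (lincomb a Y') (lincomb a Y').
  have := posE a 0; rewrite expr0n/= add0r.
  rewrite (_ : (fun w => 0 * Y ord_max w + lincomb a Y' w) = lincomb a Y')//.
  by apply/funext => w; rewrite mul0r add0r.
have [c cE] := gram_solve (fun i => cov P (Y ord_max) (Y' i)) HY' lam0 pos'.
have HL : H (lincomb c Y') by exact: (gspace_lincomb gH).
pose Z w := Y ord_max w - 1 * lincomb c Y' w.
have HZ : H Z by exact: (gspaceBZ gH).
have ZY i : cov P Z (Y' i) = 0 by rewrite (covBZl gH)// cE mul1r subrr.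
have VZ : lam <= cov P Z Z.
  have := posE (fun i => - c i) 1; rewrite (_ : (fun w => _) = Z); last first.
    apply/funext => w; rewrite /Z !mul1r /lincomb -sumrN; congr (_ + _).
    by apply: eq_bigr => i _; rewrite mulNr.
  apply: le_trans; rewrite expr1n -[leLHS]mulr1 ler_wpM2l ?(ltW lam0)// lerDl.
  by apply: sumr_ge0 => i _; exact: sqr_ge0.
rewrite (_ : [set w | _] = [set w | `|(Z w + lincomb c Y' w)| <= delta /\
    forall i, `|Y' i w| <= delta]); last first.
  apply/seteqP; split => w h.
    by split => [|i]; [rewrite /Z mul1r subrK|]; exact: h.
  move=> i; case: (unliftP ord_max i) => [j ->|->]; first exact: h.2.
  by have := h.1; rewrite /Z mul1r subrK.
apply: (le_trans (gspace_conditional_itv_le c HZ HY' ZY lam0 delta0 VZ)).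
rewrite exprS (EFinM _ (_ ^+ m)); apply: lee_wpmul2l; last exact: IH.
by rewrite lee_fin divr_ge0// mulr_ge0// ltW.
Qed.

Lemma gspace_sd_itv_ge Y (s : R) : H Y -> 0 <= s <= 1 ->
  ((s / 30)%:E <= P [set w | `[(- (s * Num.sqrt (cov P Y Y)))%R,
     (s * Num.sqrt (cov P Y Y))%R]%classic (Y w)])%E.
Proof.
move=> HY /andP[s0 s1]; have gY := gspace_gaussian gH HY.
have [V0|V0] := eqVneq (cov P Y Y) 0.
  rewrite V0 sqrtr0 mulr0 oppr0 set_itv1.
  rewrite (_ : P _ = 1%E); first by rewrite lee_fin; lra.
  by apply: gaussian_null => //; rewrite cov_second_moment.
have Vp : 0 < second_moment P Y by rewrite lt_def second_moment_ge0 cov_second_moment V0.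
have h1 : - 2 <= - s by lra.
have h2 : s <= 2 by lra.
have := gaussian_itv_ge gY Vp h1 h2; rewrite cov_second_moment mulNr.
by rewrite (_ : (s - - s) / 60 = s / 30)//; field.
Qed.

(** Induction on the number of generating variables. Split off [Y ord0] by
    orthogonal projection: its contribution to each combination has standard
    deviation at most [1], so it is at most [s] with probability [s / 30], and
    the remaining contributions are independent of it and have variance at most
    [1] again. The bound depends on the number [r] of generators and not on the
    number [m] of combinations. *)
Lemma gspace_box_ge r (Y : 'I_r -> Omega -> R) m (L : 'I_m -> 'I_r -> R) (s : R) :
  (forall k, H (Y k)) -> 0 <= s <= 1 ->
  (forall j, cov P (lincomb (L j) Y) (lincomb (L j) Y) <= 1) ->
  (((s / 30) ^+ r)%:E <= P [set w | forall j, `|lincomb (L j) Y w| <= r%:R * s]%R)%E.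
Proof.
move=> + s01; have /andP[s0 s1] := s01; elim: r Y L => [|r IH] Y L HY V1.
  rewrite expr0 (_ : [set w | _] = setT); first by rewrite probability_setT.
  by apply/seteqP; split => // w _ j /=; rewrite /lincomb big_ord0 normr0 mul0r.
pose Y0 := Y ord0; pose V := cov P Y0 Y0.
pose beta k := cov P (Y (lift ord0 k)) Y0 / V.
pose Y' k w := Y (lift ord0 k) w - beta k * Y0 w.
pose L' j k := L j (lift ord0 k).
pose alpha j := L j ord0 + \sum_k L' j k * beta k.
have HY0 : H Y0 by exact: HY.
have HY' k : H (Y' k) by exact: (gspaceBZ gH).
have HL' j : H (lincomb (L' j) Y') by exact: (gspace_lincomb gH).
have LE j w : lincomb (L j) Y w = alpha j * Y0 w + lincomb (L' j) Y' w.
  rewrite /lincomb big_ord_recl /alpha mulrDl -addrA; congr (_ + _).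
  by rewrite mulr_suml -big_split/=; apply: eq_bigr => k _; rewrite /Y' /L'; ring.
have Y0Y' k : cov P Y0 (Y' k) = 0.
  rewrite covC (covBZl gH)// /beta -/V; have [V0|V0] := eqVneq V 0.
    by rewrite V0 mulr0 subr0 covC (cov_null gH).
  by rewrite divfK ?subrr.
have Y0L j : cov P Y0 (lincomb (L' j) Y') = 0.
  by rewrite covC (cov_lincombl gH)// big1// => k _; rewrite covC Y0Y' mulr0.
have VE j : cov P (lincomb (L j) Y) (lincomb (L j) Y) =
    alpha j ^+ 2 * V + cov P (lincomb (L' j) Y') (lincomb (L' j) Y').
  rewrite (_ : lincomb (L j) Y = (fun w => alpha j * Y0 w + lincomb (L' j) Y' w)); last first.
    by apply/funext => w; exact: LE.
  by rewrite (cov_sqrZD gH)// Y0L mulr0 addr0.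
have V0 : 0 <= V by exact: cov_ge0.
have V1' j : cov P (lincomb (L' j) Y') (lincomb (L' j) Y') <= 1.
  by have := V1 j; rewrite VE; have := mulr_ge0 (sqr_ge0 (alpha j)) V0; lra.
have aV j : `|alpha j| * Num.sqrt V <= 1.
  rewrite -(ler_pXn2r (n := 2)) ?nnegrE ?mulr_ge0 ?sqrtr_ge0//.
  rewrite exprMn sqr_sqrtr// real_normK ?num_real// expr1n.
  by have := V1 j; rewrite VE; have := cov_ge0 P (lincomb (L' j) Y'); lra.
pose A : set R := `[- (s * Num.sqrt V), s * Num.sqrt V]%classic.
pose S : set R := `[- (r%:R * s), r%:R * s]%classic.
have SE (x : R) : S x = (`|x| <= r%:R * s) :> Prop by rewrite /S /= in_itv/= ler_norml.
have mA : measurable A by exact: measurable_itv.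
have mS : measurable S by exact: measurable_itv.
have mbox (c : R) m' (Z : 'I_m' -> Omega -> R) : (forall i, H (Z i)) ->
    measurable [set w | forall i, `|Z i w| <= c].
  move=> HZ; rewrite (_ : [set w | _] = [set w | forall i, `[- c, c]%classic (Z i w)]).
    by apply: (@measurable_box _ _ _ _ Z (fun=> `[- c, c]%classic)) => i;
      [exact: (gspace_measurable gH)|exact: measurable_itv].
  by apply/seteqP; split => w h i; have := h i; rewrite /= in_itv/= ler_norml.
apply: (@le_trans _ _ (P [set w | A (Y0 w) /\ forall j, S (lincomb (L' j) Y' w)])).
  rewrite (gspace_independent gH HY0 HL' Y0L mA (fun=> mS)).
  rewrite exprS EFinM; apply: lee_pmul.
  - by rewrite lee_fin divr_ge0.
  - by rewrite lee_fin exprn_ge0// divr_ge0.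
  - exact: gspace_sd_itv_ge.
  - have := IH Y' L' HY' V1'; congr (_ <= P _)%E; apply/seteqP; split => w h j; have := h j.
      by rewrite SE.
    by rewrite SE.
apply: le_measure; rewrite ?inE.
- rewrite (_ : [set w | _] = [set w | A (Y0 w)] `&` [set w | forall j, S (lincomb (L' j) Y' w)])//.
  apply: measurableI; first exact: measurable_preimage.
  by apply: (@measurable_box _ _ _ _ (fun j => lincomb (L' j) Y') (fun=> S)) => // j; exact: (gspace_measurable gH).
- by apply: (mbox _ _ (fun j => lincomb (L j) Y)) => j; exact: (gspace_lincomb gH).
move=> w [+ h] j; have := h j; rewrite SE LE => h1; rewrite /A /= in_itv/= -ler_norml => h2.
apply: (le_trans (ler_normD _ _)).
have -> : r.+1%:R * s = s + r%:R * s by rewrite -natr1; ring.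
apply: lerD => //; rewrite normrM.
have := ler_wpM2l (normr_ge0 (alpha j)) h2; have := aV j; nra.
Qed.

(** Let [c] solve the Gram system with right-hand side [(-1) ^+ i] and let
    [Z] be the normalised combination [c]. Then
    [X i = rho * (-1) ^+ i * Z + Rv i] with [Rv i] independent of [Z] and
    of variance at most [1]. The signs alternate as soon as [Z >= 1] and all
    [|Rv i| < rho]. As [\sum_i c i * Rv i = 0], the [n.+1] remainders are
    combinations of [n] of them, so that [gspace_box_ge] gives a power [n]. *)
Lemma gspace_alternating_ge n (X : 'I_n.+1 -> Omega -> R) (lam : R) :
  (forall i, H (X i)) -> (forall i, cov P (X i) (X i) = 1) -> 0 < lam <= 1 ->
  (forall a, lam * \sum_i a i ^+ 2 <= cov P (lincomb a X) (lincomb a X)) ->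
  ((60^-1 * (Num.sqrt (lam / n.+1%:R) / (30 * n.+1%:R)) ^+ n)%:E <=
   P [set w | forall i : 'I_n.+1, 0 < (-1) ^+ i * X i w]%R)%E.
Proof.
move=> HX X1 /andP[lam0 lam1] pos.
pose v (i : 'I_n.+1) : R := (-1) ^+ i.
have v2 i : v i * v i = 1 by rewrite /v -exprMn mulrNN mulr1 expr1n.
have [c cE] := gram_solve v HX lam0 pos.
have HC : H (lincomb c X) by exact: (gspace_lincomb gH).
pose q := \sum_i c i * v i.
have qE : cov P (lincomb c X) (lincomb c X) = q.
  rewrite (cov_lincombl gH)//; apply: eq_bigr => i _; by rewrite covC cE.
have [k0 ck0] : exists k0, c k0 != 0.
  apply: contrapT => /forallNP c0.
  have := cE ord0; rewrite (cov_lincombl gH)// big1 => [/esym/eqP|i _].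
    by rewrite /v expr0 oner_eq0.
  by have /negP := c0 i; rewrite negbK => /eqP ->; rewrite mul0r.
have c2 : 0 < \sum_i c i ^+ 2.
  rewrite (bigD1 k0)//= ltr_wpDr ?sumr_ge0//; last by rewrite exprn_even_gt0.
  by move=> i _; exact: sqr_ge0.
have lq : lam * \sum_i c i ^+ 2 <= q by rewrite -qE; exact: pos.
have q0 : 0 < q by apply: lt_le_trans lq; rewrite mulr_gt0.
have n0 : 0 < n.+1%:R :> R by rewrite ltr0n.
(* Cauchy-Schwarz, as a sum of squares around the mean [q / n.+1]. *)
have cs : q ^+ 2 <= n.+1%:R * \sum_i c i ^+ 2.
  have : 0 <= \sum_i (c i * v i - q / n.+1%:R) ^+ 2 by apply: sumr_ge0 => i _; exact: sqr_ge0.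
  have -> : \sum_i (c i * v i - q / n.+1%:R) ^+ 2 = \sum_i c i ^+ 2 - q ^+ 2 / n.+1%:R.
    transitivity (\sum_i (c i ^+ 2 + (c i * v i * (- 2 * q / n.+1%:R) + q ^+ 2 / n.+1%:R ^+ 2))).
      apply: eq_bigr => i _; have -> : c i ^+ 2 = (c i * v i) ^+ 2 by rewrite exprMn (expr2 (v i)) v2 mulr1.
      field.
      by rewrite gt_eqF.
    rewrite !big_split/= -mulr_suml -/q sumr_const card_ord -mulr_natl.
    by field; rewrite gt_eqF.
  by rewrite subr_ge0 ler_pdivrMr// mulrC.
have lamq : lam * q <= n.+1%:R.
  rewrite -(ler_pM2r q0) -mulrA -expr2; apply: (le_trans (ler_wpM2l (ltW lam0) cs)).
  by rewrite mulrCA ler_wpM2l// ltW.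
pose rho := Num.sqrt q^-1.
have rho0 : 0 < rho by rewrite sqrtr_gt0 invr_gt0.
have rho2 : rho ^+ 2 = q^-1 by rewrite sqr_sqrtr// invr_ge0 ltW.
(* A lower bound of [rho] that depends on [lam] and [n] only. *)
pose rho' := Num.sqrt (lam / n.+1%:R).
have rho'0 : 0 < rho' by rewrite sqrtr_gt0 divr_gt0.
have rr : rho' <= rho.
  by apply: ler_wsqrtr; rewrite ler_pdivrMr// mulrC ler_pdivlMr.
have rho'1 : rho' <= 1.
  rewrite -sqrtr1 ler_sqrt// ler_pdivrMr// mul1r (le_trans lam1)//.
  by rewrite ler1n.
pose Z w := rho * lincomb c X w.
have HZ : H Z by exact: (gspaceZ gH).
have ZX i : cov P Z (X i) = rho * v i by rewrite (covZl gH)// cE.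
have ZZ : cov P Z Z = 1.
  rewrite (covZl gH)// covC (covZl gH)// qE mulrA -expr2 rho2 mulVf//.
  by rewrite gt_eqF.
pose Rv i w := X i w - (rho * v i) * Z w.
have HR i : H (Rv i) by exact: (gspaceBZ gH).
have ZR i : cov P Z (Rv i) = 0.
  by rewrite covC (covBZl gH)// ZZ covC ZX mulr1 subrr.
have VR i : cov P (Rv i) (Rv i) <= 1.
  have := X1 i; rewrite (_ : X i = (fun w => (rho * v i) * Z w + Rv i w)); last first.
    by apply/funext => w; rewrite /Rv addrC subrK.
  rewrite (cov_sqrZD gH)// ZR ZZ; have := sqr_ge0 (rho * v i); lra.
(* [Z] is a multiple of the combination [c], so the remainders satisfy one linear relation. *)
have cR w : \sum_i c i * Rv i w = 0.
  have E i : c i * Rv i w = c i * X i w - (c i * v i) * (rho * Z w) by rewrite /Rv; ring.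
  under eq_bigr do rewrite E.
  rewrite sumrB -mulr_suml -/q /Z (mulrA rho) -expr2 rho2 mulrA divff ?gt_eqF//.
  by rewrite mul1r subrr.
(* The remainder of index [k0] is eliminated by this relation. *)
pose L (i : 'I_n.+1) (k : 'I_n) : R :=
  if unlift k0 i is Some j then (j == k)%:R else - (c (lift k0 k) / c k0).
pose Yk k := Rv (lift k0 k).
have LE i : lincomb (L i) Yk = Rv i.
  apply/funext => w; rewrite /lincomb /L; case: unliftP => [j ->|->].
    rewrite (bigD1 j)//= eqxx mul1r big1 ?addr0// => k.
    by rewrite eq_sym => /negbTE ->; rewrite mul0r.
  have := cR w; rewrite (bigD1_ord k0)//= => /eqP; rewrite addrC addr_eq0 => /eqP h.
  apply: (mulfI ck0); rewrite -[RHS]opprK -h mulr_sumr -sumrN.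
  by apply: eq_bigr => k _; rewrite /Yk; field.
pose s := rho' / n.+1%:R.
have s01 : 0 <= s <= 1.
  rewrite divr_ge0 ?(ltW rho'0)//= ler_pdivrMr// mul1r (le_trans rho'1)//.
  by rewrite ler1n.
have ns : n%:R * s < rho.
  apply: lt_le_trans rr; rewrite /s mulrA ltr_pdivrMr// mulrC ltr_pM2l// ltr_nat//.
have := @gspace_box_ge n Yk n.+1 L s (fun k => HR _) s01.
have VL j : cov P (lincomb (L j) Yk) (lincomb (L j) Yk) <= 1 by rewrite LE.
move=> /(_ VL) boxP.
pose A : set R := `[1, 2]%classic.
pose S : set R := `[- (n%:R * s), n%:R * s]%classic.
have SE (x : R) : S x = (`|x| <= n%:R * s) :> Prop by rewrite /S /= in_itv/= ler_norml.
have mA : measurable A by exact: measurable_itv.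
have mS : measurable S by exact: measurable_itv.
apply: (@le_trans _ _ (P [set w | A (Z w) /\ forall j, S (Rv j w)])).
  rewrite (gspace_independent gH HZ HR ZR mA (fun=> mS)).
  rewrite EFinM; apply: lee_pmul.
  - by rewrite lee_fin invr_ge0.
  - by rewrite lee_fin exprn_ge0// divr_ge0 ?sqrtr_ge0// mulr_ge0.
  - have := @gaussian_itv_ge _ _ _ P Z 1 2 (gspace_gaussian gH HZ).
    rewrite cov_second_moment ZZ sqrtr1 !mulr1 => /(_ ltr01 _ (lexx _)) h.
    by apply: le_trans (h _); [rewrite lee_fin; lra|lra].
  - rewrite -/rho' (_ : rho' / _ = s / 30); last by rewrite /s; field; rewrite gt_eqF.
    apply: (le_trans boxP); rewrite le_eqVlt; apply/orP; left; apply/eqP.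
    congr (P _); apply/seteqP; split => w h j; have := h j; rewrite LE SE//.
apply: le_measure; rewrite ?inE.
- rewrite (_ : [set w | _] = [set w | A (Z w)] `&` [set w | forall j, S (Rv j w)])//.
  apply: measurableI; first exact: measurable_preimage.
  by apply: (@measurable_box _ _ _ _ Rv (fun=> S)) => // j; exact: (gspace_measurable gH).
- rewrite (_ : [set w | _] = [set w | forall i, `]0, +oo[%classic (v i * X i w)]); last first.
    by apply/seteqP; split => w h i; have := h i; rewrite /= in_itv/= andbT.
  apply: (@measurable_box _ _ _ _ (fun i w => v i * X i w) (fun=> `]0, +oo[%classic)) => i.
    exact: (gspace_measurable gH (gspaceZ gH _ (HX i))).
  exact: measurable_itv.
move=> w [+ h] j; have := h j; rewrite SE => h1; rewrite /A /= in_itv/= => /andP[h2 _].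
have -> : X j w = rho * v j * Z w + Rv j w by rewrite /Rv addrC subrK.
rewrite -/(v j) mulrDr mulrA (mulrCA (v j)) v2 mulr1.
have : `|v j * Rv j w| < rho.
  rewrite normrM /v normrX normrN1 expr1n mul1r.
  exact: le_lt_trans h1 ns.
rewrite ltr_norml => /andP[h3 _].
have := ler_wpM2l (ltW rho0) h2; lra.
Qed.

End SmallBalls.

(** * Zeros and derivatives of smooth functions *)

Section SmoothPaths.
Context (R : realType).
Implicit Types (F : nat -> R -> R) (f : R -> R).

(** A smooth function together with all its derivatives. *)
Definition derivative_tower F : Prop :=
  forall k t, is_derive (t : R) 1 (F k) (F k.+1 t).

Lemma is_derive_continuous f f' : (forall t : R, is_derive t 1 f (f' t)) -> continuous f.
Proof.
move=> df t; apply/differentiable_continuous/derivable1_diffP.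
by have [] := df t.
Qed.

Lemma lt_path_le_last (x : R) s : path <%R x s -> x <= last x s.
Proof.
elim: s x => //= y s IH x /andP[xy ps].
exact: le_trans (ltW xy) (IH _ ps).
Qed.

(** The zeros are given in increasing order, so that the zeros of the
    derivative, one in each gap, come in increasing order too. *)
Lemma rolle_path f f' (x : R) s : (forall t : R, is_derive t 1 f (f' t)) ->
  path <%R x s -> (forall y, y \in x :: s -> f y = 0) ->
  exists s', [/\ size s' = size s, path <%R x s',
    forall y, y \in s' -> y <= last x s & forall y, y \in s' -> f' y = 0].
Proof.
move=> df; elim: s x => [|y s IH] x /=; first by exists [::].
move=> /andP[xy ps] f0.
have [|s' [s1 s2 s3 s4]] := IH y ps.
  by move=> z zs; apply: f0; rewrite in_cons zs orbT.
have [|||c cxy dc] := @Rolle _ f x y xy.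
- by move=> t _; have [] := df t.
- by apply: continuous_subspaceT; exact: (is_derive_continuous df).
- by rewrite !f0// !in_cons eqxx ?orbT.
move: cxy; rewrite in_itv/= => /andP[xc cy].
have yl : y <= last y s by exact: lt_path_le_last.
exists (c :: s'); split => /=.
- by rewrite s1.
- rewrite xc/=; case: s' s2 {s1 s3 s4} => //= z s' /andP[yz ->].
  by rewrite (lt_trans cy yz).
- by move=> z; rewrite in_cons => /orP[/eqP ->|/s3//]; rewrite (le_trans (ltW cy)).
- move=> z; rewrite in_cons => /orP[/eqP ->|/s4//].
  by rewrite -(@derive_val _ _ _ _ _ _ _ (df c)) (@derive_val _ _ _ _ _ _ _ dc).
Qed.

Lemma rolle_tower F n x s : derivative_tower F -> size s = n -> path <%R x s ->
  (forall y, y \in x :: s -> F 0%N y = 0) ->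
  exists2 xi, x <= xi <= last x s & F n xi = 0.
Proof.
elim: n F x s => [|n IH] F x s tF ss ps F0.
  by exists x; [rewrite lexx lt_path_le_last|rewrite F0// mem_head].
have [s' [s1 s2 s3 s4]] := rolle_path (tF 0%N) ps F0.
case: s' s1 s2 s3 s4 => [|x' s'] /=; first by rewrite ss.
rewrite ss => -[s1] /andP[xx' ps'] s3 s4.
have [xi /andP[h1 h2] h3] := IH (fun k => F k.+1) x' s' (fun k => tF k.+1) s1 ps' s4.
exists xi => //; rewrite (le_trans (ltW xx') h1) (le_trans h2)//.
by apply: s3; exact: mem_last.
Qed.

Lemma rolle_tower_uniq F n (s : seq R) (a b : R) : derivative_tower F -> size s = n.+1 ->
  uniq s -> (forall y, y \in s -> a <= y <= b /\ F 0%N y = 0) ->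
  exists2 xi, a <= xi <= b & F n xi = 0.
Proof.
move=> tF ss us sF; pose s' := sort <=%R s.
have : sorted <%R s' by rewrite lt_sorted_uniq_le sort_uniq us sort_le_sorted.
have ms' y : (y \in s') = (y \in s) by rewrite mem_sort.
have : size s' = n.+1 by rewrite size_sort.
case: s' ms' => // x r ms' /= [sr] pr.
have [|xi /andP[h1 h2] h3] := rolle_tower tF sr pr.
  by move=> y; rewrite ms' => /sF[].
exists xi => //; apply/andP; split.
  apply: le_trans h1; have : x \in s by rewrite -ms' mem_head.
  by move=> /sF[/andP[]].
apply: (le_trans h2); have : last x r \in s by rewrite -ms' mem_last.
by move=> /sF[/andP[]].
Qed.

Lemma derivn_monic (p : {poly R}) n : p \is monic -> size p = n.+1 -> p^`(n) = (n`!%:R)%:P.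
Proof.
move=> /monicP mp sp; apply/polyP => i; rewrite coef_derivn coefC.
case: i => [|i] /=.
  by rewrite addn0 ffactnn; move: mp; rewrite lead_coefE sp/= => ->.
by rewrite nth_default ?mul0rn// sp addnS ltnS leq_addr.
Qed.

(** Subtract from [F 0] the multiple of the monic polynomial with roots [s]
    that makes the difference vanish at [x] too, and apply Rolle [n] times. *)
Lemma interpolation_remainder F n (s : seq R) (a b x : R) : derivative_tower F ->
  size s = n -> uniq s -> (forall y, y \in s -> a <= y <= b /\ F 0%N y = 0) ->
  a <= x <= b ->
  exists2 xi, a <= xi <= b & F 0%N x = F n xi / n`!%:R * \prod_(y <- s) (x - y).
Proof.
(* At a zero both sides vanish. *)
move=> tF ss us sF xab; have [xs|xs] := boolP (x \in s).
  exists x => //; rewrite (sF _ xs).2 (big_rem x)//= subrr mul0r mulr0//.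
pose w : {poly R} := \prod_(y <- s) ('X - y%:P).
have wx y : w.[y] = \prod_(z <- s) (y - z).
  by rewrite horner_prod; apply: eq_bigr => z _; rewrite hornerXsubC.
have wx0 : w.[x] != 0.
  rewrite wx prodf_seq_neq0; apply/allP => y ys /=.
  by rewrite subr_eq0; apply: contra xs => /eqP ->.
pose c := F 0%N x / w.[x].
pose G k u := F k u - c * (w^`(k)).[u].
have tG : derivative_tower G.
  move=> k t; rewrite /G derivnS.
  have h1 := tF k t; have h2 := is_derive_poly (w^`(k)) t.
  by apply: is_derive_eq; rewrite /GRing.scale/=; ring.
have [||y|xi xiab] := @rolle_tower_uniq G n (x :: s) a b tG.
- by rewrite /= ss.
- by rewrite /= xs.
- rewrite in_cons => /orP[/eqP ->|ys].
    by split => //; rewrite /G derivn0 /c divfK ?subrr.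
  have [h1 h2] := sF _ ys; split => //; rewrite /G derivn0 h2 wx (big_rem y)//=.
  by rewrite subrr mul0r mulr0 subr0.
rewrite /G derivn_monic ?monic_prod_XsubC//; last by rewrite size_prod_XsubC ss.
rewrite hornerC => /eqP; rewrite subr_eq0 => /eqP FE.
exists xi => //; rewrite -wx FE mulfK ?pnatr_eq0 -?lt0n ?fact_gt0//.
by rewrite /c divfK.
Qed.

Lemma norm_le_of_zeros F n (s : seq R) (T M x : R) : derivative_tower F ->
  size s = n -> uniq s -> (forall y, y \in s -> 0 <= y <= T /\ F 0%N y = 0) ->
  0 <= x <= T -> (forall y, 0 <= y <= T -> `|F n y| <= M) ->
  `|F 0%N x| <= T ^+ n / n`!%:R * M.
Proof.
move=> tF ss us sF xT FM.
have [xi xiT ->] := interpolation_remainder tF ss us sF xT.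
rewrite !normrM normfV normr_nat mulrC mulrA mulrAC; apply: ler_pM => //; last exact: FM.
rewrite ler_wpM2r ?invr_ge0//.
  rewrite -ss big_seq normr_prod.
  apply: (@le_trans _ _ (\prod_(y <- s | y \in s) T)).
    apply: ler_prod => y ys; rewrite normr_ge0/=.
    have [/andP[y0 yT] _] := sF _ ys; have /andP[x0 x1] := xT.
    by rewrite ler_norml; apply/andP; split; lra.
  by rewrite -big_seq big_const_seq count_predT iter_mulr_1.
Qed.

Definition fdiff (h : R) f : R -> R := fun t => f (t + h) - f t.

(** Induction on [k]: the mean value theorem for the [k]-th difference
    replaces one difference by [h] times a derivative. *)
Lemma fdiff_mvt F (h : R) k (t : R) : derivative_tower F -> 0 <= h ->
  exists2 xi, t <= xi <= t + k%:R * h & iter k (fdiff h) (F 0%N) t = h ^+ k * F k xi.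
Proof.
move=> + h0; elim: k F t => [|k IH] F t tF.
  by exists t; rewrite ?mul0r ?addr0 ?lexx ?expr0 ?mul1r.
have dk j (u : R) (G : nat -> R -> R) : derivative_tower G ->
    is_derive u 1 (iter j (fdiff h) (G 0%N)) (iter j (fdiff h) (G 1%N) u).
  move=> tG; elim: j u => [|j IHj] u /=; first exact: tG.
  rewrite {1}/fdiff.
  have h1 : is_derive u 1 (fun v => iter j (fdiff h) (G 0%N) (v + h))
     (iter j (fdiff h) (G 1%N) (u + h)).
    have := @is_derive1_comp _ (iter j (fdiff h) (G 0%N)) (fun v : R => v + h) u
      (iter j (fdiff h) (G 1%N) (u + h)) 1 _ _.
    by rewrite mulr1; apply; apply: is_derive_eq; rewrite addr0.
  by apply: is_derive_eq.
have [xi0 xi0t E0] : exists2 xi, t <= xi <= t + h &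
    iter k.+1 (fdiff h) (F 0%N) t = h * iter k (fdiff h) (F 1%N) xi.
  rewrite /= {1}/fdiff; have [->|hn0] := eqVneq h 0.
    by exists t; rewrite ?addr0 ?lexx// subrr mul0r.
  have tth : t < t + h by rewrite ltrDl lt_def hn0.
  have [c] := @MVT _ (iter k (fdiff h) (F 0%N)) (iter k (fdiff h) (F 1%N)) _ _ tth
    (fun u _ => dk k u F tF)
    (continuous_subspaceT (is_derive_continuous (fun u => dk k u F tF))).
  rewrite in_itv/= => /andP[c1 c2] ->; exists c; first by rewrite !ltW.
  by rewrite addrAC subrr add0r mulrC.
have [xi /andP[x1 x2] E] := IH (fun j => F j.+1) xi0 (fun j => tF j.+1).
exists xi; last by rewrite E0 E exprS mulrA.
have /andP[y1 y2] := xi0t; rewrite (le_trans y1 x1)/= (le_trans x2)//.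
by rewrite -natr1 mulrDl mul1r; lra.
Qed.

(** [counting] is infinite on infinite sets, which contain sequences of any
    length. *)
Lemma counting_ge (A : set R) n :
  (n%:R%:E <= counting A :> \bar R)%E <->
  exists s : seq R, [/\ size s = n, uniq s & forall x, x \in s -> A x].
Proof.
rewrite /counting; case: asboolP => [fA|nfA]; last first.
  split=> _; last by rewrite leey.
  have [B BA nB] := infinite_set_fset n nfA.
  exists (take n (finmap.enum_fset B)); split.
  - by rewrite size_takel.
  - exact/take_uniq/finmap.fset_uniq.
  - by move=> x /mem_take xB; exact: BA.
rewrite lee_fin ler_nat; split => [nA|[s [ss us sA]]].
  exists (take n (finmap.enum_fset (fset_set A))); split.
  - by rewrite size_takel.
  - exact/take_uniq/finmap.fset_uniq.
  - by move=> x /mem_take; rewrite in_fset_set// => /set_mem.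
rewrite -ss; apply: uniq_leq_size => // x /sA Ax.
by rewrite in_fset_set//; exact/mem_set.
Qed.

Lemma alternating_zeros f n (t : nat -> R) : continuous f ->
  (forall i, (i < n)%N -> t i < t i.+1) ->
  (forall i, (i <= n)%N -> 0 < (-1) ^+ i * f (t i)) ->
  exists s : seq R, [/\ size s = n, uniq s & forall x, x \in s -> t 0%N <= x <= t n /\ f x = 0].
Proof.
move=> cf; elim: n t => [|n IH] t lt_t ft; first by exists [::].
have [s [ss us sz]] := IH t (fun i h => lt_t i (ltnW h)) (fun i h => ft i (leqW h)).
have [c cn fc] : exists2 c, t n < c < t n.+1 & f c = 0.
  have h1 := ft n (leqnSn n); have h2 := ft n.+1 (leqnn _).
  have [||c] := @IVT _ f (t n) (t n.+1) 0 (ltW (lt_t n (ltnSn n))).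
  - exact: continuous_subspaceT.
  - move: h1 h2; rewrite exprS mulN1r mulNr -signr_odd.
    case: (odd n) => /=; rewrite ?expr1 ?expr0 ?mulN1r ?mul1r ?opprK => h1 h2.
      by rewrite ge_min le_max; apply/andP; split; apply/orP; [left|right]; lra.
    by rewrite ge_min le_max; apply/andP; split; apply/orP; [right|left]; lra.
  rewrite in_itv/= => /andP[c1 c2] fc; exists c => //.
  rewrite !lt_def c1 c2 !andbT; apply/andP; split.
    by apply/eqP => E; move: h1; rewrite -E fc mulr0 ltxx.
  by apply/eqP => E; move: h2; rewrite E fc mulr0 ltxx.
have /andP[c1 c2] := cn.
have t0n : t 0%N <= t n.
  elim: (n) lt_t => // k IHk h; apply: le_trans (IHk _) (ltW (h k _)) => //.
  by move=> i ik; apply: h; exact: leqW.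
exists (c :: s); split; first by rewrite /= ss.
  rewrite /= us andbT; apply/negP => /sz[/andP[_ cn'] _].
  by rewrite leNgt c1 in cn'.
move=> x; rewrite in_cons => /orP[/eqP ->|/sz[/andP[x0 xn] fx]].
  by split=> //; rewrite (le_trans t0n (ltW c1)) (ltW c2).
by split => //; rewrite x0 (le_trans xn)// (ltW (lt_t _ _)).
Qed.

End SmoothPaths.

(** * Measurability of the number of zeros *)

Section MeasurableZeroCount.
Context d (Omega : measurableType d) (R : realType).
Variable X : R -> Omega -> R.
Hypothesis mX : forall t, measurable_fun setT (X t).
Hypothesis cX : forall w, continuous (X^~ w).

Lemma grid_approx (a b x : R) (l : nat) : a <= x <= b ->
  exists2 j, (j <= l)%N & a + (b - a) * (j%:R / l.+1%:R) <= x <= a + (b - a) * (j.+1%:R / l.+1%:R).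
Proof.
move=> /andP[ax xb]; have l0 : 0 < l.+1%:R :> R by rewrite ltr0n.
have [ab|ab] := leP b a.
  have bE : b = a by apply/eqP; rewrite eq_le ab (le_trans ax xb).
  by exists 0%N => //; rewrite bE subrr !mul0r !addr0 ax -bE.
have ba0 : 0 < b - a by rewrite subr_gt0.
pose y := (x - a) / (b - a) * l.+1%:R.
have y0 : 0 <= y by rewrite mulr_ge0// divr_ge0 ?subr_ge0// ltW.
have yl : y <= l.+1%:R by rewrite ler_piMl// ler_pdivrMr// mul1r lerD2r.
have /andP[y1 y2] := truncn_itv y0.
have xE : x = a + (b - a) * (y / l.+1%:R).
  by rewrite /y; field; rewrite !gt_eqF.
have [jl|lj] := leqP (Num.trunc y) l.
  exists (Num.trunc y) => //; rewrite xE !lerD2l !(ler_pM2l ba0) !ler_pM2r ?invr_gt0//.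
  by rewrite y1 ltW.
have yE : y = l.+1%:R.
  by apply/eqP; rewrite eq_le yl (le_trans _ y1)// ler_nat.
exists l => //; rewrite xE !lerD2l !(ler_pM2l ba0) !ler_pM2r ?invr_gt0// yE lexx.
by rewrite ler_nat leqnSn.
Qed.

(** By continuity and compactness, a path vanishes on [a, b] if and only if
    it takes arbitrarily small values on the grids. *)
Lemma measurable_zero_itv (a b : R) : a <= b ->
  measurable [set w | exists2 x, a <= x <= b & X x w = 0].
Proof.
move=> ab.
pose q l j := a + (b - a) * ((minn j l.+1)%:R / l.+1%:R).
have qab l j : a <= q l j <= b.
  have h0 : 0 <= (minn j l.+1)%:R / l.+1%:R :> R by rewrite divr_ge0.
  have h1 : (minn j l.+1)%:R / l.+1%:R <= 1 :> R.
    by rewrite ler_pdivrMr ?ltr0n// mul1r ler_nat geq_minr.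
  rewrite /q; apply/andP; split; first by rewrite lerDl mulr_ge0// subr_ge0.
  by rewrite -lerBrDl ler_piMr// subr_ge0.
rewrite (_ : [set w | _] = \bigcap_i \bigcup_l \bigcup_j
    [set w | `]- (i.+1%:R^-1), i.+1%:R^-1[%classic (X (q l j) w)]).
  apply: bigcapT_measurable => i; apply: bigcupT_measurable => l.
  apply: bigcupT_measurable => j.
  by rewrite -[X in measurable X]setTI; apply: mX => //; exact: measurable_itv.
apply/seteqP; split => [w [x xab xw] i _|w H].
  have i0 : 0 < i.+1%:R^-1 :> R by rewrite invr_gt0 ltr0n.
  have /cvgrPdist_lt /(_ _ i0) [e /= e0 He] := @cX w x.
  pose l := Num.trunc ((b - a) / e).
  have hl : (b - a) / l.+1%:R < e.
    rewrite ltr_pdivrMr ?ltr0n// mulrC -ltr_pdivrMr//; exact: truncnS_gt.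
  have [j jl /andP[j1 j2]] := grid_approx l xab.
  exists l => //; exists j => //=.
  have qE : q l j = a + (b - a) * (j%:R / l.+1%:R) by rewrite /q (minn_idPl _)// leqW.
  have : `|X x w - X (q l j) w| < i.+1%:R^-1.
    apply: He; rewrite /= qE; apply: le_lt_trans hl.
    rewrite ger0_norm ?subr_ge0// lerBlDl; apply: (le_trans j2).
    rewrite le_eqVlt -[j.+1%:R]natr1; apply/orP; left; apply/eqP; field.
    by rewrite gt_eqF ?ltr0n.
  by rewrite xw sub0r normrN in_itv/= ltr_norml.
have cn : {within `[a, b], continuous (fun x => `|X x w|)}.
  apply: continuous_subspaceT => x; apply: continuous_comp; first exact: cX.
  exact: norm_continuous.
have [c] := EVT_min ab cn; rewrite in_itv/= => cab cmin.
exists c => //; apply/eqP; apply: contraT => Xc0.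
have c0 : 0 < `|X c w| by rewrite normr_gt0.
pose i := Num.trunc (`|X c w|^-1).
have hi : i.+1%:R^-1 < `|X c w|.
  rewrite invf_plt ?posrE ?ltr0n//; exact: truncnS_gt.
have [l _ [j _ /=]] := H i I.
rewrite in_itv/= -ltr_norml => h.
have := cmin (q l j); rewrite in_itv/= qab => /(_ isT) hh.
by have := lt_trans (le_lt_trans hh h) hi; rewrite ltxx.
Qed.

Lemma seq_separation (s : seq R) :
  exists2 e : R, 0 < e & forall x y, x \in s -> y \in s -> x != y -> e <= `|x - y|.
Proof.
have one (x : R) (r : seq R) : exists2 e : R, 0 < e & forall y, y \in r -> x != y -> e <= `|x - y|.
  elim: r => [|z r [e e0 He]]; first by exists 1.
  have [xz|xz] := eqVneq x z.
    exists e => // y; rewrite in_cons => /orP[/eqP ->|yr]; first by rewrite xz eqxx.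
    exact: He.
  exists (Num.min e `|x - z|); first by rewrite lt_min e0 normr_gt0 subr_eq0.
  move=> y; rewrite in_cons => /orP[/eqP -> _|yr xy]; first by rewrite ge_min lexx orbT.
  by rewrite ge_min He.
elim: s => [|z s [e e0 He]]; first by exists 1.
have [e' e'0 He'] := one z s.
exists (Num.min e e'); first by rewrite lt_min e0.
move=> x y; rewrite !in_cons => /orP[/eqP ->|xs] /orP[/eqP ->|ys] xy.
- by rewrite eqxx in xy.
- by rewrite ge_min He' ?orbT.
- by rewrite distrC ge_min He' ?orbT// eq_sym.
- by rewrite ge_min He.
Qed.

(** Distinct zeros are separated by some gap, so for a fine enough grid they
    lie in pairwise nonadjacent cells; conversely zeros in nonadjacent closed
    cells are distinct. This describes the event by countably many events on
    cells. *)
Lemma measurable_zero_count (T : R) n : 0 < T ->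
  measurable [set w | exists s : seq R, [/\ size s = n, uniq s &
    forall x, x \in s -> 0 <= x <= T /\ X x w = 0]].
Proof.
move=> T0.
pose cell k (i : nat) w := exists2 x, T * (i%:R / k.+1%:R) <= x <= T * (i.+1%:R / k.+1%:R) & X x w = 0.
pose sep k (g : {ffun 'I_n -> 'I_k.+1}) := forall i j, i != j -> (g i + 1 < g j)%N \/ (g j + 1 < g i)%N.
have cellab k (i : nat) : T * (i%:R / k.+1%:R) <= T * (i.+1%:R / k.+1%:R).
  by rewrite ler_pM2l// ler_pM2r ?invr_gt0 ?ltr0n// ler_nat.
rewrite (_ : [set w | _] = \bigcup_k \bigcup_(g in [set g | sep k g]) \bigcap_(j in [set: 'I_n])
    [set w | cell k (g j) w]).
  apply: bigcupT_measurable => k; apply: fin_bigcup_measurable.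
    exact: sub_finite_set (@finite_finset _ setT).
  move=> g _; apply: fin_bigcap_measurable => // j _.
  exact: measurable_zero_itv.
apply/seteqP; split => [w [s [ss us sz]]|w [k _ [g sg H]]].
  have [e e0 He] := seq_separation s.
  (* A mesh below half of the separation [e]. *)
  pose k := Num.trunc (2 * T / e).
  have k0 : 0 < k.+1%:R :> R by rewrite ltr0n.
  have hk : 2 * T / k.+1%:R < e.
    rewrite ltr_pdivrMr// -ltr_pdivrMl// mulrC; exact: truncnS_gt.
  have js (j : 'I_n) : nth 0 s j \in s by rewrite mem_nth// ss.
  have ex (j : 'I_n) : {i : 'I_k.+1 | T * (i%:R / k.+1%:R) <= nth 0 s j <= T * (i.+1%:R / k.+1%:R)}.
    apply/cid; have [xT _] := sz _ (js j).
    have [i ik] := grid_approx k xT.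
    rewrite subr0 !add0r => hi; exists (Ordinal (ik : (i < k.+1)%N)) => //.
  exists k => //; exists [ffun j => sval (ex j)].
    move=> i j ij /=; rewrite !ffunE.
    have := svalP (ex i); have := svalP (ex j).
    set gi := sval (ex i); set gj := sval (ex j) => /andP[j1 j2] /andP[i1 i2].
    have xy : nth 0 s i != nth 0 s j by rewrite nth_uniq ?ss.
    have hij := He _ _ (js i) (js j) xy.
    apply/orP; apply: contraT; rewrite negb_or -!leqNgt => /andP[a1 a2].
    have : `|nth 0 s i - nth 0 s j| <= 2 * T / k.+1%:R; last first.
      by move=> hh; have := le_lt_trans (le_trans hij hh) hk; rewrite ltxx.
    have c1 : gi.+1%:R <= gj%:R + 2 :> R.
      by rewrite -(natrD _ _ 2) ler_nat; move: a1 a2; rewrite !addn1 addn2.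
    have c2 : gj.+1%:R <= gi%:R + 2 :> R.
      by rewrite -(natrD _ _ 2) ler_nat; move: a1 a2; rewrite !addn1 addn2.
    have E (u v : R) : u <= v + 2 -> T * (u / k.+1%:R) <= T * (v / k.+1%:R) + 2 * T / k.+1%:R.
      move=> uv; rewrite (_ : T * (v / _) + _ = T * ((v + 2) / k.+1%:R)); last by field; rewrite gt_eqF.
      by rewrite ler_pM2l// ler_pM2r ?invr_gt0.
    have := E _ _ c1; have := E _ _ c2 => d1 d2.
    rewrite ler_norml; apply/andP; split; last by rewrite lerBlDr addrC; apply: (le_trans i2); apply: (le_trans d2); rewrite lerD2r.
    by rewrite lerNl opprB lerBlDr addrC; apply: (le_trans j2); apply: (le_trans d1); rewrite lerD2r.
  move=> j _ /=; rewrite ffunE; exists (nth 0 s j); first exact: (svalP (ex j)).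
  by have [] := sz _ (js j).
have ex (j : 'I_n) : {x : R | T * ((g j)%:R / k.+1%:R) <= x <= T * ((g j).+1%:R / k.+1%:R) /\ X x w = 0}.
  by apply/cid; have [x h1 h2] := H j I; exists x.
pose z j := sval (ex j).
have zin : injective z.
  move=> i j zij; apply/eqP; apply: contraT => /sg.
  have [/andP[i1 i2] _] := svalP (ex i); have [/andP[j1 j2] _] := svalP (ex j).
  have lt1 (a b : nat) : (a + 1 < b)%N -> T * (a.+1%:R / k.+1%:R) < T * (b%:R / k.+1%:R).
    by rewrite addn1 => ab; rewrite ltr_pM2l// ltr_pM2r ?invr_gt0 ?ltr0n// ltr_nat.
  rewrite -/(z i) in i1 i2; rewrite -/(z j) -zij in j1 j2.
  by move=> [/lt1 h|/lt1 h]; [have := le_lt_trans i2 (lt_le_trans h j1)|have := le_lt_trans j2 (lt_le_trans h i1)]; rewrite ltxx.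
exists [seq z j | j <- enum 'I_n]; split.
- by rewrite size_map size_enum_ord.
- by rewrite map_inj_uniq// enum_uniq.
move=> x /mapP[j _ ->]; have [/andP[j1 j2] j3] := svalP (ex j); split => //.
rewrite -/(z j) in j1 j2; rewrite (le_trans _ j1)/=; last first.
  by rewrite mulr_ge0 ?(ltW T0)// divr_ge0.
apply: (le_trans j2); rewrite -[leRHS]mulr1 ler_pM2l// ler_pdivrMr ?ltr0n// mul1r.
by rewrite ler_nat.
Qed.

End MeasurableZeroCount.

(** * The Gaussian space of a stationary process *)

Section EqualLaws.
Context d (Omega : measurableType d) (R : realType) (P : probability Omega R).
Variables Y Z : Omega -> R.
Hypotheses (mY : measurable_fun setT Y) (mZ : measurable_fun setT Z).
Let mY_mixin := isMeasurableFun.Build _ _ _ _ _ mY.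
Let Ym : {mfun Omega >-> R} := HB.pack Y mY_mixin.
Let mZ_mixin := isMeasurableFun.Build _ _ _ _ _ mZ.
Let Zm : {mfun Omega >-> R} := HB.pack Z mZ_mixin.

Lemma second_moment_eq_law : (forall A, measurable A -> P (Y @^-1` A) = P (Z @^-1` A)) ->
  second_moment P Y = second_moment P Z.
Proof.
move=> YZ; rewrite /second_moment /Rintegral; congr fine.
have m2 : measurable_fun setT (fun x : R => (x ^+ 2)%:E).
  by apply/measurable_EFinP; exact: measurable_funX.
transitivity (\int[distribution P Ym]_x (x ^+ 2)%:E)%E.
  by rewrite ge0_integral_distribution// => x; rewrite lee_fin sqr_ge0.
transitivity (\int[distribution P Zm]_x (x ^+ 2)%:E)%E.
  by apply: eq_measure_integral => A mA _; exact: YZ.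
by rewrite ge0_integral_distribution// => x; rewrite lee_fin sqr_ge0.
Qed.

End EqualLaws.

Section GaussianMean.
Context d (Omega : measurableType d) (R : realType) (P : probability Omega R).
Variables Y : Omega -> R.
Hypothesis mY : measurable_fun setT Y.

Lemma gaussian_law_mean (m s : R) :
  (forall A : set R, measurable A -> P (Y @^-1` A) = gaussian_law m s A) ->
  P.-integrable setT (EFin \o Y) /\ \int[P]_w Y w = m.
Proof.
move=> lawY; have [s0|s0] := eqVneq s 0.
  pose Z w := Y w - m.
  have mZ : measurable_fun setT Z by exact: measurable_funB.
  have lawZ (A : set R) : measurable A -> P (Z @^-1` A) = \d_(0 : R) A.
    move=> mA; pose B : set R := (fun x => x - m) @^-1` A.
    have mB : measurable B.
      by rewrite -[B]setTI; apply: (measurable_funB (@measurable_id _ R setT) (measurable_cst m)).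
    rewrite (_ : Z @^-1` A = Y @^-1` B)// lawY// /gaussian_law s0 eqxx !diracE.
    by have -> : (m \in B) = (0 \in A) by rewrite -(subrr m); apply/idP/idP => /set_mem h; apply/mem_set.
  have mD : measurable_fun setT (fun x : R => x + m) by exact: measurable_funD.
  have YE : Y = (fun x => x + m) \o Z by apply/funext => w; rewrite /Z /= subrK.
  split; first by rewrite YE; exact: integrable_degenerate.
  rewrite /Rintegral -[RHS]/(fine m%:E); congr fine.
  have YEw w : Y w = Z w + m by rewrite /Z subrK.
  under eq_integral => w _ do rewrite YEw.
  rewrite (integral_degenerate mZ lawZ (f := fun x => (x + m)%:E)) ?add0r//.
  exact/measurable_EFinP.
have lawN (A : set R) : measurable A -> P (Y @^-1` A) = normal_prob m s A.
  by move=> mA; rewrite lawY// /gaussian_law (negbTE s0).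
have i1 := integrable_normal_id m s0.
have m1 : measurable_fun setT (@idfun R) by exact: measurable_id.
split; first exact: (integrable_law mY lawN m1 i1).
have H := Rintegral_law mY lawN m1 i1.
exact: (etrans H (normal_mean m s0)).
Qed.

Lemma gaussian_law_normN (s : R) A : gaussian_law 0 `|s| A = gaussian_law 0 s A.
Proof.
have [s0|s0] := eqVneq s 0; first by rewrite s0 normr0.
have s0n : `|s| != 0 by rewrite normr_eq0.
rewrite /gaussian_law (negbTE s0) (negbTE s0n).
rewrite /normal_prob; apply: eq_integral => x _; congr EFin.
by rewrite (normal_pdfE 0 s0) (normal_pdfE 0 s0n) /normal_peak /normal_fun real_normK ?num_real.
Qed.

Lemma gaussian_rv_centered : gaussian_rv P Y -> 'E_P[Y]%E = 0%E -> centered_gaussian P Y.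
Proof.
move=> [m [s lawY]] EY; split => //; exists `|s|; split => // A mA.
have [iY mE] := gaussian_law_mean lawY.
have m0 : m = 0 by rewrite -mE /Rintegral; move: EY; rewrite unlock => ->.
by rewrite gaussian_law_normN -[in RHS]m0 lawY.
Qed.

End GaussianMean.

Section ProcessSpace.
Context d (Omega : measurableType d) (R : realType) (P : probability Omega R).
Variable X : R -> {RV P >-> R}.

Definition process_span : set (Omega -> R) :=
  [set Y | exists k (t a : 'I_k -> R), Y = (fun w => \sum_(i < k) a i * X (t i) w)].

Lemma process_spanX t : process_span (X t : Omega -> R).
Proof.
exists 1%N, (fun=> t), (fun=> 1); apply/funext => w.
by rewrite big_ord1 mul1r.
Qed.

Hypotheses (hgauss : gaussian_process X) (hcent : centered X).

Lemma process_centered_gaussian t : centered_gaussian P (X t : Omega -> R).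
Proof.
apply: gaussian_rv_centered; [exact: measurable_funPT| |exact: hcent].
have := hgauss (fun=> t : R) (fun _ : 'I_1 => 1).
by congr gaussian_rv; apply/funext => w; rewrite big_ord1 mul1r.
Qed.

Lemma process_gaussian_space : gaussian_space P process_span.
Proof.
split.
- move=> _ [k [t [a ->]]].
  have iX i : P.-integrable setT (EFin \o (X (t i) : Omega -> R)).
    have := gaussian_integrable_pow 1 (process_centered_gaussian (t i)).
    by congr (P.-integrable _ _).
  apply: gaussian_rv_centered; [|exact: hgauss|].
    by apply: measurable_sum => i; apply: measurable_funM => //; exact: measurable_funPT.
  rewrite unlock; under eq_integral do rewrite -sumEFin.
  rewrite integral_sum//; last first.
    move=> i; have := integrableZl measurableT (a i) (iX i).
    by congr (P.-integrable _ _).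
  rewrite big1// => i _; under eq_integral do rewrite EFinM.
  rewrite integralZl//; last exact: iX.
  by have := hcent (t i); rewrite unlock => ->; rewrite mule0.
- by exists 0%N, (fun=> 0), (fun=> 0); apply/funext => w; rewrite big_ord0.
- move=> c _ _ [k [t [a ->]]] [l [u [b ->]]].
  exists (k + l)%N, (fun i => match fintype.split i with inl j => t j | inr j => u j end),
    (fun i => match fintype.split i with inl j => c * a j | inr j => b j end).
  apply/funext => w; rewrite big_split_ord/= mulr_sumr; congr (_ + _).
    apply: eq_bigr => i _; rewrite (_ : fintype.split (lshift l i) = inl i) ?mulrA//.
    exact: (unsplitK (inl i)).
  apply: eq_bigr => i _; rewrite (_ : fintype.split (rshift k i) = inr i)//.
  exact: (unsplitK (inr i)).
Qed.

Hypothesis hstat : stationary X.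
Let gH := process_gaussian_space.

(** The two combinations are the same function of a pair of values and of
    its translate by [s], so they have the same law. *)
Lemma stationary_second_moment (a t s : R) :
  second_moment P (fun w => a * X t w + X s w) =
  second_moment P (fun w => a * X (t - s) w + X 0 w).
Proof.
have mX u : measurable_fun setT (X u) by exact: measurable_funPT.
apply: second_moment_eq_law.
- by apply: measurable_funD => //; apply: measurable_funM.
- by apply: measurable_funD => //; apply: measurable_funM.
move=> A mA.
pose f (v : 2.-tuple R) := a * tnth v ord0 + tnth v ord_max.
have mf : measurable_fun setT f.
  apply: measurable_funD; last exact: measurable_tnth.
  by apply: measurable_funM => //; exact: measurable_tnth.
have mB : measurable (f @^-1` A) by rewrite -[_ @^-1` _]setTI; exact: mf.
pose u (i : 'I_2) := if i == ord0 then t - s else 0.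
have := hstat u s mB.
rewrite (_ : _ @^-1` _ = (fun w => a * X t w + X s w) @^-1` A); last first.
  by apply/funext => w; rewrite /f /values /= !tnth_mktuple /u /= subrK add0r.
move=> ->; congr (P _).
by apply/funext => w; rewrite /f /values /= !tnth_mktuple /u /=.
Qed.

(** Polarisation of [stationary_second_moment]. *)
Lemma stationary_cov (t s : R) : cov P (X t) (X s) = cov P (X (t - s)) (X 0).
Proof.
have E u v (a : R) : cov P (fun w => a * X u w + X v w) (fun w => a * X u w + X v w) =
    a ^+ 2 * cov P (X u) (X u) + 2 * a * cov P (X u) (X v) + cov P (X v) (X v).
  by apply: (cov_sqrZD gH); exact: process_spanX.
have := stationary_second_moment 1 t s; have := stationary_second_moment (-1) t s.
rewrite !cov_second_moment !E; lra.
Qed.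

Variable mu : probability (measurableTypeR R) R.
Hypothesis hspec : is_spectral_measure X mu.

(** The real part of the spectral identity, at the time lag [t - s]. *)
Lemma spectral_cov (t s : R) : cov P (X t) (X s) = \int[mu]_x cos ((t - s) * x).
Proof.
rewrite stationary_cov; have := hspec (t - s).
rewrite /fourier /Cintegral => /(congr1 (@complex.Re R)) /=.
rewrite unlock => E; rewrite /cov /Rintegral.
transitivity (\int[mu]_x cos (- ((t - s) * x))); first exact: E.
by apply: eq_Rintegral => x _; rewrite cosN.
Qed.

Lemma spectral_cov_eq1 (t : R) : cov P (X t) (X t) = 1.
Proof.
rewrite spectral_cov subrr; under eq_Rintegral do rewrite mul0r cos0.
exact: (Rintegral_prob_cst mu 1).
Qed.

End ProcessSpace.

(** * Energy of trigonometric polynomials *)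

Lemma Rintegral_sum d (T : measurableType d) (R : realType) (mu : {measure set T -> \bar R}) m
    (f : 'I_m -> T -> R) : (forall i, mu.-integrable setT (EFin \o f i)) ->
  \int[mu]_x (\sum_i f i x) = \sum_i \int[mu]_x f i x.
Proof.
move=> fi; rewrite /Rintegral; under eq_integral do rewrite -sumEFin.
rewrite integral_sum// (eq_bigr (fun i => (\int[mu]_x f i x)%:E)) ?sumEFin//.
by move=> i _; rewrite fineK//; apply: integrable_fin_num => //; exact: fi.
Qed.

Section TrigEnergy.
Context (R : realType) (mu : probability (measurableTypeR R) R).

(** The squared modulus of [\sum_i a_i e^(i t_i x)]. *)
Definition trig_sqr m (a t : 'I_m -> R) (x : R) : R :=
  (\sum_i a i * cos (t i * x)) ^+ 2 + (\sum_i a i * sin (t i * x)) ^+ 2.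

Lemma trig_sqrE m (a t : 'I_m -> R) (x : R) :
  trig_sqr a t x = \sum_i \sum_j a i * a j * cos ((t i - t j) * x).
Proof.
rewrite /trig_sqr !expr2 !mulr_suml -big_split/=; apply: eq_bigr => i _.
rewrite !mulr_sumr -big_split/=; apply: eq_bigr => j _.
by rewrite mulrBl cosB; ring.
Qed.

Lemma integrable_cos_scale (t : R) : mu.-integrable setT (EFin \o (fun x : R => cos (t * x))).
Proof.
apply: (@integrable_bounded _ _ _ mu _ 1).
  by have := measurable_cos_affine t 0; under eq_fun do rewrite addr0.
by move=> x; rewrite ler_norml cos_geN1 cos_le1.
Qed.

Lemma integrable_trig_sqr m (a t : 'I_m -> R) : mu.-integrable setT (EFin \o trig_sqr a t).
Proof.
rewrite (_ : EFin \o _ = fun x => \sum_i (\sum_j (a i * a j * cos ((t i - t j) * x))%:E))%E; last first.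
  by apply/funext => x /=; rewrite trig_sqrE -sumEFin; apply: eq_bigr => i _; rewrite sumEFin.
apply: integrable_sum => // i _; apply: integrable_sum => // j _.
have := integrableZl measurableT (a i * a j) (integrable_cos_scale (t i - t j)).
by congr (mu.-integrable _ _).
Qed.

Lemma Rintegral_trig_sqr m (a t : 'I_m -> R) :
  \int[mu]_x trig_sqr a t x = \sum_i \sum_j a i * a j * \int[mu]_x cos ((t i - t j) * x).
Proof.
have i1 i j : mu.-integrable setT (EFin \o (fun x : R => a i * a j * cos ((t i - t j) * x))).
  have := integrableZl measurableT (a i * a j) (integrable_cos_scale (t i - t j)).
  by congr (mu.-integrable _ _).
under eq_Rintegral do rewrite trig_sqrE.
rewrite Rintegral_sum; last first.
  move=> i; rewrite (_ : EFin \o _ = fun x => (\sum_j (a i * a j * cos ((t i - t j) * x))%:E)%E).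
    by apply: integrable_sum => // j _; exact: i1.
  by apply/funext => x /=; rewrite sumEFin.
apply: eq_bigr => i _; rewrite Rintegral_sum//; apply: eq_bigr => j _.
by rewrite -RintegralZl//; exact: integrable_cos_scale.
Qed.

End TrigEnergy.

(** * Variance of finite differences *)

Section FiniteDifferenceVariance.
Context (R : realType).
Implicit Types (h t x : R).

(** The coefficients do not depend on [f], which lets the same identity be
    applied to the paths and to the cosines. *)
Lemma iter_fdiff_lincomb h n : exists c : nat -> R, forall (f : R -> R) t,
  iter n (fdiff h) f t = \sum_(i < n.+1) c i * f (t + i%:R * h).
Proof.
elim: n => [|n [c Hc]].
  by exists (fun=> 1) => f t; rewrite big_ord1 mul1r mul0r addr0.
exists (fun i => (if i is i'.+1 then c i' else 0) - (if (i < n.+1)%N then c i else 0)) => f t.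
rewrite iterS /fdiff !Hc.
under [RHS]eq_bigr do rewrite mulrBl.
rewrite sumrB; congr (_ - _).
  rewrite [RHS]big_ord_recl/= mul0r add0r; apply: eq_bigr => i _.
  by congr (_ * f _); rewrite /bump/= add1n -[in RHS]natr1; ring.
rewrite [RHS]big_ord_recr/= ltnn mul0r addr0; apply: eq_bigr => i _.
by rewrite /= ltn_ord.
Qed.

Lemma sin_mvt (y : R) : exists2 c, `|c| <= `|y| & sin y = cos c * y.
Proof.
have pos (z : R) : 0 <= z -> exists2 c, `|c| <= `|z| & sin z = cos c * z.
  move=> z0; have [c] := @MVT_segment R sin cos _ _ z0 (fun x _ => is_derive_sin x)
    (continuous_subspaceT (@continuous_sin R)).
  rewrite in_itv/= sin0 !subr0 => /andP[c0 cz] ->; exists c => //.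
  by rewrite !ger0_norm.
have [y0|y0] := leP 0 y; first exact: pos.
have [|c c1 c2] := pos (- y); first by rewrite oppr_ge0 ltW.
exists c; first by rewrite normrN in c1.
by apply: oppr_inj; rewrite -sinN c2 mulrN.
Qed.

Lemma norm_sin_le (y : R) : `|sin y| <= `|y|.
Proof.
have [c _ ->] := sin_mvt y; rewrite normrM ler_piMl//.
by rewrite ler_norml cos_geN1 cos_le1.
Qed.

Lemma cos_half (y : R) : cos y = 1 - 2 * sin (y / 2) ^+ 2.
Proof.
rewrite [in LHS](_ : y = y / 2 + y / 2); last by field.
rewrite cosD -!expr2; have := cos2Dsin2 (y / 2); lra.
Qed.

(** [2 - 2 * cos y] is the squared modulus of [e^(i y) - 1]. *)
Lemma two_sub_cos_le (y : R) : 2 - 2 * cos y <= y ^+ 2.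
Proof.
have : (sin (y / 2)) ^+ 2 <= (y / 2) ^+ 2.
  rewrite -real_normK ?num_real// -[leRHS]real_normK ?num_real//.
  by rewrite lerXn2r ?nnegrE//; exact: norm_sin_le.
rewrite cos_half expr_div_n; lra.
Qed.

Lemma two_sub_cos_ge (y : R) : `|y| <= 1 -> y ^+ 2 / 4 <= 2 - 2 * cos y.
Proof.
move=> y1; have [c cy sE] := sin_mvt (y / 2).
have cy1 : c ^+ 2 <= 1 / 4.
  rewrite -real_normK ?num_real//.
  have : `|c| <= 1 / 2 by apply: (le_trans cy); rewrite normrM (@ger0_norm _ 2^-1) ?invr_ge0//; lra.
  by have := normr_ge0 c; nra.
have := two_sub_cos_le c => hc.
have cc : 7 / 8 <= cos c by lra.
have c2 : 1 / 2 <= cos c ^+ 2 by nra.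
rewrite (cos_half y) sE exprMn expr_div_n; have := sqr_ge0 y; nra.
Qed.

(** [e^(i u x)] is an eigenfunction of the difference operator, with
    eigenvalue [e^(i h x) - 1] of squared modulus [2 - 2 * cos (h * x)]. *)
Lemma iter_fdiff_trig h n t x :
  (iter n (fdiff h) (fun u => cos (u * x)) t) ^+ 2 +
  (iter n (fdiff h) (fun u => sin (u * x)) t) ^+ 2 = (2 - 2 * cos (h * x)) ^+ n.
Proof.
pose C k := iter k (fdiff h) (fun u => cos (u * x)).
pose S k := iter k (fdiff h) (fun u => sin (u * x)).
have rot k u : C k (u + h) = C k u * cos (h * x) - S k u * sin (h * x) /\
    S k (u + h) = S k u * cos (h * x) + C k u * sin (h * x).
  elim: k u => [|k IH] u; first by rewrite /C /S /= mulrDl cosD sinD.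
  rewrite /C /S !iterS -/(C k) -/(S k) /fdiff.
  by have [-> ->] := IH (u + h); have [-> ->] := IH u; split; ring.
rewrite -/(C n) -/(S n).
elim: n t => [|n IH] t; first by rewrite /C /S /= cos2Dsin2 expr0.
rewrite [RHS]exprS -(IH t) [C n.+1]iterS [S n.+1]iterS -/(C n) -/(S n) /fdiff.
have [-> ->] := rot n t.
have -> : (2 - 2 * cos (h * x)) = (cos (h * x) - 1) ^+ 2 + sin (h * x) ^+ 2.
  by rewrite sin2cos2; ring.
by ring.
Qed.

End FiniteDifferenceVariance.

Section ProcessDifference.
Context d (Omega : measurableType d) (R : realType) (P : probability Omega R).
Variables (X : R -> {RV P >-> R}) (mu : probability (measurableTypeR R) R).
Hypotheses (hgauss : gaussian_process X) (hcent : centered X) (hstat : stationary X).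
Hypothesis hspec : is_spectral_measure X mu.
Let gH := process_gaussian_space hgauss hcent.

Lemma cov_lincomb_process m (a t : 'I_m -> R) :
  cov P (lincomb a (fun i => X (t i) : Omega -> R)) (lincomb a (fun i => X (t i) : Omega -> R)) =
  \int[mu]_x trig_sqr a t x.
Proof.
rewrite (cov_lincomb gH); last by move=> i; exact: process_spanX.
rewrite Rintegral_trig_sqr; apply: eq_bigr => i _; apply: eq_bigr => j _.
by rewrite (spectral_cov hgauss hcent hstat hspec).
Qed.

Lemma process_span_fdiff h n t : process_span X (fun w => iter n (fdiff h) (X^~ w) t).
Proof.
have [c Hc] := iter_fdiff_lincomb h n.
exists n.+1, (fun i => t + i%:R * h), (fun i => c i).
by apply/funext => w; rewrite Hc.
Qed.

Hypothesis hmom : finite_moments mu.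

(** The spectral energy of the iterated difference is
    [(2 - 2 * cos (h * x)) ^+ n <= (h * x) ^+ (2 * n)]. *)
Lemma fdiff_second_moment_le h n t :
  second_moment P (fun w => iter n (fdiff h) (X^~ w) t) <= h ^+ (2 * n) * moment mu (2 * n).
Proof.
have [c Hc] := iter_fdiff_lincomb h n.
pose u (i : 'I_n.+1) := t + i%:R * h.
pose a (i : 'I_n.+1) := c i.
rewrite cov_second_moment.
rewrite (_ : (fun w => _) = lincomb a (fun i => X (u i) : Omega -> R)); last first.
  by apply/funext => w; rewrite Hc.
rewrite cov_lincomb_process /moment.
have E x : trig_sqr a u x = (2 - 2 * cos (h * x)) ^+ n.
  rewrite -(iter_fdiff_trig h n t) /trig_sqr.
  by rewrite (Hc (fun v => cos (v * x))) (Hc (fun v => sin (v * x))).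
have im : mu.-integrable setT (EFin \o (fun x : R => `|x| ^+ (2 * n))).
  apply/integrableP; split.
    apply/measurable_EFinP; apply: measurable_funX; exact: normr_measurable.
  under eq_integral => x _ do rewrite /= normrX normr_id.
  exact: hmom.
rewrite -(RintegralZl _ measurableT im); apply: le_Rintegral => //.
- exact: integrable_trig_sqr.
- by have := integrableZl measurableT (h ^+ (2 * n)) im; congr (mu.-integrable _ _).
move=> x _; rewrite E !exprM -exprMn real_normK ?num_real// -exprMn.
by rewrite lerXn2r ?nnegrE ?sqr_ge0 ?two_sub_cos_le// subr_ge0 ler_piMr// cos_le1.
Qed.

End ProcessDifference.

(** * Coefficients of a polynomial from its values *)

Section Interpolation.

Lemma bin_le_expn2 n k : ('C(n, k) <= 2 ^ n)%N.
Proof.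
elim: n k => [|n IH] [|k] //; first by rewrite bin0 expn_gt0.
by rewrite binS expnS mul2n -addnn leq_add.
Qed.

(** In natural numbers [(k - l) + (l - k)] is the distance of [k] and [l]. *)
Lemma prod_dist_fact m k : (k <= m)%N ->
  (\prod_(l < m.+1 | l != k :> nat) ((k - l) + (l - k)) = k`! * (m - k)`!)%N.
Proof.
move=> km; rewrite -(big_mkord (fun l => l != k) (fun l => (k - l) + (l - k))%N).
rewrite (@big_cat_nat _ _ _ k)//=; last exact: leqW.
rewrite (big_ltn_cond _ (n := m.+1)) ?ltnS// eqxx/=; congr (_ * _)%N.
  rewrite big_nat_cond (eq_bigl (fun l => (0 <= l < k) && true)%N); last first.
    by move=> l; rewrite andbT andb_idr// => /andP[_ lk]; rewrite neq_ltn lk.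
  rewrite -big_nat_cond; elim: k {km} => [|k IH]; first by rewrite big_nil.
  rewrite big_nat_recl// subn0 sub0n addn0 factS; congr (_ * _)%N.
  by rewrite -IH; apply: eq_bigr => l _; rewrite !subSS.
rewrite big_nat_cond (eq_bigl (fun l => (k.+1 <= l < m.+1) && true)%N); last first.
  by move=> l; rewrite andbT andb_idr// => /andP[kl _]; rewrite neq_ltn kl orbT.
rewrite -big_nat_cond fact_prod -(add1n k) -[in m.+1](subnK km) -addSn big_addn.
rewrite subSn ?leq_addl// addnK; apply: eq_bigr => l _.
by rewrite addnK; apply/eqP; rewrite -[X in _ == X]add0n eqn_add2r subn_eq0 leq_addl.
Qed.

Lemma fact_le_prod_dist m k : (k <= m)%N ->
  (m`! <= 2 ^ m * \prod_(l < m.+1 | l != k :> nat) ((k - l) + (l - k)))%N.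
Proof.
move=> km; rewrite prod_dist_fact// -(bin_fact km) leq_mul2r.
by rewrite bin_le_expn2 orbT.
Qed.

Lemma lagrange_interpolation (K : fieldType) (p : {poly K}) m (z : 'I_m.+1 -> K) :
  injective z -> (size p <= m.+1)%N ->
  p = \sum_k (p.[z k] / \prod_(l | l != k) (z k - z l)) *: \prod_(l | l != k) ('X - (z l)%:P).
Proof.
move=> zi sp; apply/eqP; rewrite -subr_eq0; set q := \sum_k _.
apply/eqP/(@roots_geq_poly_eq0 _ _ [seq z k | k <- enum 'I_m.+1]).
- apply/allP => _ /mapP[k _ ->]; rewrite /root hornerD hornerN horner_sum subr_eq0.
  rewrite (bigD1 k)//= [X in _ + X]big1 ?addr0.
    rewrite hornerZ horner_prod.
    under [X in _ * X]eq_bigr do rewrite hornerXsubC.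
    rewrite divfK//; apply/prodf_neq0 => l lk.
    by rewrite subr_eq0 (inj_eq zi) eq_sym.
  move=> l lk; rewrite hornerZ horner_prod [X in _ * X](bigD1 k) 1?eq_sym//=.
  by rewrite hornerXsubC subrr mul0r mulr0.
- by rewrite map_inj_uniq ?enum_uniq.
rewrite size_map size_enum_ord; apply: (leq_trans (size_polyD _ _)).
rewrite geq_max sp size_polyN; apply: (leq_trans (size_sum _ _ _)).
apply/bigmax_leqP => k _; apply: (leq_trans (size_scale_leq _ _)).
rewrite size_prod => [|l _]; last by rewrite polyXsubC_eq0.
under eq_bigr do rewrite size_XsubC.
by rewrite sum_nat_const cardC1 card_ord /= muln2 -addnn -addnS addKn.
Qed.

Lemma norm_coef_prod_le (F : numFieldType) (I : Type) (s : seq I) (P : pred I) (z : I -> F) j :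
  (forall i, `|z i| <= 1) ->
  `|(\prod_(i <- s | P i) ('X - (z i)%:P))`_j| <= 2 ^+ size s.
Proof.
move=> z1; elim: s j => [|i s IH] j.
  by rewrite big_nil coef1 normr_nat expr0 lern1 leq_b1.
rewrite big_cons /= exprS; case: ifP => _; last first.
  by rewrite (le_trans (IH j))// ler_peMl ?exprn_ge0// ler1n.
rewrite mulrBl coefB coefXM coefCM mulrDl mul1r (le_trans (ler_normB _ _))// lerD//.
  by case: j => [|j]; [rewrite normr0 exprn_ge0|exact: IH].
by rewrite normrM -[leRHS]mul1r ler_pM.
Qed.

(** The coefficients of each Lagrange basis polynomial are at most [2 ^+ m]
    in the numerator, while linear separation makes the denominator at least
    [delta ^+ m * m`! / 2 ^+ m]. *)
Lemma norm_coef_le_of_values (F : numFieldType) (p : {poly F}) m (z : 'I_m.+1 -> F) (delta e : F) j :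
  (size p <= m.+1)%N -> 0 < delta -> (forall k, `|z k| <= 1) ->
  (forall k l : 'I_m.+1, delta * ((k - l) + (l - k))%:R <= `|z k - z l|) ->
  (forall k, `|p.[z k]| <= e) ->
  `|p`_j| <= m.+1%:R * (e * (2 * (4 / delta) ^+ m / m`!%:R)).
Proof.
move=> sp d0 z1 zd pe.
have mf0 : 0 < m`!%:R :> F by rewrite ltr0n fact_gt0.
have zi : injective z.
  move=> k l kl; have := zd k l; rewrite kl subrr normr0 => h.
  have : ((k - l) + (l - k))%:R <= 0 :> F by rewrite -(pmulr_rle0 _ d0).
  rewrite lern0 addn_eq0 !subn_eq0 => /andP[kl' lk].
  by apply/val_inj/eqP; rewrite /= eqn_leq kl' lk.
have e0 : 0 <= e by exact: le_trans (pe ord0).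
rewrite {1}(lagrange_interpolation zi sp) coef_sum (le_trans (ler_norm_sum _ _ _))//.
rewrite mulr_natl -[m.+1 in leRHS]card_ord -sumr_const; apply: ler_sum => k _.
rewrite coefZ -(mulrA p.[z k]) normrM; apply: ler_pM => //; rewrite normrM normfV.
have dist : delta ^+ m * m`!%:R / 2 ^+ m <= `|\prod_(l | l != k) (z k - z l)|.
  rewrite normr_prod; apply: (@le_trans _ _ (\prod_(l < m.+1 | l != k) (delta * ((k - l) + (l - k))%:R))); last first.
    apply: ler_prod => l _; by rewrite zd andbT mulr_ge0// ltW.
  rewrite big_split/= prodr_const cardC1 card_ord/= -mulrA ler_pM2l ?exprn_gt0//.
  rewrite ler_pdivrMr ?exprn_gt0// mulrC -natrX -natr_prod -natrM ler_nat.
  exact: (@fact_le_prod_dist m k (ltn_ord k : (k <= m)%N)).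
have A0 : 0 < delta ^+ m * m`!%:R / 2 ^+ m by rewrite divr_gt0 ?mulr_gt0 ?exprn_gt0.
apply: (@le_trans _ _ ((delta ^+ m * m`!%:R / 2 ^+ m)^-1 * 2 ^+ m.+1)).
  rewrite ler_pM// ?invr_ge0// ?lef_pV2 ?posrE//.
    exact: lt_le_trans dist.
  have := norm_coef_prod_le (index_enum 'I_m.+1) (fun l => l != k) j z1.
  by rewrite [X in 2 ^+ X](_ : _ = m.+1)// /index_enum -enumT size_enum_ord.
rewrite le_eqVlt; apply/orP; left; apply/eqP.
rewrite expr_div_n (_ : 4 = 2 * 2 :> F) ?exprMn ?exprS; last by rewrite -natrM.
by field; rewrite (gt_eqF mf0) !expf_neq0// gt_eqF.
Qed.

End Interpolation.

(** * Lower bound on the energy of trigonometric polynomials *)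

Section BoundedDensity.
Context (R : realType) (mu : probability (measurableTypeR R) R).

(** The restriction of the absolutely continuous part to the set where its
    density is at most [k.+1] and where [`|x|] is at most [k.+1]. These sets
    exhaust the line, so for some [k] the restriction is not zero. *)
Lemma ac_part_bounded_density : nontrivial_ac_part mu ->
  exists (nu : {measure set (measurableTypeR R) -> \bar R}) (A K : R),
  [/\ 1 <= A, 1 <= K, forall B, measurable B -> (nu B <= mu B)%E,
      forall a b, a <= b -> (nu `]a, b]%classic <= (K * (b - a))%:E)%E &
      (0 < nu `](- A)%R, A]%classic)%E].
Proof.
move=> [mu_ac [mu_s [muE muac _ ac0]]].
have acle B : measurable B -> (mu_ac B <= mu B)%E.
  by move=> mB; rewrite muE// leeDl.
have actoo : (mu_ac setT < +oo)%E.
  by apply: (le_lt_trans (acle _ measurableT)); rewrite probability_setT ltry.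
pose acf : {finite_measure set (measurableTypeR R) -> \bar R} := mfrestr measurableT actoo.
have acfE B : acf B = mu_ac B by rewrite /acf /= /mfrestr /mrestr setIT.
have acl : acf `<< (@lebesgue_measure R).
  move=> B /muac nB C mC CB; rewrite acfE; exact: nB.
pose f := Radon_Nikodym_SigmaFinite.f acf (@lebesgue_measure R).
have mf : measurable_fun setT f.
  exact: measurable_int (Radon_Nikodym_SigmaFinite.f_integrable acl).
have f0 x : (0 <= f x)%E by exact: Radon_Nikodym_SigmaFinite.f_ge0.
pose E (k : nat) : set (measurableTypeR R) :=
  [set x | (f x <= k.+1%:R%:E)%E] `&` `](- k.+1%:R)%R, k.+1%:R]%classic.
have mE1 (k : nat) : measurable [set x | (f x <= k.+1%:R%:E)%E].
  by rewrite -[X in measurable X]setTI; exact: emeasurable_fun_infty_c.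
have mE k : measurable (E k).
  by apply: measurableI => //; exact: measurable_itv.
(* A countable union of null sets would be null. *)
have [k ek] : exists k, mu_ac (E k) != 0%E.
  apply: contrapT => /forallNP H.
  have nE k : mu_ac (E k) = 0%E by have /negP := H k; rewrite negbK => /eqP.
  have : mu_ac.-negligible (\bigcup_k E k).
    by apply: negligible_bigcup => k; exists (E k); split.
  have -> : \bigcup_k E k = setT.
    apply/seteqP; split => // x _.
    pose k := maxn (Num.trunc (fine (f x))) (Num.trunc `|x|).
    have k1 : fine (f x) < k.+1%:R.
      by apply: (lt_le_trans (truncnS_gt _)); rewrite ler_nat ltnS leq_maxl.
    have k2 : `|x| < k.+1%:R.
      by apply: (lt_le_trans (truncnS_gt _)); rewrite ler_nat ltnS leq_maxr.
    exists k => //; split => /=.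
      have ffin : f x \is a fin_num by exact: Radon_Nikodym_SigmaFinite.f_fin_num.
      by rewrite -(fineK ffin) lee_fin; exact: ltW.
    by rewrite in_itv/=; move: k2; rewrite ltr_norml => /andP[-> /ltW ->].
  by move=> /(measure_negligible measurableT)/eqP; rewrite (negbTE ac0).
pose nu : {measure set (measurableTypeR R) -> \bar R} := mrestr mu_ac (mE k).
have restrE (B : set (measurableTypeR R)) : nu B = mu_ac (B `&` E k) by [].
exists nu, k.+1%:R, k.+1%:R; split.
- by rewrite ler1n.
- by rewrite ler1n.
- move=> B mB; apply: (le_trans _ (acle _ mB)); rewrite restrE.
  have mBE : measurable (B `&` E k) by exact: measurableI.
  by apply: (le_measure mu_ac); [exact: mem_set|exact: mem_set|exact: subIsetl].
- move=> a b ab; rewrite restrE.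
  pose S : set (measurableTypeR R) := `]a, b]%classic.
  have mS : measurable S by exact: measurable_itv.
  have mSE : measurable (S `&` E k) by exact: measurableI.
  rewrite -acfE [leLHS](Radon_Nikodym_SigmaFinite.f_integral acl mSE).
  apply: (@le_trans _ _ (\int[@lebesgue_measure R]_(x in S `&` E k) k.+1%:R%:E)%E).
    apply: ge0_le_integral => //.
    - exact: measurable_funS mf.
    - by move=> x [_ []].
  rewrite integral_cst//.
  rewrite [leRHS]EFinM lee_pmul2l//.
  apply: (@le_trans _ _ (@lebesgue_measure R S)).
    by apply: le_measure; [exact: mem_set|exact: mem_set|exact: subIsetl].
  rewrite lebesgue_measure_itv/= lte_fin; case: ifP => // _.
  by rewrite lee_fin subr_ge0.
rewrite restrE (_ : _ `&` _ = E k) ?lt0e ?ek//=.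
by apply/seteqP; split => [x []//|x Ex]; split => //; case: Ex.
Qed.

End BoundedDensity.

Section Quantiles.
Context (R : realType) (nu : {measure set (measurableTypeR R) -> \bar R}) (A K : R).
Hypotheses (A0 : 0 < A) (K0 : 0 < K).
Hypothesis nuK : forall a b, a <= b -> (nu `]a, b]%classic <= (K * (b - a))%:E)%E.

Let mass (a b : R) : R := fine (nu `]a, b]%classic).

Let mass_fin a b : a <= b -> nu `]a, b]%classic = (mass a b)%:E.
Proof.
move=> ab; rewrite fineK// ge0_fin_numE//.
by apply: (le_lt_trans (nuK ab)); rewrite ltry.
Qed.

Let mass_ge0 a b : 0 <= mass a b.
Proof. by rewrite fine_ge0. Qed.

Let mass_le a b : a <= b -> mass a b <= K * (b - a).
Proof. by move=> ab; rewrite -lee_fin -mass_fin// nuK. Qed.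

Let massD a b c : a <= b -> b <= c -> mass a c = mass a b + mass b c.
Proof.
move=> ab bc; apply: EFin_inj; rewrite EFinD -!mass_fin//; last exact: le_trans bc.
rewrite -measureU//; first last.
- apply/seteqP; split => // x [] /=; rewrite !in_itv/= => /andP[_ xb] /andP[bx _].
  by have := lt_le_trans bx xb; rewrite ltxx.
congr (nu _); apply/seteqP; split => x /=; rewrite !in_itv/=.
  move=> /andP[ax xc]; have [xb|bx] := leP x b; first by left; rewrite ax.
  by right.
by case => /andP[h1 h2]; apply/andP; split => //;
    [exact: le_trans bc|exact: le_lt_trans h1].
Qed.

(** The distribution function is [K]-Lipschitz, hence takes all values
    [i * eta / (2 * M)]. Using only every other gap between these quantiles
    as a cell leaves a gap of mass [eta / (2 * M)] between consecutive cells,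
    which forces their distance. *)
Lemma quantile_cells M : (0 < nu `](- A)%R, A]%classic)%E -> (0 < M)%N ->
  exists u v : nat -> R, let eta := fine (nu `](- A)%R, A]%classic) in
  [/\ forall k, (k < M)%N -> - A <= u k /\ v k <= A,
      forall k, (k < M)%N -> u k <= v k /\ nu `]u k, v k]%classic = (eta / (2 * M%:R))%:E &
      forall k l, (k < l < M)%N -> (l - k)%:R * (eta / (2 * M%:R * K)) <= u l - v k].
Proof.
move=> nu0 M0; set eta := fine _.
have M0r : 0 < M%:R :> R by rewrite ltr0n.
pose G x := mass (- A) (Num.max (- A) x).
have Gdist x y : x <= y -> G x <= G y <= G x + K * (y - x).
  move=> xy; have h : Num.max (- A) x <= Num.max (- A) y.
    by rewrite ge_max !le_max lexx xy orbT.
  rewrite /G (@massD _ (Num.max (- A) x) (Num.max (- A) y)) ?le_max ?lexx//; last by rewrite -!le_max.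
  rewrite lerDl mass_ge0/= lerD2l; apply: (le_trans (mass_le h)).
  rewrite ler_pM2l//.
  by rewrite /Num.max; case: ltP => ?; case: ltP => ?; lra.
have cG : continuous G.
  move=> x; apply/cvgrPdist_le => e e0.
  apply/nbhs_ballP; exists (e / K); first by rewrite /= divr_gt0.
  move=> y; rewrite /ball/= => /ltW xy.
  have : K * `|x - y| <= e by rewrite mulrC -ler_pdivlMr.
  have [xley|ylex] := leP x y.
    have /andP[g1 g2] := Gdist _ _ xley; apply: le_trans.
    rewrite distrC ger0_norm ?subr_ge0// distrC ger0_norm ?subr_ge0//; lra.
  have /andP[g1 g2] := Gdist _ _ (ltW ylex); apply: le_trans.
  by rewrite ger0_norm ?subr_ge0// ger0_norm ?subr_ge0 ?(ltW ylex)//; lra.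
have GA : G (- A) = 0.
  by apply/eqP; rewrite eq_le mass_ge0 andbT /G maxxx (le_trans (mass_le _))// subrr mulr0.
have AA : - A <= A by apply: (@le_trans _ _ 0); rewrite ?oppr_le0 ltW.
have GA' : G A = eta by rewrite /G (max_idPr AA).
have eta0 : 0 < eta by rewrite -lte_fin -mass_fin.
have ex (i : nat) : exists y, (i <= 2 * M)%N -> [/\ - A <= y, y <= A & G y = i%:R * (eta / (2 * M%:R))].
  have [iM|] := leqP i (2 * M); last by move=> h; exists 0.
  have [] := @IVT _ G (- A) A (i%:R * (eta / (2 * M%:R))) AA.
  - exact: continuous_subspaceT.
  - rewrite GA GA' (min_idPl (ltW eta0)) (max_idPr (ltW eta0)) mulr_ge0 ?divr_ge0 ?mulr_ge0 ?(ltW eta0)//=.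
    rewrite mulrA ler_pdivrMr ?mulr_gt0// mulrC ler_pM2l// -(natrM _ 2) ler_nat//.
  by move=> y; rewrite in_itv/= => /andP[y1 y2] yE; exists y.
have /choice[y Hy] := ex.
set s := eta / (2 * M%:R) in Hy *; have s0 : 0 < s by rewrite divr_gt0 ?mulr_gt0.
have ylt (i j : nat) : (i < j)%N -> (j <= 2 * M)%N -> y i < y j.
  move=> ij jM; have [_ _ E1] := Hy _ (leq_trans (ltnW ij) jM); have [_ _ E2] := Hy _ jM.
  rewrite ltNge; apply/negP => /Gdist /andP[]; rewrite E1 E2 ler_pM2r// ler_nat.
  by rewrite leqNgt ij.
have ymass (i j : nat) : (i < j)%N -> (j <= 2 * M)%N -> mass (y i) (y j) = (j - i)%:R * s.
  move=> ij jM; have [a1 _ E1] := Hy _ (leq_trans (ltnW ij) jM); have [a2 _ E2] := Hy _ jM.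
  rewrite natrB ?(ltnW ij)// mulrBl -E1 -E2 /G (max_idPr a1) (max_idPr a2).
  apply/eqP; rewrite eq_sym subr_eq addrC; apply/eqP; exact: (massD a1 (ltW (ylt _ _ ij jM))).
(* The cells are the gaps of even index. *)
exists (fun k => y (2 * k)%N), (fun k => y (2 * k).+1); split.
- move=> k kM; have k2 : ((2 * k).+1 <= 2 * M)%N by lia.
  by have [_ -> _] := Hy _ k2; have [-> _ _] := Hy _ (ltnW k2).
- move=> k kM; have k2 : ((2 * k).+1 <= 2 * M)%N by lia.
  have h := ltW (ylt _ _ (ltnSn (2 * k)) k2).
  by rewrite mass_fin// ymass// subSnn mul1r.
move=> k l /andP[kl lM].
have h1 : ((2 * k).+1 < 2 * l)%N by lia.
have h2 : (2 * l <= 2 * M)%N by lia.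
have := mass_le (ltW (ylt _ _ h1 h2)); rewrite ymass// => h.
rewrite (_ : eta / (2 * M%:R * K) = s / K); last by rewrite /s invfM mulrA.
rewrite mulrA ler_pdivrMr// [leRHS]mulrC.
by apply: le_trans h; rewrite ler_pM2r// ler_nat; lia.
Qed.

End Quantiles.

Section EnergyBound.
Context (R : realType) (mu : probability (measurableTypeR R) R).

Lemma exists_small_on_cell (nu : {measure set (measurableTypeR R) -> \bar R})
    (q : R -> R) (a b eta c : R) : (forall B, measurable B -> (nu B <= mu B)%E) ->
  (forall x, 0 <= q x) -> mu.-integrable setT (EFin \o q) ->
  nu `]a, b]%classic = eta%:E -> \int[mu]_x q x < c * eta -> 0 <= c ->
  exists2 x, a < x <= b & q x <= c.
Proof.
move=> numu q0 iq nuE qc c0; apply: contrapT => H.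
have qgt x : a < x <= b -> c <= q x.
  move=> xab; apply: contrapT => /negP; rewrite -ltNge => h; apply: H.
  by exists x => //; exact: ltW.
pose S : set (measurableTypeR R) := `]a, b]%classic.
have mS : measurable S by exact: measurable_itv.
have mq : measurable_fun setT q by apply/measurable_EFinP; exact: measurable_int iq.
suff : ((c * eta)%:E <= (\int[mu]_x q x)%:E)%E by rewrite lee_fin leNgt qc.
rewrite /Rintegral fineK; last exact: integrable_fin_num.
apply: (@le_trans _ _ (\int[mu]_(x in S) (q x)%:E)%E); last first.
  apply: ge0_subset_integral => //; first exact/measurable_EFinP.
  by move=> x _; rewrite lee_fin.
apply: (@le_trans _ _ (\int[mu]_(x in S) c%:E)%E); last first.
  apply: ge0_le_integral => //.
  by apply/measurable_EFinP; exact: measurable_funS mq.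
rewrite integral_cst// EFinM -nuE; apply: lee_wpmul2l; first by rewrite lee_fin.
exact: numu.
Qed.

(** Its value at [e^(i h x)] is the trigonometric polynomial with
    frequencies [0, h, .., m * h]. *)
Definition trig_poly m (a : 'I_m.+1 -> R) : {poly R[i]} := \poly_(j < m.+1) ((a (inord j))%:C)%C.

Lemma expiX (x : R) j : expi x ^+ j = expi (j%:R * x).
Proof.
elim: j => [|j IH]; first by rewrite expr0 mul0r /expi cos0 sin0.
rewrite exprS IH -natr1 mulrDl mul1r addrC /expi cosD sinD; apply/eqP.
by rewrite eq_complex /=; apply/andP; split; apply/eqP; ring.
Qed.

Lemma normr_expi (x : R) : `|expi x| = 1.
Proof. by rewrite normc_def /= cos2Dsin2 sqrtr1. Qed.

Lemma norm_expiB (x y : R) : `|expi x - expi y| = ((Num.sqrt (2 - 2 * cos (x - y)))%:C)%C.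
Proof.
rewrite normc_def; congr ((Num.sqrt _)%:C)%C; rewrite /expi /= cosB.
have := cos2Dsin2 x; have := cos2Dsin2 y; set a := cos x; set b := sin x.
by set c := cos y; set e := sin y => h1 h2; nra.
Qed.

Lemma horner_trig_poly m (a : 'I_m.+1 -> R) (h x : R) :
  (trig_poly a).[expi (h * x)] =
  ((\sum_j a j * cos (j%:R * h * x)) +i* (\sum_j a j * sin (j%:R * h * x)))%C.
Proof.
rewrite horner_poly; transitivity (\sum_(j < m.+1) ((a j * cos (j%:R * h * x)) +i* (a j * sin (j%:R * h * x)))%C).
  apply: eq_bigr => j _; rewrite inord_val expiX mulrA /expi; apply/eqP.
  by rewrite eq_complex /=; apply/andP; split; apply/eqP; ring.
apply/eqP; rewrite eq_complex /=; apply/andP; split; apply/eqP.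
  by rewrite (raddf_sum (@complex.Re R : Rcomplex R -> R)).
by rewrite (raddf_sum (@complex.Im R : Rcomplex R -> R)).
Qed.

Lemma norm_horner_trig_poly m (a : 'I_m.+1 -> R) (h x : R) :
  `|(trig_poly a).[expi (h * x)]| = ((Num.sqrt (trig_sqr a (fun j => j%:R * h) x))%:C)%C.
Proof. by rewrite horner_trig_poly normc_def. Qed.

(** A chord of the unit circle is at least half of a short arc. *)
Lemma norm_expiB_ge (x y : R) : `|x - y| <= 1 -> (((`|x - y| / 2)%:C)%C <= `|expi x - expi y|).
Proof.
move=> xy; rewrite norm_expiB lecR -[leLHS]ger0_norm ?divr_ge0// -sqrtr_sqr.
apply: ler_wsqrtr; apply: le_trans (two_sub_cos_ge xy).
by rewrite expr_div_n real_normK ?num_real// -natrX.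
Qed.

Lemma succ_le_expn2 m : (m.+1 <= 2 ^ m)%N.
Proof. by elim: m => // m IH; rewrite expnS mul2n -addnn -addn1 leq_add// expn_gt0. Qed.

(** A cruder but simpler base than the exponential one. *)
Lemma expR_nat_le4 n : expR n%:R <= 4 ^+ n :> R.
Proof.
rewrite -[X in expR X]mulr1 expRM_natl lerXn2r ?nnegrE ?expR_ge0//.
by apply: (le_trans (@expR1_le R)); lra.
Qed.

(** The points [e^(i h x_k)] of the circle are separated linearly, and
    [(m + 1) ^ m / m!] grows only exponentially, so [norm_coef_le_of_values]
    bounds each coefficient by a power of [1 / h]. *)
Lemma sum_sqr_le_of_samples m (a : 'I_m.+1 -> R) (h s A c : R) (x : 'I_m.+1 -> R) :
  0 < h -> 0 < s -> 2 * A * h <= 1 -> (forall k, - A <= x k <= A) ->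
  (forall k l : 'I_m.+1, (k < l)%N -> (l - k)%:R * (s / m.+1%:R) <= x l - x k) ->
  (forall k, trig_sqr a (fun j => j%:R * h) (x k) <= c) ->
  \sum_j a j ^+ 2 <= 64 * m.+1%:R ^+ 3 * c * (32 / (s * h)) ^+ (2 * m).
Proof.
move=> h0 s0 Ah xA xs qc.
have M0 : 0 < m.+1%:R :> R by rewrite ltr0n.
pose z k := expi (h * x k).
pose delta := h * s / (2 * m.+1%:R).
have d0 : 0 < delta by rewrite divr_gt0 ?mulr_gt0.
have dist (k l : 'I_m.+1) : ((k - l) + (l - k))%:R * (s / m.+1%:R) <= `|x k - x l|.
  have [kl|lk|kl] := ltngtP k l.
  - rewrite (eqP (ltnW kl : k - l == 0)%N) add0n; apply: (le_trans (xs _ _ kl)).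
    by rewrite distrC ler_norm.
  - rewrite (eqP (ltnW lk : l - k == 0)%N) addn0; apply: (le_trans (xs _ _ lk)).
    by rewrite ler_norm.
  by rewrite kl subnn mul0r.
have zd (k l : 'I_m.+1) : (delta%:C)%C * ((k - l) + (l - k))%:R <= `|z k - z l|.
  have hE : h * x k - h * x l = h * (x k - x l) by rewrite mulrBr.
  have hn : `|h * x k - h * x l| = h * `|x k - x l| by rewrite hE normrM gtr0_norm.
  have h1 : `|h * x k - h * x l| <= 1.
    rewrite hn; apply: le_trans Ah; rewrite mulrC ler_pM2r//.
    by have /andP[a1 a2] := xA k; have /andP[b1 b2] := xA l; rewrite ler_norml; apply/andP; split; lra.
  apply: le_trans (norm_expiB_ge h1); rewrite hn -(rmorph_nat (@real_complex R)) -rmorphM lecR.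
  rewrite ler_pdivlMr// (_ : delta * _ * 2 = h * (((k - l) + (l - k))%:R * (s / m.+1%:R))).
    by rewrite ler_pM2l// dist.
  by rewrite /delta; field; rewrite gt_eqF.
have pe k : `|(trig_poly a).[z k]| <= ((Num.sqrt c)%:C)%C.
  by rewrite norm_horner_trig_poly lecR ler_wsqrtr.
have z1 k : `|z k| <= 1 by rewrite normr_expi.
have d0C : 0 < (delta%:C)%C by rewrite ltcR.
have c0 : 0 <= c by apply: le_trans (qc ord0); rewrite addr_ge0 ?sqr_ge0.
have aj (j : 'I_m.+1) : `|a j| <= m.+1%:R * (Num.sqrt c * (2 * (4 / delta) ^+ m / m`!%:R)).
  have := norm_coef_le_of_values j (size_poly _ _) d0C z1 zd pe.
  rewrite coef_poly ltn_ord inord_val normc_def /= expr0n addr0 sqrtr_sqr.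
  rewrite -lecR !(rmorphM, rmorph_nat, rmorphXn, fmorphV)//.
pose Q := 32 / (s * h).
have Q0 : 0 < Q by rewrite divr_gt0 ?mulr_gt0.
(* [(m + 1) ^ m / m! <= 4 ^ (m + 1)] turns the factorial into an exponential. *)
have Eb : (4 / delta) ^+ m / m`!%:R <= 4 * Q ^+ m.
  have F0 : 0 < m`!%:R :> R by rewrite ltr0n fact_gt0.
  have -> : 4 / delta = m.+1%:R * (8 / (s * h)).
    by rewrite /delta; field; rewrite !gt_eqF.
  rewrite exprMn ler_pdivrMr//.
  have := pow_le_expR m (ltW M0) => hp.
  have hp' := le_trans hp (ler_wpM2l (ltW F0) (expR_nat_le4 m.+1)).
  have q0 : 0 <= (8 / (s * h)) ^+ m by rewrite exprn_ge0// divr_ge0// mulr_ge0 ?ltW.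
  apply: (le_trans (ler_wpM2r q0 hp')).
  have -> : Q = 4 * (8 / (s * h)) by rewrite /Q; field; rewrite !gt_eqF.
  by rewrite [(4 * _) ^+ m]exprMn [4 ^+ m.+1]exprS le_eqVlt; apply/orP; left; apply/eqP; ring.
have aj2 (j : 'I_m.+1) : a j ^+ 2 <= 64 * m.+1%:R ^+ 2 * c * Q ^+ (2 * m).
  have hb : `|a j| <= 8 * m.+1%:R * Num.sqrt c * Q ^+ m.
    apply: (le_trans (aj j)); rewrite -(mulrA 2).
    rewrite (_ : 8 * m.+1%:R * Num.sqrt c * Q ^+ m = m.+1%:R * (Num.sqrt c * (2 * (4 * Q ^+ m)))); last by ring.
    by rewrite ler_pM2l// ler_wpM2l ?sqrtr_ge0// ler_pM2l.
  rewrite -real_normK ?num_real//; apply: (@le_trans _ _ ((8 * m.+1%:R * Num.sqrt c * Q ^+ m) ^+ 2)).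
    by rewrite lerXn2r ?nnegrE// (le_trans _ hb).
  rewrite 3!exprMn sqr_sqrtr// -exprM (mulnC m 2) le_eqVlt; apply/orP; left; apply/eqP; ring.
apply: (le_trans (ler_sum _ (fun j _ => aj2 j))).
rewrite sumr_const card_ord -mulr_natr /Q le_eqVlt; apply/orP; left; apply/eqP; ring.
Qed.

(** If the energy were smaller, the integrand could not exceed a certain level [c]
    on a whole cell, hence would be at most [c] at some point of every cell, and
    [sum_sqr_le_of_samples] would bound [\sum_j a j ^+ 2] by half of itself. With
    [Q = 32 / (s * h)], the power [(4 * Q) ^+ (2 * m)] absorbs the polynomial
    factor [m.+1 ^+ 4]. *)
Lemma trig_energy_ge : nontrivial_ac_part mu ->
  exists h0 k0 k : R, [/\ 0 < h0 <= 1, 0 < k0 <= 1, 0 < k <= 1 &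
    forall (h : R) m (a : 'I_m.+1 -> R), 0 < h <= h0 ->
    k0 * (k * h) ^+ (2 * m) * (\sum_j a j ^+ 2) <=
    \int[mu]_x trig_sqr a (fun j => j%:R * h) x].
Proof.
move=> /ac_part_bounded_density[nu [A [K [A1 K1 numu nuK nu0]]]].
have A0 : 0 < A by lra.
have K0 : 0 < K by lra.
pose eta := fine (nu `](- A)%R, A]%classic).
have nule1 : (nu `](- A)%R, A]%classic <= 1)%E.
  have mI : measurable (`](- A)%R, A]%classic : set (measurableTypeR R)) by exact: measurable_itv.
  by apply: (le_trans (numu _ mI)); exact: probability_le1.
have etaE : nu `](- A)%R, A]%classic = eta%:E.
  by rewrite /eta fineK// ge0_fin_numE// (le_lt_trans nule1)// ltry.
have eta0 : 0 < eta by rewrite -lte_fin -etaE.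
have eta1 : eta <= 1 by rewrite -lee_fin -etaE.
have etaF : fine (nu `](- A)%R, A]%classic) = eta by [].
clearbody eta.
exists (2 * A)^-1, (eta / (16 * 16)), (eta / (16 * 16 * K)); split.
- by rewrite invr_gt0 mulr_gt0//= invf_le1 ?mulr_gt0//; lra.
- apply/andP; split; first by apply: divr_gt0 => //; exact: mulr_gt0.
  by rewrite ler_pdivrMr ?mulr_gt0// mul1r (le_trans eta1)// mulr_ege1 ?ler1n.
- apply/andP; split; first by apply: divr_gt0 => //; do 2 apply: mulr_gt0 => //.
  by rewrite ler_pdivrMr ?mulr_gt0// mul1r (le_trans eta1)// !mulr_ege1 ?ler1n.
move=> h m a /andP[h0 hA]; rewrite leNgt; apply/negP => Ilt.
pose S := \sum_j a j ^+ 2.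
have M0 : 0 < m.+1%:R :> R by rewrite ltr0n.
pose I0 := \int[mu]_x trig_sqr a (fun j => j%:R * h) x.
have I0E : I0 = \int[mu]_x trig_sqr a (fun j => j%:R * h) x by [].
rewrite -I0E in Ilt.
have I00 : 0 <= I0 by rewrite I0E; apply: Rintegral_ge0 => x _; rewrite addr_ge0 ?sqr_ge0.
clearbody I0.
pose s := eta / (2 * K); have sE : s = eta / (2 * K) by [].
have s0 : 0 < s by rewrite divr_gt0 ?mulr_gt0.
pose Q := 32 / (s * h); have QE : Q = 32 / (s * h) by [].
have Q0 : 0 < Q by apply: divr_gt0 => //; exact: mulr_gt0.
have kE : eta / (16 * 16 * K) * h = (4 * Q)^-1.
  by rewrite QE sE; field; rewrite !gt_eqF.
clearbody Q s.
have S0 : 0 < S.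
  rewrite -(@pmulr_rgt0 _ (eta / (16 * 16) * (eta / (16 * 16 * K) * h) ^+ (2 * m))).
    exact: le_lt_trans I00 Ilt.
  by apply: mulr_gt0; rewrite ?divr_gt0// kE exprn_gt0// invr_gt0 mulr_gt0.
(* The denominator makes the bound of [sum_sqr_le_of_samples] equal to [S / 2]. *)
pose c := S / (128 * m.+1%:R ^+ 3 * Q ^+ (2 * m)).
have c0 : 0 < c by rewrite divr_gt0 ?mulr_gt0 ?exprn_gt0.
have Ic : I0 < c * (eta / (2 * m.+1%:R)).
  apply: (lt_le_trans Ilt); rewrite kE.
  have h1 : m.+1%:R ^+ 4 <= 4 ^+ (2 * m) :> R.
    rewrite exprM (_ : 4 ^+ 2 = 2 ^+ 4 :> R); last by rewrite -!natrX.
    rewrite -exprM mulnC exprM lerXn2r ?nnegrE ?exprn_ge0//.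
    by rewrite -natrX ler_nat succ_le_expn2.
  rewrite exprVn exprMn -/S.
  have -> : c * (eta / (2 * m.+1%:R)) = eta / (16 * 16) * (m.+1%:R ^+ 4 * Q ^+ (2 * m))^-1 * S.
    by rewrite /c; field; rewrite !gt_eqF ?exprn_gt0.
  rewrite ler_pM2r// ler_pM2l ?divr_gt0// lef_pV2 ?posrE ?mulr_gt0 ?exprn_gt0//.
  by rewrite ler_pM2r ?exprn_gt0.
have [u [v []]] := quantile_cells A0 K0 nuK nu0 (ltn0Sn m).
rewrite etaF => uvA uv sep.
have ex (k : 'I_m.+1) : exists x, u k < x <= v k /\ trig_sqr a (fun j => j%:R * h) x <= c.
  have [_ cellE] := uv k (ltn_ord k).
  have [||x x1 x2] := exists_small_on_cell (q := trig_sqr a (fun j => j%:R * h)) numu _ (integrable_trig_sqr mu _ _) cellE _ (ltW c0).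
  - by move=> x; rewrite addr_ge0 ?sqr_ge0.
  - by rewrite -I0E.
  by exists x.
have /choice[x Hx] := ex.
have : S <= 64 * m.+1%:R ^+ 3 * c * Q ^+ (2 * m).
  rewrite QE.
  apply: (@sum_sqr_le_of_samples m a h s A c x) => //.
  - by rewrite mulrC -ler_pdivlMr ?mulr_gt0// mul1r.
  - move=> k; have [/andP[x1 x2] _] := Hx k; have [y1 y2] := uvA _ (ltn_ord k).
    by rewrite (le_trans y1 (ltW x1)) (le_trans x2 y2).
  - move=> k l kl; have klM : (k < l < m.+1)%N by rewrite kl ltn_ord.
    have := sep _ _ klM; rewrite (_ : eta / (2 * m.+1%:R * K) = s / m.+1%:R); last first.
      by rewrite sE; field; rewrite !gt_eqF.
    have [/andP[x1 x2] _] := Hx k; have [/andP[x3 x4] _] := Hx l.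
    move=> hh; apply: (le_trans hh); lra.
  by move=> k; have [] := Hx k.
have -> : 64 * m.+1%:R ^+ 3 * c * Q ^+ (2 * m) = S / 2.
  by rewrite /c; field; rewrite !gt_eqF ?exprn_gt0.
lra.
Qed.

End EnergyBound.

(** * Oscillation of the high derivatives *)

Section FdiffVariation.
Context (R : realType).
Implicit Types (T h M : R) (f : R -> R).

(** Convexity of the power function. *)
Lemma tangent_le_exprn (x y : R) q : 0 <= x -> 0 <= y ->
  y ^+ q.+1 + q.+1%:R * y ^+ q * (x - y) <= x ^+ q.+1.
Proof.
move=> x0 y0; elim: q => [|q IH]; first by rewrite !expr1 expr0; lra.
apply: le_trans (_ : _ <= x * x ^+ q.+1) _; last by rewrite -exprS.
apply: le_trans (ler_wpM2l x0 IH); rewrite -subr_ge0.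
have -> : x * (y ^+ q.+1 + q.+1%:R * y ^+ q * (x - y)) -
    (y ^+ q.+2 + q.+2%:R * y ^+ q.+1 * (x - y)) = q.+1%:R * y ^+ q * (x - y) ^+ 2.
  by rewrite -[q.+2%:R]natr1 !exprS; ring.
by rewrite mulr_ge0 ?sqr_ge0// mulr_ge0 ?exprn_ge0.
Qed.

(** Sum the tangent inequality at the mean: the linear terms cancel. *)
Lemma power_mean_le (N q : nat) (x : 'I_N.+1 -> R) : (forall i, 0 <= x i) ->
  (\sum_i x i) ^+ q.+1 <= N.+1%:R ^+ q * \sum_i x i ^+ q.+1.
Proof.
move=> x0; have N0 : 0 < N.+1%:R :> R by rewrite ltr0n.
pose y := (\sum_i x i) / N.+1%:R.
have y0 : 0 <= y by rewrite divr_ge0// sumr_ge0.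
have sE : \sum_i x i = N.+1%:R * y by rewrite /y mulrC divfK// gt_eqF.
have : \sum_i (y ^+ q.+1 + q.+1%:R * y ^+ q * (x i - y)) <= \sum_i x i ^+ q.+1.
  by apply: ler_sum => i _; exact: tangent_le_exprn.
have -> : \sum_i (y ^+ q.+1 + q.+1%:R * y ^+ q * (x i - y)) = N.+1%:R * y ^+ q.+1.
  rewrite big_split/= sumr_const card_ord -[_ *+ N.+1]mulr_natl.
  rewrite -mulr_sumr sumrB sumr_const card_ord sE -[y *+ N.+1]mulr_natl.
  by rewrite subrr mulr0 addr0.
move=> h; rewrite sE; rewrite exprMn [N.+1%:R ^+ q.+1]exprSr -mulrA.
by rewrite ler_pM2l// exprn_gt0.
Qed.

(** The [k]-th derivative is approximated by [h ^- k] times the [k]-th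
    difference on the grid of mesh [h = T / N.+1]; this is the total variation
    of that approximation over [0, T]. *)
Definition fdiff_variation T k f N : R :=
  (T / N.+1%:R) ^- k * \sum_(i < N.+1) `|iter k.+1 (fdiff (T / N.+1%:R)) f (i%:R * (T / N.+1%:R))|.

(** The right-hand side is the total variation along the grid. *)
Lemma grid_dist_le f k h N (i j : nat) : (i <= N.+1)%N -> (j <= N.+1)%N ->
  `|iter k (fdiff h) f (i%:R * h) - iter k (fdiff h) f (j%:R * h)| <=
  \sum_(l < N.+1) `|iter k.+1 (fdiff h) f (l%:R * h)|.
Proof.
move=> iN jN; wlog ij : i j iN jN / (i <= j)%N.
  by move=> W; have /orP[|] := leq_total i j => h1; [|rewrite distrC]; exact: W.
pose u l := iter k (fdiff h) f (l%:R * h).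
have uE l : iter k.+1 (fdiff h) f (l%:R * h) = u l.+1 - u l.
  by rewrite iterS /fdiff /u -[l.+1%:R]natr1 mulrDl mul1r.
rewrite distrC -/(u i) -/(u j) -(telescope_sumr _ ij).
apply: (le_trans (ler_norm_sum _ _ _)).
rewrite -(big_mkord predT (fun l => `|iter k.+1 (fdiff h) f (l%:R * h)|)).
rewrite [leRHS](@big_cat_nat _ _ _ i)//= [X in _ <= _ + X](@big_cat_nat _ _ _ j)//=.
rewrite [X in _ <= _ + (X + _)](eq_bigr (fun l => `|u l.+1 - u l|)); last by move=> l _; rewrite -uE.
rewrite addrCA lerDl addr_ge0// sumr_ge0//.
Qed.

(** As the mesh tends to zero the normalised differences converge to the
    derivative at any two given points; infinitely many meshes suffice. *)
Lemma fdiff_variation_dist F k T M x z : derivative_tower F -> 0 < T ->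
  (forall N0, exists2 N, (N0 <= N)%N & fdiff_variation T k (F 0%N) N <= M) ->
  0 <= x <= T -> 0 <= z <= T -> `|F k x - F k z| <= M.
Proof.
move=> tF T0 HM x0T z0T; rewrite leNgt; apply/negP => Mlt.
(* Half of the assumed excess is lost at each of the two points. *)
pose e := (`|F k x - F k z| - M) / 2.
have e0 : 0 < e by rewrite divr_gt0// subr_gt0.
have cF : continuous (F k) by exact: (is_derive_continuous (tF k)).
have near y : exists2 d, 0 < d & forall t, `|y - t| < d -> `|F k y - F k t| < e.
  by have /cvgrPdist_lt /(_ _ e0) [d /= d0 Hd] := cF y; exists d.
have [dx dx0 Hx] := near x; have [dz dz0 Hz] := near z.
pose d := Num.min dx dz; have d0 : 0 < d by rewrite lt_min dx0.
have [N N0N HN] := HM (Num.trunc (k.+1%:R * T / d)).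
set h := T / N.+1%:R; have NR : 0 < N.+1%:R :> R by rewrite ltr0n.
have h0 : 0 < h by rewrite divr_gt0.
have hd : k.+1%:R * h < d.
  rewrite /h mulrA ltr_pdivrMr// -ltr_pdivrMl// [_^-1 * _]mulrC.
  by apply: (lt_le_trans (truncnS_gt _)); rewrite ler_nat.
have grid y : 0 <= y <= T -> exists2 i, (i <= N.+1)%N &
    exists2 xi, `|y - xi| < d & iter k (fdiff h) (F 0%N) (i%:R * h) = h ^+ k * F k xi.
  move=> /andP[y0 yT]; pose i := Num.trunc (y / h).
  have /andP[i1 i2] := truncn_itv (divr_ge0 y0 (ltW h0)).
  rewrite -/i ler_pdivlMr// in i1; rewrite -/i ltr_pdivrMr// in i2.
  exists i.
    rewrite -(ler_nat R) -(ler_pM2r h0) (le_trans i1)// (le_trans yT)//.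
    by rewrite /h mulrC divfK// gt_eqF.
  have [xi /andP[xi1 xi2] xiE] := fdiff_mvt k (i%:R * h) tF (ltW h0).
  exists xi => //; apply: le_lt_trans hd.
  rewrite -[k.+1%:R]natr1 mulrDl mul1r; rewrite -[i.+1%:R]natr1 mulrDl mul1r in i2.
  have kh : 0 <= k%:R * h by rewrite mulr_ge0// ltW.
  by rewrite ler_norml; apply/andP; split; lra.
have [i iN [xi xid xiE]] := grid _ x0T; have [j jN [xj xjd xjE]] := grid _ z0T.
have := grid_dist_le (F 0%N) k h iN jN.
rewrite xiE xjE -mulrBr normrM ger0_norm ?exprn_ge0 ?(ltW h0)//.
rewrite -ler_pdivlMl ?exprn_gt0// -/(fdiff_variation T k (F 0%N) N) => hv.
have xidx : `|x - xi| < dx by apply: (lt_le_trans xid); rewrite /d ge_min lexx.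
have xjdz : `|z - xj| < dz by apply: (lt_le_trans xjd); rewrite /d ge_min lexx orbT.
have h1 := Hx _ xidx; have h2 := Hz _ xjdz.
have h3 := le_trans hv HN.
have eE : `|F k x - F k z| = M + e + e by rewrite /e; field.
have : `|F k x - F k z| <= `|F k x - F k xi| + `|F k xi - F k xj| + `|F k z - F k xj|.
  rewrite (distrC (F k z)).
  rewrite (_ : F k x - F k z = (F k x - F k xi) + (F k xi - F k xj) + (F k xj - F k z)); last by ring.
  by rewrite (le_trans (ler_normD _ _))// lerD2r ler_normD.
lra.
Qed.

End FdiffVariation.

Section DerivativeTail.
Context d (Omega : measurableType d) (R : realType) (P : probability Omega R).
Variables (X : R -> {RV P >-> R}) (mu : probability (measurableTypeR R) R).
Hypotheses (hgauss : gaussian_process X) (hcent : centered X) (hstat : stationary X).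
Hypotheses (hspec : is_spectral_measure X mu) (hmom : finite_moments mu).
Let gH := process_gaussian_space hgauss hcent.

Lemma paths_tower (hsmooth : smooth_paths X) w :
  derivative_tower (fun k => ((fun u => X u w : R)^`(k))%classic).
Proof.
move=> k t; apply: DeriveDef; first exact: hsmooth.
by rewrite derive1nS derive1E.
Qed.

Lemma measurable_fdiff_variation T k N :
  measurable_fun setT (fun w => fdiff_variation T k (X^~ w) N).
Proof.
apply: measurable_funM => //; apply: measurable_sum => i.
apply: measurableT_comp; first exact: normr_measurable.
exact: (gspace_measurable gH (process_span_fdiff X _ _ _)).
Qed.

(** The powers of the mesh cancel: [N.+1] differences of size [h ^+ k.+1],
    divided by [h ^+ k], add up to [T] whatever [N] is. *)
Lemma fdiff_variation_moment_le T k N p : 0 < T -> (0 < p)%N ->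
  (\int[P]_w (fdiff_variation T k (X^~ w) N ^+ (2 * p))%:E <=
    ((4 * expR 1 * p%:R) ^+ p * (T ^+ 2 * moment mu (2 * k.+1)) ^+ p)%:E)%E.
Proof.
move=> T0 p0; set h := T / N.+1%:R.
have N0 : 0 < N.+1%:R :> R by rewrite ltr0n.
have h0 : 0 < h by rewrite divr_gt0.
pose D (i : 'I_N.+1) w := iter k.+1 (fdiff h) (X^~ w) (i%:R * h).
have gD i : process_span X (D i) by exact: process_span_fdiff.
have mD i : measurable_fun setT (D i) by exact: (gspace_measurable gH (gD i)).
pose c := (h ^- k) ^+ (2 * p) * N.+1%:R ^+ (2 * p).-1.
have c0 : 0 <= c by rewrite mulr_ge0 ?exprn_ge0 ?invr_ge0 ?exprn_ge0 ?ltW.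
have p2 : (2 * p = (2 * p).-1.+1)%N by rewrite prednK// muln_gt0.
have even (x : R) : `|x| ^+ (2 * p) = x ^+ (2 * p) by rewrite !exprM real_normK ?num_real.
apply: (@le_trans _ _ (\int[P]_w (c%:E * \sum_(i < N.+1) (D i w ^+ (2 * p))%:E))%E).
  apply: ge0_le_integral => //.
  - by move=> w _; rewrite lee_fin exprM exprn_ge0// sqr_ge0.
  - by apply/measurable_EFinP; apply: measurable_funX; exact: measurable_fdiff_variation.
  - apply: emeasurable_funM => //; apply: emeasurable_sum => i.
    by apply/measurable_EFinP; exact: measurable_funX.
  move=> w _; rewrite sumEFin -EFinM lee_fin /fdiff_variation -/h exprMn /c -mulrA.
  rewrite ler_wpM2l ?exprn_ge0 ?invr_ge0 ?exprn_ge0 ?(ltW h0)//.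
  rewrite p2 (le_trans (power_mean_le _ _))//.
  by rewrite -p2 /=; under eq_bigr do rewrite even.
rewrite ge0_integralZl//; last 2 first.
- apply: emeasurable_sum => i; apply/measurable_EFinP; exact: measurable_funX.
- by move=> w _; rewrite sume_ge0// => i _; rewrite lee_fin exprM exprn_ge0// sqr_ge0.
rewrite ge0_integral_sum//; last 2 first.
- by move=> i; apply/measurable_EFinP; exact: measurable_funX.
- by move=> i w _; rewrite lee_fin exprM exprn_ge0// sqr_ge0.
pose b := (4 * expR 1 * p%:R) ^+ p * (h ^+ (2 * k.+1) * moment mu (2 * k.+1)) ^+ p.
apply: (@le_trans _ _ (c%:E * \sum_(i < N.+1) b%:E)%E).
  apply: lee_wpmul2l; first by rewrite lee_fin.
  apply: lee_sum => i _.
  apply: (le_trans (gaussian_even_moment_le (gspace_gaussian gH (gD i)) p0)).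
  rewrite lee_fin ler_wpM2l ?exprn_ge0 ?mulr_ge0 ?expR_ge0//.
  rewrite lerXn2r ?nnegrE ?second_moment_ge0//.
    by rewrite (le_trans (second_moment_ge0 P (D i)))// (fdiff_second_moment_le hgauss hcent hstat hspec hmom).
  exact: (fdiff_second_moment_le hgauss hcent hstat hspec hmom).
rewrite sumEFin -EFinM lee_fin sumr_const card_ord -[b *+ _]mulr_natl /c.
rewrite -(mulrA (h ^- k ^+ (2 * p))) (mulrA (_ ^+ _.-1)) -exprSr -p2 /b.
have hT : h * N.+1%:R = T by rewrite /h divfK// gt_eqF.
have -> : T ^+ 2 = (h ^- k) ^+ 2 * N.+1%:R ^+ 2 * h ^+ (2 * k.+1).
  rewrite -hT (mulnC 2) exprM (exprSr h k); field.
  by rewrite expf_neq0// gt_eqF.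
rewrite le_eqVlt; apply/orP; left; apply/eqP.
by rewrite !exprM -!exprMn; congr (_ ^+ p); ring.
Qed.

(** The variation may exceed [M] for every large mesh only on an increasing
    union of events, each of which is contained in a single event that
    Markov's inequality controls uniformly in the mesh. So the union satisfies
    the same bound. *)
Lemma fdiff_variation_tail T k M p : 0 < T -> 0 < M -> (0 < p)%N ->
  exists2 S : set Omega, measurable S /\
   (P S <= ((4 * expR 1 * p%:R) ^+ p * (T ^+ 2 * moment mu (2 * k.+1)) ^+ p / M ^+ (2 * p))%:E)%E &
   forall w, ~ S w -> forall N0, exists2 N, (N0 <= N)%N & fdiff_variation T k (X^~ w) N <= M.
Proof.
move=> T0 M0 p0.
pose G N w := fdiff_variation T k (X^~ w) N.
pose A N := [set w | M < G N w].
have mA N : measurable (A N).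
  rewrite -[A N]setTI (_ : A N = G N @^-1` `]M, +oo[%classic).
    by apply: measurable_fdiff_variation => //; exact: measurable_itv.
  by apply/seteqP; split => w /=; rewrite in_itv/= andbT.
pose F N0 := \bigcap_(N in [set N | (N0 <= N)%N]) A N.
have mF N0 : measurable (F N0) by apply: bigcap_measurable => //; exists N0 => /=.
have mU : measurable (\bigcup_N F N) by exact: bigcupT_measurable.
exists (\bigcup_N F N); last first.
  move=> w Sw N0; apply: contrapT => H; apply: Sw; exists N0 => // N /= N0N.
  rewrite /A /= ltNge; apply/negP => h; apply: H; exists N => //.
split => //.
set b := (X in X%:E).
have PA N : (P (A N) <= b%:E)%E.
  have := fdiff_variation_moment_le k N T0 p0; set c := (X in (_ <= X%:E)%E) => hc.
  have Mp0 : 0 < M ^+ (2 * p) by rewrite exprn_gt0.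
  have fA : P (A N) \is a fin_num by exact: fin_num_measure.
  rewrite /b -/c -(fineK fA) lee_fin ler_pdivlMr// -lee_fin EFinM fineK//.
  apply: le_trans hc; rewrite muleC -integral_cst//.
  apply: (@le_trans _ _ (\int[P]_(w in A N) (G N w ^+ (2 * p))%:E)%E).
    apply: ge0_le_integral => //.
    - by move=> w _; rewrite lee_fin exprn_ge0// ltW.
    - apply/measurable_EFinP; apply: measurable_funX; apply: (measurable_funS measurableT) => //.
      exact: measurable_fdiff_variation.
    move=> w /= Gw; rewrite lee_fin lerXn2r ?nnegrE ?(ltW M0) ?(ltW Gw)//.
    exact: (ltW (lt_trans M0 Gw)).
  apply: ge0_subset_integral => //.
    by apply/measurable_EFinP; apply: measurable_funX; exact: measurable_fdiff_variation.
  by move=> w _; rewrite lee_fin exprM exprn_ge0// sqr_ge0.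
have nF : nondecreasing_seq F.
  move=> m n mn; apply/subsetPset => w Fw N /= nN; apply: Fw => /=.
  exact: leq_trans nN.
have cvF := @nondecreasing_cvg_mu _ _ _ P _ mF mU nF.
rewrite -(cvg_lim _ cvF)//; apply: lime_le; first by apply/cvg_ex; eexists; exact: cvF.
apply: nearW => N; apply: le_trans (PA N); apply: le_measure; [exact: mem_set|exact: mem_set|].
by move=> w Fw; apply: Fw => /=.
Qed.

End DerivativeTail.

(** * Probability of many zeros *)

Section ZeroCount.
Context d (Omega : measurableType d) (R : realType) (P : probability Omega R).
Variables (X : R -> {RV P >-> R}) (mu : probability (measurableTypeR R) R).
Hypotheses (hgauss : gaussian_process X) (hcent : centered X) (hstat : stationary X).
Hypotheses (hsmooth : smooth_paths X) (hspec : is_spectral_measure X mu).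
Hypothesis hmom : finite_moments mu.
Let gH := process_gaussian_space hgauss hcent.

Lemma process_path_continuous w : continuous (fun u => X u w : R).
Proof. by have := paths_tower hsmooth w => /(_ 0%N) /is_derive_continuous. Qed.

Lemma num_zeros_geE (T : R) n : [set w | (n%:R%:E <= num_zeros X T w)%E] =
  [set w | exists s : seq R, [/\ size s = n, uniq s &
    forall x, x \in s -> 0 <= x <= T /\ X x w = 0]].
Proof. by apply/seteqP; split => w /counting_ge. Qed.

Lemma measurable_num_zeros_ge (T : R) n : 0 < T ->
  measurable [set w | (n%:R%:E <= num_zeros X T w)%E].
Proof.
move=> T0; rewrite num_zeros_geE.
apply: (@measurable_zero_count _ _ _ (fun t w => X t w)) => //.
exact: process_path_continuous.
Qed.

Variables h0 k0 k : R.
Hypotheses (k0gt0 : 0 < k0) (k0le1 : k0 <= 1) (kgt0 : 0 < k) (kle1 : k <= 1).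
Hypothesis h0le1 : h0 <= 1.
Hypothesis energy : forall (h : R) m (a : 'I_m.+1 -> R), 0 < h <= h0 ->
  k0 * (k * h) ^+ (2 * m) * (\sum_j a j ^+ 2) <=
  \int[mu]_x trig_sqr a (fun j => j%:R * h) x.

Lemma grid_energy (h : R) m (a : 'I_m.+1 -> R) : 0 < h <= h0 ->
  k0 * (k * h) ^+ (2 * m) * \sum_i a i ^+ 2 <=
  cov P (lincomb a (fun i => X (i%:R * h) : Omega -> R))
        (lincomb a (fun i => X (i%:R * h) : Omega -> R)).
Proof.
move=> hh; rewrite (cov_lincomb_process hgauss hcent hstat hspec a (fun i => i%:R * h)).
exact: energy.
Qed.

(** Alternating signs on the grid of mesh [T / n] give one zero per cell. *)
Lemma zero_count_prob_ge (T : R) n : (0 < n)%N -> 0 < T -> T / n%:R <= h0 ->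
  ((60^-1 * (Num.sqrt (k0 * (k * (T / n%:R)) ^+ (2 * n) / n.+1%:R) / (30 * n.+1%:R)) ^+ n)%:E <=
   P [set w | n%:R%:E <= num_zeros X T w])%E.
Proof.
move=> n0 T0 hh; have nR : 0 < n%:R :> R by rewrite ltr0n.
set h := T / n%:R in hh *; have hgt0 : 0 < h by rewrite divr_gt0.
have kh1 : k * h <= 1 by apply: mulr_ile1 => //; [exact: ltW|exact: ltW|exact: le_trans h0le1].
pose Y (i : 'I_n.+1) := X (i%:R * h) : Omega -> R.
have mZ := measurable_num_zeros_ge n T0.
have hY i : process_span X (Y i) by exact: process_spanX.
have mY i : measurable_fun setT (Y i) by exact: (gspace_measurable gH (hY i)).
apply: le_trans (gspace_alternating_ge gH hY _ _ (fun a => grid_energy a _)) _.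
- by move=> i; exact: (spectral_cov_eq1 hgauss hcent hstat hspec).
- have kh0 : 0 < k * h by exact: mulr_gt0.
  rewrite mulr_gt0 ?exprn_gt0//=; apply: mulr_ile1 => //; first exact: ltW.
    by rewrite exprn_ge0// ltW.
  by rewrite exprn_ile1// ltW.
- by rewrite hgt0.
apply: le_measure => //.
- apply/mem_set; rewrite (_ : [set w | _] = \bigcap_(i in [set: 'I_n.+1]) [set w | 0 < (-1) ^+ i * Y i w]).
    apply: fin_bigcap_measurable => // i _.
    rewrite (_ : [set w | _] = (fun w => (-1) ^+ i * Y i w) @^-1` `]0, +oo[%classic).
      rewrite -[X in measurable X]setTI.
      by apply: (measurable_funM (measurable_cst _) (mY i)) => //; exact: measurable_itv.
    by apply/seteqP; split => w /=; rewrite in_itv/= andbT.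
  by apply/seteqP; split => w /= H i; [move=> _|]; exact: H.
- exact/mem_set.
move=> w H; rewrite num_zeros_geE /=.
have [||s [s1 s2 s3]] := @alternating_zeros R (fun u => X u w : R) n (fun i => i%:R * h) (@process_path_continuous w).
- by move=> i _; rewrite ltr_pM2r// ltr_nat.
- by move=> i ni; exact: (H (Ordinal (ni : (i < n.+1)%N))).
exists s; split => // x /s3; rewrite mul0r (_ : n%:R * h = T)//.
by rewrite /h mulrC divfK// gt_eqF.
Qed.

(** Off the exceptional event the [n]-th derivative is at most [M], since it
    vanishes somewhere by Rolle and varies by at most [M]; then the path is
    small on the whole interval, in particular at the grid points. *)
Lemma zero_count_prob_le (T M : R) n m : 0 < T -> 0 < M -> T / m.+1%:R <= h0 ->
  (P [set w | n.+1%:R%:E <= num_zeros X T w] <=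
   ((4 * expR 1 * n.+1%:R) ^+ n.+1 * (T ^+ 2 * moment mu (2 * n.+1)) ^+ n.+1 / M ^+ (2 * n.+1) +
    (2 * (T ^+ n / n`!%:R * M) / Num.sqrt (k0 * (k * (T / m.+1%:R)) ^+ (2 * m))) ^+ m.+1)%:E)%E.
Proof.
move=> T0 M0 hh; set h := T / m.+1%:R in hh *.
have mR : 0 < m.+1%:R :> R by rewrite ltr0n.
have hgt0 : 0 < h by rewrite divr_gt0.
have [S [mS PS] HS] := fdiff_variation_tail hgauss hcent hstat hspec hmom n T0 M0 (ltn0Sn n).
set delta := T ^+ n / n`!%:R * M.
have delta0 : 0 < delta by rewrite mulr_gt0 ?divr_gt0 ?exprn_gt0// ltr0n fact_gt0.
pose Y (i : 'I_m.+1) := X (i%:R * h) : Omega -> R.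
have hY i : process_span X (Y i) by exact: process_spanX.
have mY i : measurable_fun setT (Y i) by exact: (gspace_measurable gH (hY i)).
have lam0 : 0 < k0 * (k * h) ^+ (2 * m) by rewrite mulr_gt0 ?exprn_gt0 ?mulr_gt0.
have hi : 0 < h <= h0 by rewrite hgt0.
have PB := gspace_small_ball_le gH hY lam0 delta0 (fun a => grid_energy a hi).
set B := [set w | _] in PB.
have mB : measurable B.
  rewrite (_ : B = \bigcap_(i in [set: 'I_m.+1]) [set w | `|Y i w| <= delta]).
    apply: fin_bigcap_measurable => // i _.
    rewrite (_ : [set w | _] = Y i @^-1` `[- delta, delta]%classic).
      by rewrite -[X in measurable X]setTI; apply: (mY i) => //; exact: measurable_itv.
    by apply/seteqP; split => w /=; rewrite in_itv/= ler_norml.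
  by apply/seteqP; split => w /= H i; [move=> _|]; exact: H.
apply: (@le_trans _ _ (P (S `|` B))).
  apply: le_measure; [exact/mem_set/measurable_num_zeros_ge|by apply/mem_set; exact: measurableU|].
  move=> w; rewrite num_zeros_geE => -[s [ss us sz]].
  have [wS|/HS freq] := pselect (S w); [by left|right] => i.
  have tF := paths_tower hsmooth w.
  have [xi xiT Fxi] := rolle_tower_uniq tF ss us sz.
  have Fle y : 0 <= y <= T -> `|((fun u => X u w : R)^`(n))%classic y| <= M.
    move=> yT; rewrite -[X in `|X|]subr0 -Fxi.
    exact: (fdiff_variation_dist tF T0 freq yT xiT).
  (* The bound on the path uses one zero less, as the derivative of order [n] is the
  one that is controlled. *)
  have us' : uniq (behead s) by case: (s) us => //= x s' /andP[].
  have ss' : size (behead s) = n by rewrite size_behead ss.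
  have sz' y : y \in behead s -> 0 <= y <= T /\ X y w = 0 by move=> /mem_behead; exact: sz.
  apply: (norm_le_of_zeros tF ss' us' sz' _ Fle).
  have TE : T = m.+1%:R * h by rewrite /h mulrC divfK// gt_eqF.
  by rewrite mulr_ge0 ?(ltW hgt0)//= TE ler_pM2r// ler_nat ltnW.
apply: (le_trans (measureU2 P mS mB)); rewrite EFinD.
exact: leeD.
Qed.

End ZeroCount.

(** * Choice of the constants *)

Section Numerics.
Context (R : realType).

Lemma expn_le_fact_expr n : n%:R ^+ n <= n`!%:R * 4 ^+ n :> R.
Proof.
apply: (le_trans (pow_le_expR n (ler0n R n))); apply: ler_wpM2l => //.
exact: expR_nat_le4.
Qed.

(** All losses are of the form constant to the power [n], up to
    [n.+1 ^+ 2 <= 4 ^+ n]; they go into the constant in front of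
    [n%:R / T]. *)
Lemma alternating_bound_ge (k0 k T : R) n : 0 < k0 -> k0 <= 1 -> 0 < k -> (0 < n)%N -> 0 < T ->
  expR (- (n%:R ^+ 2 * ln (60 * 30 * 4 / (k * k0) * n%:R / T))) <=
  60^-1 * (Num.sqrt (k0 * (k * (T / n%:R)) ^+ (2 * n) / n.+1%:R) / (30 * n.+1%:R)) ^+ n.
Proof.
move=> k00 k01 kgt0 n0 T0; have nR : 0 < n%:R :> R by rewrite ltr0n.
have n1R : 0 < n.+1%:R :> R by rewrite ltr0n.
pose h := T / n%:R; have h0 : 0 < h by rewrite divr_gt0.
set x := _ * n%:R / T.
have x0 : 0 < x by rewrite /x divr_gt0// mulr_gt0// divr_gt0 ?mulr_gt0.
have -> : expR (- (n%:R ^+ 2 * ln x)) = ((x^-1) ^+ n) ^+ n.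
  rewrite -exprM -[in RHS](@lnK _ x) ?posrE// -expRN -expRM_natl natrM; congr expR; ring.
have s0 : 0 <= Num.sqrt (k0 * (k * h) ^+ (2 * n) / n.+1%:R) / (30 * n.+1%:R).
  by rewrite divr_ge0// mulr_ge0.
apply: (@le_trans _ _ ((60^-1 * (Num.sqrt (k0 * (k * h) ^+ (2 * n) / n.+1%:R) / (30 * n.+1%:R))) ^+ n)); last first.
  rewrite exprMn -/h; apply: ler_wpM2r; first exact: exprn_ge0.
  case: n n0 {nR n1R h h0 x x0 s0} => // n _; rewrite exprS ler_piMr// exprn_ile1//.
  by rewrite invf_le1// ler1n.
rewrite lerXn2r ?nnegrE ?exprn_ge0 ?invr_ge0 ?(ltW x0) ?mulr_ge0//.
have sq : k0 * (k * h) ^+ n / n.+1%:R <= Num.sqrt (k0 * (k * h) ^+ (2 * n) / n.+1%:R).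
  have khn : 0 <= (k * h) ^+ n by rewrite exprn_ge0// mulr_ge0// ltW.
  rewrite -[leLHS]ger0_norm ?divr_ge0 ?mulr_ge0 ?(ltW k00)// -sqrtr_sqr.
  apply: ler_wsqrtr; rewrite expr_div_n exprMn -exprM (mulnC n).
  have p2 : 0 <= (k * h) ^+ (2 * n) by rewrite exprM exprn_ge0// sqr_ge0.
  have k02 : k0 ^+ 2 <= k0 by rewrite expr2 ler_piMr// ltW.
  have n12 : (n.+1%:R ^+ 2)^-1 <= n.+1%:R^-1 :> R.
    by rewrite lef_pV2 ?posrE ?exprn_gt0// expr2 ler_peMr ?ler1n.
  have q0 : 0 <= k0 ^+ 2 * (k * h) ^+ (2 * n) by rewrite mulr_ge0 ?sqr_ge0.
  have q1 : 0 <= (n.+1%:R ^+ 2)^-1 :> R by rewrite invr_ge0 sqr_ge0.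
  exact: (ler_pM q0 q1 (ler_wpM2r p2 k02) n12).
apply: (@le_trans _ _ (60^-1 * (k0 * (k * h) ^+ n / n.+1%:R / (30 * n.+1%:R)))); last first.
  by apply: ler_wpM2l => //; apply: ler_wpM2r => //; rewrite invr_ge0 mulr_ge0.
have n4 : n.+1%:R ^+ 2 <= 4 ^+ n :> R.
  have h2 := succ_le_expn2 n.
  rewrite (_ : 4 = 2 ^+ 2 :> R); last by rewrite -natrX.
  by rewrite -exprM mulnC exprM lerXn2r ?nnegrE ?exprn_ge0// -natrX ler_nat.
have -> : x^-1 = k * h * (k0 / (60 * 30 * 4)).
  by rewrite /x /h; field; rewrite !gt_eqF ?mulr_gt0.
rewrite exprMn.
have -> : 60^-1 * (k0 * (k * h) ^+ n / n.+1%:R / (30 * n.+1%:R)) =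
    (k * h) ^+ n * (k0 / (60 * 30) * (n.+1%:R ^+ 2)^-1).
  by field; rewrite !gt_eqF.
apply: ler_wpM2l; first by rewrite exprn_ge0// mulr_ge0// ltW.
rewrite (_ : k0 / (60 * 30 * 4) = k0 / (60 * 30) / 4); last by field.
rewrite expr_div_n; apply: ler_pM; rewrite ?exprn_ge0 ?invr_ge0 ?divr_ge0 ?(ltW k00)//.
  case: n n0 {nR n1R h h0 x x0 s0 sq n4} => // n _; rewrite exprS ler_piMr ?divr_ge0 ?(ltW k00)//.
  rewrite exprn_ile1 ?divr_ge0 ?(ltW k00)// ler_pdivrMr ?mulr_gt0// mul1r (le_trans k01)//.
  by rewrite mulr_ege1 ?ler1n.
by rewrite lef_pV2 ?posrE ?exprn_gt0.
Qed.

(** The exponent [2 * eps * n] lost in the scale [x] exceeds [m], the number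
    of grid points. *)
Lemma power_scale_le (B D x eps : R) n m : 0 < B -> 1 <= D -> 1 <= x -> (0 < n)%N ->
  m%:R <= 2 * eps * n%:R ->
  (B / (D `^ (1 / n%:R)) * x `^ (1 - 2 * eps)) ^+ n <= B ^+ n / D * x ^+ n / x ^+ m.
Proof.
move=> B0 D1 x1 n0 mn; have nR : 0 < n%:R :> R by rewrite ltr0n.
have D0 : 0 < D by exact: lt_le_trans D1.
have x0 : 0 < x by exact: lt_le_trans x1.
rewrite exprMn expr_div_n -mulrA.
have -> : (D `^ (1 / n%:R)) ^+ n = D.
  by rewrite -powR_mulrn ?powR_ge0// -powRrM divfK ?gt_eqF// powRr1// ltW.
apply: ler_wpM2l; first by rewrite divr_ge0 ?exprn_ge0 ?ltW.
rewrite ler_pdivlMr ?exprn_gt0//.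
rewrite -!powR_mulrn ?powR_ge0 ?(ltW x0)// -powRrM -powRD; last by rewrite (gt_eqF x0) /= implybT.
by apply: ler_powR => //; lra.
Qed.

(** The factor [(n / T) ^+ m] saved through [power_scale_le] compensates
    the smallness [(k * T / m) ^+ m] of the conditional standard deviation,
    because [m <= n]. What remains is exponential in [n] and is absorbed by the
    constant [k * k0 / (16 * 16)]. *)
Lemma small_ball_ratio_le (k0 k T D L eps : R) n m : 0 < k0 -> k0 <= 1 -> 0 < k -> k <= 1 ->
  0 < T -> 1 <= D -> (m.+1 <= n.+1)%N -> m.+1%:R <= eps * n.+1%:R -> T <= n.+1%:R ->
  L = k * k0 / (16 * 16) / (D `^ (1 / n.+1%:R)) * (n.+1%:R / T) `^ (1 - 2 * eps) ->
  2 * (T ^+ n / n`!%:R * (2 * expR 1 * n.+1%:R * T * D)) / (k0 * (k * (T / m.+1%:R)) ^+ m) * L ^+ n.+1 <= 1.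
Proof.
move=> k00 k01 kgt0 k1 T0 D1 mn meps Tn LE.
have nR : 0 < n.+1%:R :> R by rewrite ltr0n.
have mR : 0 < m.+1%:R :> R by rewrite ltr0n.
have D0 : 0 < D by exact: lt_le_trans D1.
have e0 := expR_gt0 (1 : R).
have B0 : 0 < k * k0 / (16 * 16) by apply: divr_gt0; exact: mulr_gt0.
have x1 : 1 <= n.+1%:R / T by rewrite ler_pdivlMr// mul1r.
have x0 : 0 < n.+1%:R / T by exact: lt_le_trans x1.
have mle : m%:R <= 2 * eps * n.+1%:R by rewrite -natr1 in meps; have := ler0n R m; lra.
have := power_scale_le B0 D1 x1 (ltn0Sn n) mle; rewrite -LE => HL.
set A := (X in X * _).
have A0 : 0 <= A.
  rewrite /A; apply: divr_ge0.
    apply: mulr_ge0 => //; apply: mulr_ge0; first by rewrite divr_ge0// exprn_ge0// ltW.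
    by rewrite !mulr_ge0// ltW.
  by rewrite mulr_ge0 ?(ltW k00)// exprn_ge0// mulr_ge0 ?(ltW kgt0)// divr_ge0// ltW.
apply: (le_trans (ler_wpM2l A0 HL)).
have F0 : 0 < n`!%:R :> R by rewrite ltr0n fact_gt0.
have F1 : n.+1%:R ^+ n.+1 / n`!%:R <= n.+1%:R * 4 ^+ n.+1 :> R.
  rewrite ler_pdivrMr//; have := expn_le_fact_expr n.+1.
  by rewrite factS natrM mulrAC.
have M1 : (m.+1%:R / (k * n.+1%:R)) ^+ m <= k^-1 ^+ n.+1.
  apply: (@le_trans _ _ (k^-1 ^+ m)).
    rewrite lerXn2r ?nnegrE ?divr_ge0 ?mulr_ge0 ?invr_ge0 ?(ltW kgt0)//.
    rewrite invfM mulrCA ler_piMr ?invr_ge0 ?(ltW kgt0)// ler_pdivrMr// mul1r ler_nat//.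
  by rewrite ler_weXn2l ?invr_ge1 ?unitfE ?gt_eqF// (leq_trans _ mn).
have AE (b : R) : A * (b / D * (n.+1%:R / T) ^+ n.+1 / (n.+1%:R / T) ^+ m) =
   (4 * expR 1 / k0) * (n.+1%:R ^+ n.+1 / n`!%:R) * n.+1%:R * (m.+1%:R / (k * n.+1%:R)) ^+ m * b.
  rewrite /A !expr_div_n !exprMn !exprVn (exprS T n); field.
  by rewrite !gt_eqF ?exprn_gt0.
rewrite AE.
have n2 : n.+1%:R ^+ 2 <= 4 ^+ n.+1 :> R.
  have h2 := ltnW (succ_le_expn2 n.+1).
  rewrite (_ : 4 = 2 ^+ 2 :> R); last by rewrite -natrX.
  by rewrite -exprM mulnC exprM lerXn2r ?nnegrE ?exprn_ge0// -natrX ler_nat.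
apply: (@le_trans _ _ ((4 * 4 / k0) * (n.+1%:R * 4 ^+ n.+1) * n.+1%:R * (k^-1 ^+ n.+1) * (k * k0 / (16 * 16)) ^+ n.+1)).
  apply: ler_wpM2r; first by rewrite exprn_ge0// ltW.
  have q1 : 0 <= 4 * expR 1 / k0 by rewrite divr_ge0 ?mulr_ge0 ?(ltW k00) ?(ltW e0).
  have q2 : 0 <= n.+1%:R ^+ n.+1 / n`!%:R :> R by rewrite divr_ge0 ?exprn_ge0.
  have q3 : 0 <= (m.+1%:R / (k * n.+1%:R)) ^+ m by rewrite exprn_ge0// divr_ge0// mulr_ge0// ltW.
  apply: (ler_pM _ q3 _ M1); first by apply: mulr_ge0 => //; exact: mulr_ge0.
  apply: ler_wpM2r => //; apply: (ler_pM q1 q2 _ F1).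
  apply: ler_wpM2r; first by rewrite invr_ge0 ltW.
  by apply: ler_wpM2l => //; have := @expR1_le R; lra.
have kk : k^-1 ^+ n.+1 * (k * k0 / (16 * 16)) ^+ n.+1 = (k0 / (16 * 16)) ^+ n.+1.
  by rewrite -exprMn; congr (_ ^+ _); field; rewrite gt_eqF.
rewrite -[leLHS]mulrA kk.
have -> : 4 * 4 / k0 * (n.+1%:R * 4 ^+ n.+1) * n.+1%:R * (k0 / (16 * 16)) ^+ n.+1 =
   (n.+1%:R ^+ 2 * 4 ^+ n.+1) * (4 * 4 / k0 * (k0 / (16 * 16)) ^+ n.+1) by ring.
apply: (@le_trans _ _ (4 ^+ n.+1 * 4 ^+ n.+1 * (4 * 4 / k0 * (k0 / (16 * 16)) ^+ n.+1))).
  apply: ler_wpM2r; last by apply: ler_wpM2r => //; exact: exprn_ge0.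
  by rewrite mulr_ge0 ?exprn_ge0 ?divr_ge0 ?(ltW k00).
rewrite -exprMn mulrCA -exprMn exprS.
have -> : 4 * 4 * (k0 / (16 * 16)) = k0 / 16 by field.
rewrite mulrA (_ : 4 * 4 / k0 * (k0 / 16) = 1); last by field; rewrite gt_eqF.
rewrite mul1r exprn_ile1 ?divr_ge0 ?(ltW k00)//.
by rewrite ler_pdivrMr// mul1r (le_trans k01)// ler1n.
Qed.

Lemma derivative_tail_le (T C D E : R) n p : 0 < T -> 0 <= C -> C <= D ^+ 2 -> 1 <= D -> 0 < E ->
  (4 * expR 1 * n.+1%:R) ^+ p * (T ^+ 2 * C) ^+ p / (2 * expR 1 * n.+1%:R * T * D * E) ^+ (2 * p) <=
  (E ^- 2) ^+ p.
Proof.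
move=> T0 C0 CD D1 E0; have D0 : 0 < D by exact: lt_le_trans D1.
have nR : 0 < n.+1%:R :> R by rewrite ltr0n.
have e0 := expR_gt0 (1 : R).
rewrite exprM -exprMn -expr_div_n lerXn2r ?nnegrE ?invr_ge0 ?sqr_ge0//.
  by rewrite divr_ge0 ?sqr_ge0// !mulr_ge0 ?sqr_ge0// ltW.
have -> : 4 * expR 1 * n.+1%:R * (T ^+ 2 * C) / (2 * expR 1 * n.+1%:R * T * D * E) ^+ 2 =
    (C / D ^+ 2) * (expR 1 * n.+1%:R)^-1 * E ^- 2.
  by field; rewrite !gt_eqF.
rewrite ler_piMl ?invr_ge0 ?sqr_ge0// mulr_ile1 ?divr_ge0 ?sqr_ge0 ?invr_ge0 ?mulr_ge0 ?(ltW e0)//.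
  by rewrite ler_pdivrMr ?exprn_gt0// mul1r.
rewrite invf_le1 ?mulr_gt0// mulr_ege1 ?ler1n//.
by rewrite -[leLHS]expR0 ler_expR.
Qed.

(** [Num.sqrt k0] is bounded below by [k0]. *)
Lemma grid_value_tail_le (k0 k T D L E eps : R) n m : 0 < k0 -> k0 <= 1 -> 0 < k -> k <= 1 ->
  0 < T -> 1 <= D -> (m.+1 <= n.+1)%N -> m.+1%:R <= eps * n.+1%:R -> T <= n.+1%:R ->
  0 < L -> 0 < E ->
  L = k * k0 / (16 * 16) / (D `^ (1 / n.+1%:R)) * (n.+1%:R / T) `^ (1 - 2 * eps) ->
  2 * (T ^+ n / n`!%:R * (2 * expR 1 * n.+1%:R * T * D * E)) /
    Num.sqrt (k0 * (k * (T / m.+1%:R)) ^+ (2 * m)) <= E / L ^+ n.+1.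
Proof.
move=> k00 k01 kgt0 k1 T0 D1 mn meps Tn L0 E0 LE.
have := small_ball_ratio_le k00 k01 kgt0 k1 T0 D1 mn meps Tn LE.
set W := T ^+ n / n`!%:R; set V := 2 * expR 1 * n.+1%:R * T * D.
have D0 : 0 < D by exact: lt_le_trans D1.
have kh0 : 0 < k * (T / m.+1%:R) by rewrite mulr_gt0// divr_gt0// ltr0n.
have V0 : 0 <= V by rewrite /V; do 4 (apply: mulr_ge0; last by rewrite ?(ltW T0) ?(ltW D0) ?expR_ge0).
have W0 : 0 <= W by rewrite divr_ge0// exprn_ge0// ltW.
set q := k * _ in kh0 *.
have q0 : 0 < k0 * q ^+ m by rewrite mulr_gt0// exprn_gt0.
have sq : k0 * q ^+ m <= Num.sqrt (k0 * q ^+ (2 * m)).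
  rewrite -[leLHS]ger0_norm ?(ltW q0)// -sqrtr_sqr; apply: ler_wsqrtr.
  rewrite exprMn -exprM (mulnC m); apply: ler_wpM2r.
    by rewrite exprn_ge0// ltW.
  by rewrite expr2 ler_piMr// ltW.
have s0 : 0 < Num.sqrt (k0 * q ^+ (2 * m)) by exact: lt_le_trans sq.
move=> H; rewrite ler_pdivlMr ?exprn_gt0//.
apply: (@le_trans _ _ (2 * (W * (V * E)) / (k0 * q ^+ m) * L ^+ n.+1)).
  apply: ler_wpM2r; first by rewrite exprn_ge0// ltW.
  apply: ler_wpM2l; first by rewrite mulr_ge0// mulr_ge0// mulr_ge0// ltW.
  by rewrite lef_pV2 ?posrE.
rewrite (_ : 2 * (W * (V * E)) / (k0 * q ^+ m) * L ^+ n.+1 =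
   (2 * (W * V) / (k0 * q ^+ m) * L ^+ n.+1) * E); last by ring.
by rewrite ler_piMl// ltW.
Qed.

(** The number of grid points satisfies [m.+1 >= (2 / 3) * eps * n], since
    [eps * n <= m.+2 <= (3 / 2) * m.+1]. Together with [1 - eps / 4 >= 7 / 8]
    this leaves more than the exponent [eps * n ^ 2 / 2]. *)
Lemma upper_bound_le (k0 k T C D L eps : R) n m : 0 < k0 -> k0 <= 1 -> 0 < k -> k <= 1 ->
  0 < T -> 0 <= C -> C <= D ^+ 2 -> 1 <= D -> 0 < eps < 1 / 2 -> (0 < m)%N ->
  m.+1%:R <= eps * n.+1%:R -> eps * n.+1%:R <= m.+2%:R -> T <= n.+1%:R -> 1 <= L ->
  L = k * k0 / (16 * 16) / (D `^ (1 / n.+1%:R)) * (n.+1%:R / T) `^ (1 - 2 * eps) ->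
  forall M, M = 2 * expR 1 * n.+1%:R * T * D * expR (eps * n.+1%:R / 4 * ln L) ->
  (4 * expR 1 * n.+1%:R) ^+ n.+1 * (T ^+ 2 * C) ^+ n.+1 / M ^+ (2 * n.+1) +
    (2 * (T ^+ n / n`!%:R * M) / Num.sqrt (k0 * (k * (T / m.+1%:R)) ^+ (2 * m))) ^+ m.+1 <=
  2 * expR (- (eps * n.+1%:R ^+ 2 / 2 * ln L)).
Proof.
move=> k00 k01 kgt0 k1 T0 C0 CD D1 /andP[eps0 eps1] m0 meps epsm Tn L1 LE M ->.
have L0 : 0 < L by exact: lt_le_trans L1.
have l0 : 0 <= ln L by exact: ln_ge0.
have nR : 0 < n.+1%:R :> R by rewrite ltr0n.
have mn : (m.+1 <= n.+1)%N.
  rewrite -(ler_nat R) (le_trans meps)// ler_piMl ?ler0n//; lra.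
have E0 := expR_gt0 (eps * n.+1%:R / 4 * ln L).
set E := expR (eps * n.+1%:R / 4 * ln L) in E0 *.
have EE : E = expR (eps * n.+1%:R / 4 * ln L) by [].
clearbody E.
have D0 : 0 < D by exact: lt_le_trans D1.
rewrite (_ : 2 * expR (- (eps * n.+1%:R ^+ 2 / 2 * ln L)) = expR (- (eps * n.+1%:R ^+ 2 / 2 * ln L)) +
  expR (- (eps * n.+1%:R ^+ 2 / 2 * ln L))); last by ring.
apply: lerD.
  apply: (le_trans (derivative_tail_le n n.+1 T0 C0 CD D1 E0)).
  rewrite EE -expRM_natl -expRN -expRM_natl le_eqVlt; apply/orP; left; apply/eqP.
  by congr expR; field.
have hb := grid_value_tail_le k00 k01 kgt0 k1 T0 D1 mn meps Tn L0 E0 LE.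
apply: (@le_trans _ _ ((E / L ^+ n.+1) ^+ m.+1)).
  rewrite lerXn2r ?nnegrE//; last by rewrite divr_ge0 ?exprn_ge0 ?(ltW E0) ?(ltW L0).
  rewrite divr_ge0// mulr_ge0// mulr_ge0 ?divr_ge0 ?exprn_ge0 ?(ltW T0)//.
  by do 3 (apply: mulr_ge0; last by rewrite ?(ltW T0) ?(ltW D0) ?(ltW E0)); rewrite mulr_ge0 ?expR_ge0.
have LX : L ^+ n.+1 = expR (n.+1%:R * ln L) by rewrite expRM_natl lnK.
rewrite LX EE -expRN -expRD -expRM_natl ler_expR.
have mR : m.+2%:R <= 3 / 2 * m.+1%:R :> R.
  by rewrite -[m.+2%:R]natr1; have : 2 <= m.+1%:R :> R; [rewrite ler_nat|lra].
set N := n.+1%:R in nR epsm meps *; set mm := m.+1%:R in mR meps *; set l := ln L in l0 *.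
have h1 : eps * N / 2 <= mm * (1 - eps / 4).
  have : 0 <= mm by exact: ler0n.
  nra.
have h2 := ler_wpM2r (mulr_ge0 (ltW nR) l0) h1.
rewrite (_ : eps * N ^+ 2 / 2 * l = eps * N / 2 * (N * l)); last by ring.
rewrite (_ : mm * _ = - (mm * (1 - eps / 4) * (N * l))); last by field.
by rewrite lerN2.
Qed.

End Numerics.

Theorem theorem1p1 (R : realType) (d : measure_display)
    (Omega : measurableType d) (P : probability Omega R)
    (X : R -> {RV P >-> R}) (mu : probability (measurableTypeR R) R)
    (hgauss : gaussian_process X) (hcent : centered X) (hstat : stationary X)
    (hsmooth : smooth_paths X) (hspec : is_spectral_measure X mu)
    (hsym : symmetric_measure mu) (hac : nontrivial_ac_part mu)
    (hmom : finite_moments mu) :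
  exists c b B : R, [/\ 0 < c, 0 < b < 1, 0 < B < 1 &
    forall (eps : R) (n : nat) (T : R),
      0 < eps < 1 / 2 ->
      1 / eps ^+ 2 <= n%:R ->
      0 < T < b * (Num.floor (eps * n%:R))%:~R ->
      expR 1 <= B / (Dmom mu n `^ (1 / n%:R)) * (n%:R / T) `^ (1 - 2 * eps) ->
      ((expR (- (n%:R ^+ 2 * ln (c * n%:R / T))))%:E
         <= P [set w | (n%:R%:E <= num_zeros X T w)%E]
         <= (2 * expR (- (eps * n%:R ^+ 2 / 2
               * ln (B / (Dmom mu n `^ (1 / n%:R))
                     * (n%:R / T) `^ (1 - 2 * eps)))))%:E)%E].

Proof.
have [h0 [k0 [k [/andP[h00 h01] /andP[k00 k01] /andP[kgt0 k1] energy]]]] := trig_energy_ge hac.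
exists (60 * 30 * 4 / (k * k0)), (h0 / 2), (k * k0 / (16 * 16)).
have kk0 : 0 < k * k0 by exact: mulr_gt0.
split.
- by apply: divr_gt0 => //; do 2 apply: mulr_gt0 => //.
- by rewrite divr_gt0//= ltr_pdivrMr// mul1r (le_lt_trans h01)// ltr1n.
- apply/andP; split; first by apply: divr_gt0 => //; exact: mulr_gt0.
  rewrite ltr_pdivrMr ?mulr_gt0// mul1r.
  apply: (@le_lt_trans _ _ 1); first by rewrite mulr_ile1// ltW.
  by rewrite -natrM ltr1n.
move=> eps n T /andP[eps0 eps1] neps /andP[T0 Tm] HL.
have nR : 0 < n%:R :> R.
  by apply: lt_le_trans neps; rewrite divr_gt0// exprn_gt0.
(* [1 / eps ^ 2 <= n] gives [eps * n >= 1 / eps > 2], so there are at least two grid points. *)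
have epsn : 2 < eps * n%:R.
  have : eps^-1 <= eps * n%:R.
    rewrite mulrC -ler_pdivrMr// (le_trans _ neps)// le_eqVlt; apply/orP; left; apply/eqP.
    by field; rewrite gt_eqF.
  apply: lt_le_trans; rewrite invf_pgt ?posrE//; lra.
have [m [m0 mE meps epsm]] : exists m, [/\ (0 < m)%N,
    (Num.floor (eps * n%:R))%:~R = m.+1%:R :> R, m.+1%:R <= eps * n%:R & eps * n%:R <= m.+2%:R].
  have /andP[f1 f2] := floor_itv (eps * n%:R).
  have : 1 < (Num.floor (eps * n%:R))%:~R :> R by rewrite intrD in f2; lra.
  rewrite -[X in X < _]/(1%:~R) ltr_int; move: f1 f2; case: (Num.floor _) => // -[|[|m]]// f1 f2 _.
  exists m.+1; split => //; apply: ltW; rewrite -[m.+3%:R]natr1.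
  by move: f2; rewrite intrD.
rewrite mE in Tm; have mR : 0 < m.+1%:R :> R by rewrite ltr0n.
have epsn1 : eps * n%:R <= n%:R by rewrite ler_piMl ?ltW//; lra.
have Thm : T / m.+1%:R <= h0.
  by rewrite ler_pdivrMr// (le_trans (ltW Tm))// ler_wpM2r// ler_pdivrMr// ler_peMr ?ler1n// ltW.
have Thn : T / n%:R <= h0.
  apply: le_trans Thm; rewrite ler_wpM2l ?(ltW T0)// lef_pV2 ?posrE//.
  exact: le_trans epsn1.
have Tn : T <= n%:R.
  by move: Thn; rewrite ler_pdivrMr// => /le_trans; apply; rewrite ler_piMl ?(ltW nR).
case: n nR neps HL epsn meps epsm epsn1 Thn Tn {mE} => [|n nR neps HL epsn meps epsm epsn1 Thn Tn].
  by rewrite ltxx.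
apply/andP; split.
  apply: le_trans (zero_count_prob_ge hgauss hcent hstat hsmooth hspec k00 k01 kgt0 k1 h01 energy (ltn0Sn n) T0 Thn).
  by rewrite lee_fin; exact: alternating_bound_ge.
set L := _ / _ * _ in HL *.
have L1 : 1 <= L by apply: le_trans HL; rewrite -[leLHS]expR0 ler_expR.
set D := Dmom mu n.+1 in L HL L1 *.
have D1 : 1 <= D by rewrite /D /Dmom le_max lexx.
have C0 : 0 <= moment mu (2 * n.+1).
  by apply: Rintegral_ge0 => x _; rewrite exprn_ge0.
have CD : moment mu (2 * n.+1) <= D ^+ 2.
  rewrite -[leLHS]sqr_sqrtr// lerXn2r ?nnegrE ?sqrtr_ge0 ?(le_trans ler01 D1)//.
  by rewrite /D /Dmom !le_max lexx orbT.
have eps01 : 0 < eps < 1 / 2 by rewrite eps0.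
have [M ME] : exists M, M = 2 * expR 1 * n.+1%:R * T * D * expR (eps * n.+1%:R / 4 * ln L).
  by eexists.
have HM := upper_bound_le k00 k01 kgt0 k1 T0 C0 CD D1 eps01 m0 meps epsm Tn L1 erefl ME.
have M0 : 0 < M.
  by rewrite ME; do 4 (apply: mulr_gt0; last by rewrite ?expR_gt0 ?(lt_le_trans ltr01 D1)); rewrite mulr_gt0 ?expR_gt0.
apply: (le_trans (zero_count_prob_le hgauss hcent hstat hsmooth hspec hmom k00 kgt0 energy n T0 M0 Thm)).
by rewrite lee_fin.
Qed.
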